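(* The stationary solution $(a,\beta)$ of the amplitude-phase system (S) displayed in the context satisfies $$-\frac{F_m\sin\beta}{2\omega}-\frac{\lambda a}{2}+\epsilon A_1(a,\beta,\sigma)+O(\epsilon^2)=0,$$ $$-\sigma+\frac{3da^2}{8\omega}-\frac{F_m\cos\beta}{2a\omega}+\epsilon A_2(a,\beta,\sigma)+O(\epsilon^2)=0,$$ with $$A_1(a,\beta,\sigma)=\frac{3d\lambda a^3}{16\omega^2}+\frac{\sigma F_m\sin\beta}{4\omega^2}+\frac{\lambda F_m\cos\beta}{8\omega^2}+\frac{9da^2F_m\sin\beta}{32\omega^3},$$ $$A_2(a,\beta,\sigma)=-\frac{\lambda^2}{8\omega}-\frac{15d^2a^4}{256\omega^3}-\frac{5c^2a^2}{12\omega^3}+\frac{\sigma F_m\cos\beta}{4\omega^2a}+\frac{3daF_m\cos\beta}{32\omega^3}-\frac{\lambda F_m\sin\beta}{8\omega^2a}.$$ This stationary solution reaches its maximum amplitude (with respect to $\sigma$) for $\sigma=\sigma_0^*+\epsilon\sigma_1^*+O(\epsilon^2)$, $a^*=a_0^*+\epsilon a_1^*+O(\epsilon^2)$, $\beta^*=\beta_0^*+\epsilon\beta_1^*+O(\epsilon^2)$ with $$a_0^*=\frac{F_m}{\lambda\omega},\qquad\sigma_0^*=\frac{3da_0^{*2}}{8\omega}=\frac{3dF_m^2}{8\lambda^2\omega^3},\qquad\beta_0^*=-\frac\pi2,$$ $$\sigma_1^*=-\frac{29}{12\omega}\sigma_0^{*2}-\frac{5c^2a_0^{*2}}{12\omega^3}-\frac{\lambda^2}{4\omega}=-\frac{87d^2a_0^{*4}}{256\omega^3}-\frac{5c^2a_0^{*2}}{12\omega^3}-\frac{\lambda^2}{4\omega},\qquad\beta_1^*=-\frac{\lambda}{2\omega},\qquad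 a_1^*=-\frac{a_0^*\sigma_0^*}{\omega}.$$ The periodic forcing is then at the angular frequency $$\tilde\omega_\epsilon=\omega+\epsilon\sigma_0^*+\epsilon^2\sigma_1^*+O(\epsilon^3),$$ which is slightly different from the approximate angular frequency $\nu_\epsilon$ of the undamped free periodic solution associated to the same amplitude. For this frequency, the approximation (up to the order $\epsilon^2$) of the solution $\tilde u=\epsilon u$ of $$\ddot{\tilde u}+\omega^2\tilde u+\epsilon\lambda\dot{\tilde u}+c\tilde u^2+\frac d\epsilon\tilde u^3=\epsilon^2F_m\cos(\tilde\omega_\epsilon t)$$ is periodic: $$\tilde u(t)=\epsilon a^*\cos(\tilde\omega_\epsilon t+\beta^* )+\epsilon^2\left[-\frac{ca^{*2}}{2\omega^2}+\frac{ca^{*2}}{6\omega^2}\cos(2(\tilde\omega_\epsilon t+\beta^* ))+\frac{da^{*3}}{32\omega^2}\cos(3(\tilde\omega_\epsilon t+\beta^* ))\right]+\epsilon^3r(\epsilon,t),$$ $$\tilde u(0)=\epsilon a^*+\epsilon^2\left[-\frac{ca^{*2}}{3\omega^2}+\frac{da^{*3}}{32\omega^2}\right]+O(\epsilon^3),\qquad\dot u(0)=O(\epsilon^3),$$ with $r$ bounded in $C^2(0,t_\epsilon)$.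
   Context: $\omega>0$, $\lambda>0$ (damping), $c,d,F_m,\sigma$ are real constants, and $\epsilon>0$ is a small parameter. The forcing frequency is $\tilde\omega_\epsilon=\omega+\epsilon\sigma$. The amplitude-phase system (S) is $$\frac{da}{dt}=\epsilon\left(-\frac{F_m\sin\beta}{2\omega}-\frac{\lambda a}{2}\right)+\epsilon^2A_1(a,\beta,\sigma)+O(\epsilon^3),\qquad\frac{d\beta}{dt}=\epsilon\left(-\sigma+\frac{3da^2}{8\omega}-\frac{F_m\cos\beta}{2a\omega}\right)+\epsilon^2A_2(a,\beta,\sigma)+O(\epsilon^3)$$ with $A_1,A_2$ as displayed in the claim. A stationary solution is a pair $(a,\beta)$, depending on $\sigma$ and $\epsilon$, at which both right-hand sides vanish. The undamped free equation is $\ddot{\tilde u}+\omega^2\tilde u+c\tilde u^2+\frac d\epsilon\tilde u^3=0$; its approximate angular frequency for amplitude $a$ is $\nu_\epsilon=\omega+\epsilon\frac{3da^2}{8\omega}+\epsilon^2\left(-\frac{5c^2a^2}{12\omega^3}-\frac{15d^2a^4}{256\omega^3}\right)+O(\epsilon^3)$. The final time is $t_\epsilon=\varsigma/\epsilon^2$ for some constant $\varsigma>0$. Bounded in $C^2(0,t_\epsilon)$ means that $r(\epsilon,\cdot)$ and its first two time derivatives are bounded on $(0,t_\epsilon)$ by a constant independent of $\epsilon$.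
   Formalization: β₁* is +λ/(2ω) (the printed sign is false); the initial values are taken at t=-β*/ω̃_ε, where the phase vanishes, not at t=0; the O(ε³) terms of (S) also have O(ε³) Lipschitz constants; F_m≠0; the maximum is over a bounded range of a and σ away from a=0. *)

(* Defs.v *)
From Stdlib Require Import Reals.
From Coquelicot Require Import Coquelicot.

Open Scope R_scope.

Definition A_1 (omega lambda d Fm a beta sigma : R) : R :=
  3 * d * lambda * a ^ 3 / (16 * omega ^ 2)
  + sigma * Fm * sin beta / (4 * omega ^ 2)
  + lambda * Fm * cos beta / (8 * omega ^ 2)
  + 9 * d * a ^ 2 * Fm * sin beta / (32 * omega ^ 3).

Definition A_2 (omega lambda c d Fm a beta sigma : R) : R :=
  - lambda ^ 2 / (8 * omega)
  - 15 * d ^ 2 * a ^ 4 / (256 * omega ^ 3)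
  - 5 * c ^ 2 * a ^ 2 / (12 * omega ^ 3)
  + sigma * Fm * cos beta / (4 * omega ^ 2 * a)
  + 3 * d * a * Fm * cos beta / (32 * omega ^ 3)
  - lambda * Fm * sin beta / (8 * omega ^ 2 * a).

(* First-order parts of the two right-hand sides of the amplitude-phase
   system. *)
Definition G1 (omega lambda Fm a beta : R) : R :=
  - (Fm * sin beta) / (2 * omega) - lambda * a / 2.

Definition G2 (omega d Fm a beta sigma : R) : R :=
  - sigma + 3 * d * a ^ 2 / (8 * omega) - Fm * cos beta / (2 * a * omega).

(* The O(eps^3) terms of the system are arbitrary functions [rho1] and [rho2]
   of [eps a beta sigma]. *)
Definition rhs_amplitude (omega lambda d Fm : R) (rho1 : R -> R -> R -> R -> R)
    (eps a beta sigma : R) : R :=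
  eps * G1 omega lambda Fm a beta
  + eps ^ 2 * A_1 omega lambda d Fm a beta sigma + rho1 eps a beta sigma.

Definition rhs_phase (omega lambda c d Fm : R) (rho2 : R -> R -> R -> R -> R)
    (eps a beta sigma : R) : R :=
  eps * G2 omega d Fm a beta sigma
  + eps ^ 2 * A_2 omega lambda c d Fm a beta sigma + rho2 eps a beta sigma.

(* Bounded range of amplitude, phase and detuning, away from the singularity
   a = 0, on which the expansions in eps are meaningful.  The pairs (a, beta),
   (a, beta + 2 PI) and (- a, beta + PI) describe the same motion
   a cos(theta + beta); the representative is normalized by giving a the sign
   of Fm (hence a > 0 when Fm > 0) and taking beta in [-PI, PI]. *)
Definition in_range (Fm m M a beta sigma : R) : Prop :=
  0 < Fm * a /\ m <= Rabs a <= M /\ - PI <= beta <= PI /\ Rabs sigma <= M.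

(* [rho] is O(eps^3), uniformly on every range, together with its Lipschitz
   constant in (a, beta, sigma).  The Lipschitz bound (implied by O(eps^3)
   bounds on the first partial derivatives) is needed to locate a maximum with
   respect to sigma up to O(eps^2): a bound on the values alone would only
   locate it up to O(eps), because the maximum is quadratic. *)
Definition remainder_O3 (Fm : R) (rho : R -> R -> R -> R -> R) : Prop :=
  forall m M : R, 0 < m -> exists C eps0 : R, 0 < eps0 /\
  forall eps a beta sigma a' beta' sigma' : R, 0 < eps < eps0 ->
    in_range Fm m M a beta sigma -> in_range Fm m M a' beta' sigma' ->
    Rabs (rho eps a beta sigma) <= C * eps ^ 3 /\
    Rabs (rho eps a beta sigma - rho eps a' beta' sigma')
      <= C * eps ^ 3
         * (Rabs (a - a') + Rabs (beta - beta') + Rabs (sigma - sigma')).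

Definition stationary (omega lambda c d Fm : R)
    (rho1 rho2 : R -> R -> R -> R -> R) (eps a beta sigma : R) : Prop :=
  rhs_amplitude omega lambda d Fm rho1 eps a beta sigma = 0 /\
  rhs_phase omega lambda c d Fm rho2 eps a beta sigma = 0.

(* (a, beta), at detuning sigma, has maximal amplitude among the stationary
   solutions at all detunings in the range. *)
Definition max_amplitude (omega lambda c d Fm : R)
    (rho1 rho2 : R -> R -> R -> R -> R) (m M eps a beta sigma : R) : Prop :=
  stationary omega lambda c d Fm rho1 rho2 eps a beta sigma /\
  in_range Fm m M a beta sigma /\
  forall a' beta' sigma' : R,
    stationary omega lambda c d Fm rho1 rho2 eps a' beta' sigma' ->
    in_range Fm m M a' beta' sigma' -> Rabs a' <= Rabs a.

Definition a0star (omega lambda Fm : R) : R := Fm / (lambda * omega).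

Definition sigma0star (omega lambda d Fm : R) : R :=
  3 * d * a0star omega lambda Fm ^ 2 / (8 * omega).

Definition beta0star : R := - (PI / 2).

Definition a1star (omega lambda d Fm : R) : R :=
  - (a0star omega lambda Fm * sigma0star omega lambda d Fm) / omega.

Definition sigma1star (omega lambda c d Fm : R) : R :=
  - (29 / (12 * omega)) * sigma0star omega lambda d Fm ^ 2
  - 5 * c ^ 2 * a0star omega lambda Fm ^ 2 / (12 * omega ^ 3)
  - lambda ^ 2 / (4 * omega).

(* The sign is +: the source prints - lambda / (2 omega), a misprint.  At first
   order in eps, the phase equation at the maximum reads
     - sigma1 + 3 d a0 a1 / (4 omega) - lambda beta1 / 2 + A_2 (a0, beta0, sigma0)
     = 0,
   which with the values of [a1star] and [sigma1star] forces
   beta1 = + lambda / (2 omega). *)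
Definition beta1star (omega lambda : R) : R := lambda / (2 * omega).

(* [nu eps a] is an angular frequency of the undamped free vibration of
   amplitude a, known up to O(eps^3). *)
Definition free_frequency (omega c d : R) (nu : R -> R -> R) : Prop :=
  forall M : R, exists C eps0 : R, 0 < eps0 /\
  forall eps a : R, 0 < eps < eps0 -> Rabs a <= M ->
    Rabs (nu eps a
          - (omega + eps * (3 * d * a ^ 2 / (8 * omega))
             + eps ^ 2 * (- (5 * c ^ 2 * a ^ 2) / (12 * omega ^ 3)
                          - 15 * d ^ 2 * a ^ 4 / (256 * omega ^ 3))))
      <= C * eps ^ 3.

Definition forced_solution (omega lambda c d Fm eps freq T : R) (u : R -> R)
    : Prop :=
  forall t : R, 0 < t < T ->
    ex_derive u t /\ ex_derive (Derive u) t /\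
    Derive_n u 2 t + omega ^ 2 * u t + eps * lambda * Derive u t
      + c * u t ^ 2 + d / eps * u t ^ 3
    = eps ^ 2 * Fm * cos (freq * t).

Definition approximation (omega c d eps freq a beta t : R) : R :=
  eps * a * cos (freq * t + beta)
  + eps ^ 2 * (- (c * a ^ 2) / (2 * omega ^ 2)
               + c * a ^ 2 / (6 * omega ^ 2) * cos (2 * (freq * t + beta))
               + d * a ^ 3 / (32 * omega ^ 2) * cos (3 * (freq * t + beta))).

Definition initial_value (omega c d eps a : R) : R :=
  eps * a
  + eps ^ 2 * (- (c * a ^ 2) / (3 * omega ^ 2) + d * a ^ 3 / (32 * omega ^ 2)).

(* The initial data of the source, u = initial_value + O(eps^3) and
   u' = O(eps^3), are the values of the approximation at the instant where the
   phase freq * t + beta vanishes.  They are imposed at that instant: in the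
   time of the forcing cos (freq * t) it is not t = 0, where the phase is
   beta, close to - PI / 2. *)
Definition zero_phase_time (freq beta : R) : R := - beta / freq.

Definition C2_bounded (C T : R) (r : R -> R) : Prop :=
  forall t : R, 0 < t < T ->
    ex_derive r t /\ ex_derive (Derive r) t /\ continuous (Derive_n r 2) t /\
    Rabs (r t) <= C /\ Rabs (Derive r t) <= C /\ Rabs (Derive_n r 2 t) <= C.

(* Main.v *)
Require Import Defs.
From Stdlib Require Import Reals Lra Lia.
From Coquelicot Require Import Coquelicot.

Open Scope R_scope.

(* In the variables x = a / a0, b = beta + PI / 2 the stationary equations read
     x = cos b + O(eps),   s = s0 x^2 - (lambda / 2) sin b / x + O(eps),
   with Lipschitz remainders, so that the stationary points form a curve
   parametrized by b.  The O(eps) term of x contributes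
   eps lambda b / (2 omega) to first order in b, hence x is maximal near
   b = eps lambda / (2 omega); comparing the maximum with the stationary point
   of exactly that phase, and using that cos is strongly concave near 0, bounds
   the distance by O(eps^2).  The expansions of a and sigma follow by
   substitution.

   For the differential equation, write u = eps (v_0 + eps v_1 + eps^2 v_2)
   + eps^3 y, where v_0 + eps v_1 is the stated approximation and v_2 removes
   the nonresonant terms of order eps^2; the stationary equations are exactly
   what makes the resonant terms O(eps^3).  Then y solves an equation with
   bounded forcing eps rho, whose linear part averages, in the frame rotating
   with the forcing, to a Jordan block with double eigenvalue - eps lambda / 2.
   A quadratic form adapted to this block, corrected by a term of order eps
   that absorbs the oscillations, decreases as soon as it is large, which
   confines y for all later times. *)

(** * Fixed points, barriers and differential equations *)

(** Damping is what carries the estimate to the time varsigma / eps^2. A Gronwall bound for y has a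
    rate of order eps and would lose a factor exp (C / eps), whereas an energy that decreases when
    it is large gives a bound independent of T.

    Since d may have either sign, the cubic term could make u blow up, so existence on (0, T) is not
    automatic. The quadratic and cubic terms are therefore clamped outside |u| <= L eps: the clamped
    equation has global solutions, and confinement shows that the clamp is never active. There is no
    circularity, because the energy level is fixed by the damping, the residual and the initial data
    before the region is chosen in which the O(eps^2) errors of the slope are estimated; L and the
    threshold for eps come last. *)

Ltac triangle := apply Rle_trans with (1 := Rabs_triang _ _).

Lemma small_epsilon (k v : R) : 0 <= k -> 0 < v ->
  exists e, 0 < e <= 1 /\ forall eps, 0 < eps < e -> k * eps < v.
Proof.
  intros Hk Hv. exists (Rmin 1 (v / (k + 1))).
  assert (Hq : 0 < v / (k + 1)) by (apply Rdiv_lt_0_compat; lra).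
  split; [split; [apply Rmin_glb_lt; lra|apply Rmin_l]|].
  intros eps He.
  assert (H : eps < v / (k + 1)) by (apply Rlt_le_trans with (1 := proj2 He), Rmin_r).
  assert (eps * (k + 1) < v).
  { replace v with (v / (k + 1) * (k + 1)) by (field; lra). apply Rmult_lt_compat_r; lra. }
  lra.
Qed.

Lemma common_bound (e f : R) : 0 < e -> 0 < f -> exists g, 0 < g /\ g <= e /\ g <= f.
Proof.
  intros He Hf. exists (Rmin e f).
  split; [now apply Rmin_glb_lt|]. split; [apply Rmin_l|apply Rmin_r].
Qed.

Lemma lipschitz_continuity (f : R -> R) (L : R) :
  (forall x y, Rabs (f x - f y) <= L * Rabs (x - y)) -> continuity f.
Proof.
  intros Hf x e He.
  assert (HL : 0 < Rabs L + 1) by (generalize (Rabs_pos L); lra).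
  exists (e / (Rabs L + 1)); split; [now apply Rdiv_lt_0_compat|].
  intros y [_ Hy]; simpl in *; unfold Rdist in *.
  apply Rle_lt_trans with (1 := Hf y x).
  apply Rle_lt_trans with ((Rabs L + 1) * Rabs (y - x)).
  - apply Rmult_le_compat_r; [apply Rabs_pos|]. generalize (Rle_abs L); lra.
  - apply Rmult_lt_reg_r with (/ (Rabs L + 1)); [now apply Rinv_0_lt_compat|].
    replace ((Rabs L + 1) * Rabs (y - x) * / (Rabs L + 1)) with (Rabs (y - x))
      by (field; lra).
    exact Hy.
Qed.

(** On the real line the intermediate value theorem replaces iteration: x - f x changes sign on
    [- r, r]. The existence is informative so that the parametric version can define [g] by
    projection. *)
Lemma contraction_fixpoint (f : R -> R) (k : R) :
  0 <= k < 1 -> (forall x y, Rabs (f x - f y) <= k * Rabs (x - y)) ->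
  {x : R | f x = x}.
Proof.
  intros Hk Hf.
  set (r := Rabs (f 0) / (1 - k)).
  assert (Hr : 0 <= r).
  { apply Rmult_le_pos; [apply Rabs_pos|]. apply Rlt_le, Rinv_0_lt_compat; lra. }
  assert (Er : Rabs (f 0) = (1 - k) * r) by (unfold r; field; lra).
  assert (Hc : continuity (fun x => x - f x)).
  { apply continuity_minus; [apply derivable_continuous, derivable_id|].
    exact (lipschitz_continuity f k Hf). }
  assert (Hp : 0 <= r - f r).
  { generalize (Hf r 0). rewrite Rminus_0_r, (Rabs_right r) by lra.
    intros H; apply Rabs_le_between in H.
    generalize (Rle_abs (f 0)); nra. }
  assert (Hn : - r - f (- r) <= 0).
  { generalize (Hf (- r) 0). rewrite Rminus_0_r, Rabs_Ropp, (Rabs_right r) by lra.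
    intros H; apply Rabs_le_between in H.
    generalize (Rle_abs (- f 0)); rewrite Rabs_Ropp; nra. }
  destruct (IVT_gen (fun x => x - f x) (- r) r 0 Hc) as [x [_ Hx]].
  - split; [apply Rle_trans with (2 := Hn); apply Rmin_l|].
    apply Rle_trans with (1 := Hp); apply Rmax_r.
  - exists x; lra.
Qed.

(** Moving the parameter moves f by L dist, and the contraction amplifies this by 1 / (1 - k).
    [dist] is asked to vanish on the diagonal and nothing more, so pairs can serve as parameters
    without a metric structure. *)
Lemma contraction_fixpoint_parametric (Y : Type) (dist : Y -> Y -> R)
    (f : Y -> R -> R) (k L : R) :
  0 <= k < 1 -> (forall y, dist y y = 0) ->
  (forall y y' x x', Rabs (f y x - f y' x') <= k * Rabs (x - x') + L * dist y y') ->
  exists g : Y -> R,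
    (forall y, f y (g y) = g y) /\
    (forall y x, f y x = x -> x = g y) /\
    (forall y y', Rabs (g y - g y') <= L / (1 - k) * dist y y').
Proof.
  intros Hk H0 Hf.
  assert (Hf' : forall y x x', Rabs (f y x - f y x') <= k * Rabs (x - x')).
  { intros y x x'. generalize (Hf y y x x'). rewrite H0; lra. }
  exists (fun y => proj1_sig (contraction_fixpoint (f y) k Hk (Hf' y))).
  split; [|split].
  - intros y. apply (proj2_sig (contraction_fixpoint (f y) k Hk (Hf' y))).
  - intros y x Hx.
    destruct (contraction_fixpoint (f y) k Hk (Hf' y)) as [z Hz]; simpl.
    generalize (Hf' y x z). rewrite Hx, Hz. intros H.
    assert (Hxz : Rabs (x - z) = 0) by (generalize (Rabs_pos (x - z)); nra).
    generalize (Rabs_eq_0 _ Hxz); lra.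
  - intros y y'.
    destruct (contraction_fixpoint (f y) k Hk (Hf' y)) as [z Hz]; simpl.
    destruct (contraction_fixpoint (f y') k Hk (Hf' y')) as [z' Hz']; simpl.
    generalize (Hf y y' z z'). rewrite Hz, Hz'. intros H.
    replace (L / (1 - k) * dist y y') with (L * dist y y' / (1 - k)) by (field; lra).
    apply Rle_div_r; lra.
Qed.

Lemma continuous_lt_locally (f : R -> R) (s b : R) :
  continuous f s -> f s < b ->
  exists del, 0 < del /\ forall r, Rabs (r - s) < del -> f r < b.
Proof.
  intros Hc Hs.
  destruct (Hc (fun y => y < b)) as [del Hdel].
  { exists (mkposreal (b - f s) (proj2 (Rlt_0_minus _ _) Hs)). intros y Hy.
    change (Rabs (y - f s) < b - f s) in Hy.
    apply Rabs_lt_between in Hy; lra. }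
  exists del; split; [apply cond_pos|]. intros r Hr; apply Hdel, Hr.
Qed.

Lemma is_derive_neg_left (f : R -> R) (s l : R) :
  is_derive f s l -> l < 0 ->
  exists del, 0 < del /\ forall r, s - del < r < s -> f s < f r.
Proof.
  intros Hd Hl. apply is_derive_Reals in Hd.
  destruct (Hd (- l / 2)) as [del Hdel]; [lra|].
  exists del; split; [apply cond_pos|]. intros r Hr.
  assert (H : Rabs ((f (s + (r - s)) - f s) / (r - s) - l) < - l / 2).
  { apply Hdel; [lra|]. rewrite Rabs_left; lra. }
  replace (s + (r - s)) with r in H by ring.
  apply Rabs_lt_between in H.
  assert (E : f r - f s = (f r - f s) / (r - s) * (r - s)) by (field; lra).
  nra.
Qed.

(** First-crossing argument. The sign of the derivative is asked only at points of the level b,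
    which is where an energy estimate supplies it. *)
Lemma barrier_right (f : R -> R) (t0 T b : R) :
  (forall t, t0 <= t < T -> continuous f t) -> f t0 < b ->
  (forall t, t0 < t < T -> f t = b -> exists l, is_derive f t l /\ l < 0) ->
  forall t, t0 <= t < T -> f t < b.
Proof.
  intros Hc H0 Hb t1 Ht1.
  destruct (Rlt_le_dec (f t1) b) as [|Hge]; [assumption|exfalso].
  set (E := fun s => t0 <= s <= t1 /\ forall r, t0 <= r <= s -> f r < b).
  destruct (completeness E) as [s [Hub Hlub]].
  { exists t1. intros s [Hs _]; lra. }
  { exists t0. split; [lra|]. intros r Hr. replace r with t0 by lra. exact H0. }
  assert (Hs0 : t0 <= s).
  { apply Hub. split; [lra|]. intros r Hr. replace r with t0 by lra. exact H0. }
  assert (Hs1 : s <= t1) by (apply Hlub; intros r [Hr _]; lra).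
  assert (Hleft : forall r, t0 <= r < s -> f r < b).
  { intros r Hr. destruct (Rlt_le_dec (f r) b) as [|Hr']; [assumption|exfalso].
    assert (s <= r); [|lra]. apply Hlub. intros x [Hx Hx'].
    destruct (Rle_lt_dec x r) as [|Hxr]; [assumption|].
    generalize (Hx' r); lra. }
  assert (Hnear : forall del, 0 < del -> t0 <> s -> exists r, t0 <= r < s /\ s - del < r).
  { intros del Hdel Hne. exists (Rmax t0 (s - del / 2)).
    split; [split; [apply Rmax_l|apply Rmax_lub_lt; lra]|].
    apply Rlt_le_trans with (2 := Rmax_r _ _); lra. }
  (* s is the supremum of the times up to which f stays below b. If f s < b, this extends past s by
     continuity; f s = b contradicts the negative slope, since f < b on the left; f s > b
     contradicts continuity from the left. *)
  destruct (Rtotal_order (f s) b) as [Hlt|[Heq|Hgt]].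
  - destruct (continuous_lt_locally f s b) as [del [Hdel Hn]]; [apply Hc; lra|lra|].
    assert (s <> t1) by (intros ->; lra).
    set (x := Rmin t1 (s + del / 2)).
    assert (Hx : s < x /\ x <= t1 /\ x <= s + del / 2).
    { unfold x; split; [apply Rmin_glb_lt; lra|]. split; [apply Rmin_l|apply Rmin_r]. }
    assert (x <= s); [|lra]. apply Hub. split; [lra|]. intros r Hr.
    destruct (Rlt_le_dec r s); [apply Hleft; lra|].
    apply Hn. rewrite Rabs_right; lra.
  - assert (t0 <> s) by (intros ->; lra).
    destruct (Hb s) as [l [Hl Hneg]]; [lra|exact Heq|].
    destruct (is_derive_neg_left f s l Hl Hneg) as [del [Hdel Hn]].
    destruct (Hnear del Hdel) as [r [Hr Hr']]; [assumption|].
    generalize (Hleft r Hr) (Hn r); lra.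
  - assert (Hcn : continuous (fun x => - f x) s).
    { apply (continuous_opp f). apply Hc; lra. }
    destruct (continuous_lt_locally (fun x => - f x) s (- b)) as [del [Hdel Hn]];
      [exact Hcn|lra|].
    assert (t0 <> s) by (intros ->; lra).
    destruct (Hnear del Hdel) as [r [Hr Hr']]; [assumption|].
    generalize (Hleft r Hr). assert (- f r < - b); [|lra].
    apply Hn. rewrite Rabs_left; lra.
Qed.

(** Time reversal t -> - t of [barrier_right]. *)
Lemma barrier_left (f : R -> R) (t0 T b : R) :
  (forall t, T < t <= t0 -> continuous f t) -> f t0 < b ->
  (forall t, T < t < t0 -> f t = b -> exists l, is_derive f t l /\ 0 < l) ->
  forall t, T < t <= t0 -> f t < b.
Proof.
  intros Hc H0 Hb t Ht.
  assert (H : forall s, - t0 <= s < - T -> f (- s) < b).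
  { apply (barrier_right (fun s => f (- s))).
    - intros s Hs. apply (continuous_comp Ropp f).
      + apply (continuous_opp (fun x : R => x) s (continuous_id s)).
      + apply Hc; lra.
    - now rewrite Ropp_involutive.
    - intros s Hs Hs'. destruct (Hb (- s)) as [l [Hl Hl']]; [lra|exact Hs'|].
      exists (- l); split; [|lra].
      replace (- l) with (scal (- 1) l) by (unfold scal; simpl; unfold mult; simpl; ring).
      apply (is_derive_comp f Ropp); [exact Hl|].
      auto_derive; [trivial|ring]. }
  rewrite <- (Ropp_involutive t). apply H; lra.
Qed.

Lemma is_lim_seq_half_pow (K : R) : is_lim_seq (fun n => K * (1 / 2) ^ n) 0.
Proof.
  replace (Finite 0) with (Rbar_mult K 0) by (simpl; now rewrite Rmult_0_r).
  apply (is_lim_seq_scal_l (fun n => (1 / 2) ^ n) K 0).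
  apply is_lim_seq_geom. rewrite Rabs_right; lra.
Qed.

(** Banach's theorem for the weighted norm sup |y| / E, carried out pointwise on the Picard
    iterates. The weight may be unbounded on R; its local bound makes the convergence locally
    uniform, so that the limit is continuous. *)
Lemma weighted_fixpoint (E : R -> R) (Phi : (R -> R) -> R -> R) (A : R) :
  (forall t, 0 < E t) ->
  (forall t, exists B, forall s, Rabs (s - t) < 1 -> E s <= B) ->
  (forall y, (forall t, continuous y t) -> forall t, continuous (Phi y) t) ->
  (forall K y y', (forall t, continuous y t) -> (forall t, continuous y' t) ->
     (forall t, Rabs (y t - y' t) <= K * E t) ->
     forall t, Rabs (Phi y t - Phi y' t) <= K / 2 * E t) ->
  (forall t, Rabs (Phi (fun _ => 0) t) <= A * E t) ->
  exists y, (forall t, continuous y t) /\ forall t, Phi y t = y t.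
Proof.
  intros HE HB HPc HPk HA.
  set (y := fun n => Nat.iter n Phi (fun _ => 0)).
  assert (HA0 : 0 <= A).
  { generalize (HA 0) (HE 0) (Rabs_pos (Phi (fun _ => 0) 0)); nra. }
  assert (yc : forall n t, continuous (y n) t).
  { induction n; [intros t; apply continuous_const|]. exact (HPc _ IHn). }
  assert (ystep : forall n t, Rabs (y (S n) t - y n t) <= A * (1 / 2) ^ n * E t).
  { induction n as [|n IH]; intros t.
    - unfold y; simpl. rewrite Rminus_0_r, Rmult_1_r. apply HA.
    - replace (A * (1 / 2) ^ S n * E t) with (A * (1 / 2) ^ n / 2 * E t)
        by (simpl; field).
      exact (HPk _ _ _ (yc (S n)) (yc n) IH t). }
  assert (ydist : forall n p t,
    Rabs (y (n + p)%nat t - y n t) <= 2 * A * (1 / 2) ^ n * (1 - (1 / 2) ^ p) * E t).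
  { intros n p t. induction p as [|p IH].
    - rewrite Nat.add_0_r, Rminus_diag, Rabs_R0; simpl; lra.
    - replace (y (n + S p)%nat t - y n t)
        with ((y (S (n + p)) t - y (n + p)%nat t) + (y (n + p)%nat t - y n t))
        by (rewrite Nat.add_succ_r; ring).
      triangle.
      generalize (ystep (n + p)%nat t). rewrite pow_add.
      simpl ((1 / 2) ^ S p). lra. }
  assert (hp : forall n, 0 < (1 / 2) ^ n) by (intros n; apply pow_lt; lra).
  assert (ydist' : forall n p t,
    Rabs (y (n + p)%nat t - y n t) <= 2 * A * E t * (1 / 2) ^ n).
  { intros n p t. apply Rle_trans with (1 := ydist n p t).
    assert (0 <= 2 * A * (1 / 2) ^ n * E t)
      by (repeat apply Rmult_le_pos; try lra; [apply Rlt_le, hp|apply Rlt_le, HE]).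
    generalize (hp p); nra. }
  assert (ylim : forall t, ex_finite_lim_seq (fun n => y n t)).
  { intros t. apply ex_lim_seq_cauchy_corr. intros e.
    assert (H := is_lim_seq_half_pow (2 * A * E t)). apply is_lim_seq_spec in H.
    destruct (H (mkposreal (e / 2) (is_pos_div_2 e))) as [N HN]. simpl in HN.
    exists N. intros n m Hn Hm.
    assert (HNN := HN N (le_n N)). rewrite Rminus_0_r in HNN.
    apply Rabs_lt_between in HNN.
    replace n with (N + (n - N))%nat by lia. replace m with (N + (m - N))%nat by lia.
    generalize (ydist' N (n - N)%nat t) (ydist' N (m - N)%nat t). intros H1 H2.
    apply Rabs_le_between in H1. apply Rabs_le_between in H2.
    apply Rabs_def1; lra. }
  set (z := fun t => real (Lim_seq (fun n => y n t))).
  assert (zlim : forall t, is_lim_seq (fun n => y n t) (z t)).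
  { intros t. apply Lim_seq_correct', ylim. }
  assert (zdist : forall n t, Rabs (z t - y n t) <= 2 * A * E t * (1 / 2) ^ n).
  { intros n t.
    assert (H : is_lim_seq (fun p => Rabs (y (n + p)%nat t - y n t)) (Rabs (z t - y n t))).
    { apply (is_lim_seq_abs _ (Finite (z t - y n t))).
      apply is_lim_seq_minus'; [|apply is_lim_seq_const].
      apply is_lim_seq_ext with (fun p => y (p + n)%nat t).
      { intros p. now rewrite Nat.add_comm. }
      apply (is_lim_seq_incr_n (fun p => y p t) n), zlim. }
    apply (is_lim_seq_le _ (fun _ => 2 * A * E t * (1 / 2) ^ n) _ _
             (fun p => ydist' n p t) H (is_lim_seq_const _)). }
  assert (zc : forall t, continuous z t).
  { intros t. apply continuity_pt_filterlim.
    destruct (HB t) as [B HBt].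
    apply (CVU_continuity y z t (mkposreal 1 Rlt_0_1)).
    - intros e He.
      assert (H := is_lim_seq_half_pow (2 * A * B)). apply is_lim_seq_spec in H.
      destruct (H (mkposreal e He)) as [N HN]. simpl in HN.
      exists N. intros n s Hn Hs.
      apply Rle_lt_trans with (1 := zdist n s).
      specialize (HN n Hn). rewrite Rminus_0_r in HN. apply Rabs_lt_between in HN.
      apply Rle_lt_trans with (2 := proj2 HN).
      apply Rmult_le_compat_r; [apply Rlt_le, hp|].
      apply Rmult_le_compat_l; [lra|]. apply HBt, Hs.
    - intros n s _. apply continuity_pt_filterlim, yc.
    - unfold Boule; simpl. rewrite Rminus_diag, Rabs_R0; lra. }
  exists z; split; [exact zc|]. intros t.
  (* The contraction hypothesis applied to [z] and [y n] shows that the shifted iterates also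
     converge to Phi z, and limits are unique. *)
  assert (H : is_lim_seq (fun n => y (S n) t) (Phi z t)).
  { apply is_lim_seq_spec. intros e.
    assert (H := is_lim_seq_half_pow (A * E t)). apply is_lim_seq_spec in H.
    destruct (H e) as [N HN]. exists N. intros n Hn.
    specialize (HN n Hn). rewrite Rminus_0_r in HN. apply Rabs_lt_between in HN.
    rewrite <- Rabs_Ropp, Ropp_minus_distr.
    apply Rle_lt_trans with (2 := proj2 HN).
    replace (A * E t * (1 / 2) ^ n) with (2 * A * (1 / 2) ^ n / 2 * E t) by field.
    apply (HPk (2 * A * (1 / 2) ^ n) z (y n)); [exact zc|apply yc|].
    intros s. generalize (zdist n s). lra. }
  assert (H' := zlim t). apply is_lim_seq_incr_1 in H'.
  apply is_lim_seq_unique in H. apply is_lim_seq_unique in H'.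
  rewrite H' in H. now injection H.
Qed.

(** Equal to 2 cosh (mu (t - t0)): a weight that grows on both sides of t0, so that the equation is
    solved forward and backward at once. *)
Definition two_sided_exp (mu t0 t : R) : R :=
  exp (mu * (t - t0)) + exp (- (mu * (t - t0))).

Lemma two_sided_exp_ge1 (mu t0 t : R) : 1 <= two_sided_exp mu t0 t.
Proof.
  unfold two_sided_exp.
  generalize (exp_pos (mu * (t - t0))) (exp_pos (- (mu * (t - t0)))).
  destruct (Rle_dec 0 (mu * (t - t0))).
  - generalize (exp_ineq1_le (mu * (t - t0))); lra.
  - generalize (exp_ineq1_le (- (mu * (t - t0)))); lra.
Qed.

(** Integration from t0 gains a factor 1 / mu in the weighted norm, which makes the Picard map a
    contraction for large mu. *)
Lemma RInt_two_sided_exp (mu t0 K : R) (f : R -> R) :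
  0 < mu -> (forall s, continuous f s) ->
  (forall s, Rabs (f s) <= K * two_sided_exp mu t0 s) ->
  forall t, Rabs (RInt f t0 t) <= K / mu * two_sided_exp mu t0 t.
Proof.
  intros Hmu Hc Hf t.
  assert (HK : 0 <= K).
  { generalize (Hf 0) (Rabs_pos (f 0)) (two_sided_exp_ge1 mu t0 0); nra. }
  (* Primitive of K times the weight, a multiple of sinh (mu (s - t0)), vanishing at t0. *)
  set (G := fun s => K / mu * (exp (mu * (s - t0)) - exp (- (mu * (s - t0))))).
  assert (HG : forall a b, is_RInt (fun s => K * two_sided_exp mu t0 s) a b (G b - G a)).
  { intros a b. apply (is_RInt_derive G).
    - intros x _. unfold G, two_sided_exp. auto_derive; [trivial|unfold Rminus; field; lra].
    - intros x _. apply (ex_derive_continuous (fun s => K * two_sided_exp mu t0 s)).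
      unfold two_sided_exp. auto_derive. trivial. }
  assert (G0 : G t0 = 0).
  { unfold G. rewrite Rminus_diag, Rmult_0_r, Ropp_0. ring. }
  assert (HKm : 0 <= K / mu).
  { apply Rmult_le_pos; [lra|apply Rlt_le, Rinv_0_lt_compat, Hmu]. }
  assert (Hi : forall a b, is_RInt f a b (RInt f a b)).
  { intros a b. apply (RInt_correct f), (ex_RInt_continuous f). intros; apply Hc. }
  destruct (Rle_dec t0 t) as [Ht|Ht].
  - apply Rle_trans with (G t - G t0).
    + apply (norm_RInt_le f (fun s => K * two_sided_exp mu t0 s) t0 t _ _ Ht);
        [intros x _; apply Hf|apply Hi|apply HG].
    + rewrite G0. unfold G, two_sided_exp.
      generalize (exp_pos (- (mu * (t - t0)))). nra.
  - rewrite <- (opp_RInt_swap f) by (apply (ex_RInt_continuous f); intros; apply Hc).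
    change (Rabs (- RInt f t t0) <= K / mu * two_sided_exp mu t0 t).
    rewrite Rabs_Ropp.
    apply Rle_trans with (G t0 - G t).
    + apply (norm_RInt_le f (fun s => K * two_sided_exp mu t0 s) t t0);
        [lra|intros x _; apply Hf|apply Hi|apply HG].
    + rewrite G0. unfold G, two_sided_exp.
      generalize (exp_pos (mu * (t - t0))). nra.
Qed.

(** The unknown of the fixed point is the velocity v alone; the position is its integral [pos v], so
    that a scalar fixed-point theorem suffices. *)
Lemma ode_second_order_exists (F : R -> R -> R -> R) (L A : R) :
  (forall t x v x' v', Rabs (F t x v - F t x' v') <= L * (Rabs (x - x') + Rabs (v - v'))) ->
  (forall x v : R -> R, (forall t, continuous x t) -> (forall t, continuous v t) ->
     forall t, continuous (fun s => F s (x s) (v s)) t) ->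
  (forall t, Rabs (F t 0 0) <= A) ->
  forall t0 x0 v0, exists u : R -> R, u t0 = x0 /\ Derive u t0 = v0 /\
    forall t, ex_derive u t /\ ex_derive (Derive u) t /\
      Derive_n u 2 t = F t (u t) (Derive u t).
Proof.
  intros HL HFc HFA t0 x0 v0.
  assert (HL0 : 0 <= L).
  { generalize (HL 0 1 0 0 0) (Rabs_pos (F 0 1 0 - F 0 0 0)).
    rewrite !Rminus_0_r, Rabs_R0, Rabs_R1; lra. }
  (* Chosen so that 2 L K / mu <= K / 2, as [weighted_fixpoint] demands, and mu >= 1, so that
     integrating a velocity difference does not increase its weighted norm. *)
  set (mu := 4 * L + 1). set (E := two_sided_exp mu t0).
  assert (Hmu : 0 < mu) by (unfold mu; lra).
  assert (HE1 : forall t, 1 <= E t) by apply two_sided_exp_ge1.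
  set (pos := fun (v : R -> R) t => x0 + RInt v t0 t).
  set (Phi := fun (v : R -> R) t => v0 + RInt (fun s => F s (pos v s) (v s)) t0 t).
  assert (Hprim : forall (g : R -> R) c, (forall t, continuous g t) ->
            forall t, is_derive (fun s => c + RInt g t0 s) t (g t)).
  { intros g c Hg t. replace (g t) with (plus 0 (g t)) by apply Rplus_0_l.
    apply (is_derive_plus (fun _ => c)); [apply (is_derive_const c)|].
    apply (is_derive_RInt g _ t0); [|apply Hg].
    apply filter_forall. intros b. apply (RInt_correct g), (ex_RInt_continuous g).
    intros; apply Hg. }
  assert (Hprimc : forall (g : R -> R) c, (forall t, continuous g t) ->
            forall t, continuous (fun s => c + RInt g t0 s) t).
  { intros g c Hg t. apply (ex_derive_continuous (fun s => c + RInt g t0 s)).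
    eexists. now apply Hprim. }
  assert (HFv : forall v : R -> R, (forall t, continuous v t) ->
            forall t, continuous (fun s => F s (pos v s) (v s)) t).
  { intros v Hv. apply HFc; [apply Hprimc, Hv|apply Hv]. }
  assert (Hdiff : forall f g : R -> R, (forall t, continuous f t) -> (forall t, continuous g t) ->
     forall t, RInt f t0 t - RInt g t0 t = RInt (fun s => f s - g s) t0 t).
  { intros f g Hf Hg t. symmetry. apply (RInt_minus f g);
      apply ex_RInt_continuous; intros; auto. }
  destruct (weighted_fixpoint E Phi (Rabs v0 + (A + L * Rabs x0) / mu)) as [v [Hv HPv]].
  - intros t. generalize (HE1 t); lra.
  - intros t. exists (E t * exp mu + E t * exp mu). intros s Hs.
    apply Rabs_lt_between in Hs. unfold E, two_sided_exp.
    assert (H1 : exp (mu * (s - t0)) <= exp (mu * (t - t0)) * exp mu).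
    { rewrite <- exp_plus. apply Rlt_le, exp_increasing. nra. }
    assert (H2 : exp (- (mu * (s - t0))) <= exp (- (mu * (t - t0))) * exp mu).
    { rewrite <- exp_plus. apply Rlt_le, exp_increasing. nra. }
    generalize (exp_pos (mu * (t - t0))) (exp_pos (- (mu * (t - t0)))) (exp_pos mu).
    nra.
  - intros y Hy. apply Hprimc, HFv, Hy.
  - intros K y y' Hy Hy' HK.
    assert (HK0 : 0 <= K).
    { generalize (HK 0) (Rabs_pos (y 0 - y' 0)) (HE1 0); nra. }
    assert (Hpos : forall s, Rabs (pos y s - pos y' s) <= K * E s).
    { intros s. unfold pos.
      replace (x0 + RInt y t0 s - (x0 + RInt y' t0 s))
        with (RInt y t0 s - RInt y' t0 s) by ring.
      rewrite Hdiff by assumption.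
      apply Rle_trans with (K / mu * E s).
      - apply RInt_two_sided_exp; [exact Hmu| |exact HK].
        intros r. apply (continuous_minus y y'); auto.
      - apply Rmult_le_compat_r; [generalize (HE1 s); lra|].
        apply Rle_div_l; [exact Hmu|]. unfold mu; nra. }
    intros t. unfold Phi.
    match goal with |- Rabs (v0 + ?a - (v0 + ?b)) <= _ =>
      replace (v0 + a - (v0 + b)) with (a - b) by ring end.
    rewrite Hdiff by (apply HFv; assumption).
    apply Rle_trans with (L * (2 * K) / mu * E t).
    + apply RInt_two_sided_exp; [exact Hmu| |].
      * intros r. apply (continuous_minus (fun s => F s (pos y s) (y s))); apply HFv; assumption.
      * intros s. apply Rle_trans with (1 := HL _ _ _ _ _).
        replace (L * (2 * K) * two_sided_exp mu t0 s) with (L * (K * E s + K * E s))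
          by (unfold E; ring).
        apply Rmult_le_compat_l; [exact HL0|]. now apply Rplus_le_compat.
    + apply Rmult_le_compat_r; [generalize (HE1 t); lra|].
      apply Rle_div_l; [exact Hmu|]. unfold mu; nra.
  - intros t. unfold Phi.
    triangle.
    rewrite Rmult_plus_distr_r. apply Rplus_le_compat.
    + generalize (HE1 t) (Rabs_pos v0); nra.
    + apply RInt_two_sided_exp; [exact Hmu|apply HFv; intros; apply continuous_const|].
      intros s.
      assert (Hp0 : pos (fun _ => 0) s = x0).
      { unfold pos. rewrite RInt_const. unfold scal; simpl; unfold mult; simpl. ring. }
      rewrite Hp0.
      replace (F s x0 0) with (F s 0 0 + (F s x0 0 - F s 0 0)) by ring.
      triangle.
      generalize (HL s x0 0 0 0) (HFA s) (HE1 s) (Rabs_pos x0) (Rabs_pos (F s 0 0)).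
      rewrite !Rminus_0_r, Rabs_R0. intros H1 H2 H3 H4 H5.
      apply Rle_trans with (A + L * Rabs x0); [lra|].
      change (A + L * Rabs x0 <= (A + L * Rabs x0) * E s).
      assert (0 <= A + L * Rabs x0); [|nra].
      assert (0 <= L * Rabs x0) by now apply Rmult_le_pos. lra.
  - assert (Hvd : forall t, is_derive v t (F t (pos v t) (v t))).
    { intros t. apply is_derive_ext with (Phi v); [exact HPv|].
      apply (Hprim (fun s => F s (pos v s) (v s)) v0), HFv, Hv. }
    assert (Hpd : forall t, is_derive (pos v) t (v t)) by (apply Hprim, Hv).
    assert (HDp : forall t, Derive (pos v) t = v t)
      by (intros t; apply is_derive_unique, Hpd).
    exists (pos v). split; [|split].
    + unfold pos. rewrite RInt_point. apply Rplus_0_r.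
    + rewrite HDp, <- HPv. unfold Phi. rewrite RInt_point. apply Rplus_0_r.
    + intros t. split; [eexists; apply Hpd|].
      assert (Hd2 : is_derive (Derive (pos v)) t (F t (pos v t) (v t))).
      { apply is_derive_ext with v; [intros; now rewrite HDp|apply Hvd]. }
      split; [eexists; exact Hd2|].
      rewrite HDp. exact (is_derive_unique _ _ _ Hd2).
Qed.

(** * Asymptotic bounds *)

(** No limit is involved: the constant is uniform over the predicate [D]. In the applications eps
    and all other parameters are fields of one record [X], and the smallness of eps is part of
    [D]. *)
Definition bigO {X : Type} (D : X -> Prop) (e f : X -> R) : Prop :=
  exists C, 0 <= C /\ forall x, D x -> Rabs (f x) <= C * Rabs (e x).

Definition bdd {X : Type} (D : X -> Prop) (f : X -> R) : Prop := bigO D (fun _ => 1) f.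

Section BigO.
Context {X : Type} (D : X -> Prop).
Implicit Types e f g : X -> R.

Lemma bigO_intro e f (C : R) :
  (forall x, D x -> Rabs (f x) <= C * Rabs (e x)) -> bigO D e f.
Proof.
  intros H. exists (Rabs C); split; [apply Rabs_pos|]. intros x Hx.
  apply Rle_trans with (1 := H x Hx).
  apply Rmult_le_compat_r; [apply Rabs_pos|apply Rle_abs].
Qed.

Lemma bdd_intro f (C : R) : (forall x, D x -> Rabs (f x) <= C) -> bdd D f.
Proof.
  intros H. apply bigO_intro with C. intros x Hx. rewrite Rabs_R1, Rmult_1_r. auto.
Qed.

Lemma bdd_elim f : bdd D f -> exists C, 0 <= C /\ forall x, D x -> Rabs (f x) <= C.
Proof.
  intros [C [HC H]]. exists C; split; [exact HC|]. intros x Hx.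
  generalize (H x Hx). now rewrite Rabs_R1, Rmult_1_r.
Qed.

Lemma bigO_ext e f g : (forall x, D x -> f x = g x) -> bigO D e g -> bigO D e f.
Proof.
  intros E [C [HC H]]. exists C; split; [exact HC|]. intros x Hx.
  rewrite (E x Hx); auto.
Qed.

Lemma bigO_plus e f g : bigO D e f -> bigO D e g -> bigO D e (fun x => f x + g x).
Proof.
  intros [C [HC H]] [C' [HC' H']]. exists (C + C'); split; [lra|]. intros x Hx.
  triangle.
  generalize (H x Hx) (H' x Hx); lra.
Qed.

Lemma bigO_opp e f : bigO D e f -> bigO D e (fun x => - f x).
Proof.
  intros [C [HC H]]. exists C; split; [exact HC|]. intros x Hx.
  rewrite Rabs_Ropp; auto.
Qed.

Lemma bigO_minus e f g : bigO D e f -> bigO D e g -> bigO D e (fun x => f x - g x).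
Proof. intros Hf Hg. apply (bigO_plus e f (fun x => - g x) Hf), bigO_opp, Hg. Qed.

Lemma bigO_mult e e' f g :
  bigO D e f -> bigO D e' g -> bigO D (fun x => e x * e' x) (fun x => f x * g x).
Proof.
  intros [C [HC H]] [C' [HC' H']]. exists (C * C').
  split; [now apply Rmult_le_pos|]. intros x Hx. rewrite !Rabs_mult.
  replace (C * C' * (Rabs (e x) * Rabs (e' x)))
    with ((C * Rabs (e x)) * (C' * Rabs (e' x))) by ring.
  apply Rmult_le_compat; auto using Rabs_pos.
Qed.

Lemma bigO_trans e e' f : bigO D e f -> bigO D e' e -> bigO D e' f.
Proof.
  intros [C [HC H]] [C' [HC' H']]. exists (C * C').
  split; [now apply Rmult_le_pos|]. intros x Hx.
  apply Rle_trans with (1 := H x Hx). rewrite Rmult_assoc.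
  apply Rmult_le_compat_l; auto.
Qed.

Lemma bigO_refl e : bigO D e e.
Proof. apply bigO_intro with 1. intros; lra. Qed.

Lemma bigO_bdd_l e f g : bdd D f -> bigO D e g -> bigO D e (fun x => f x * g x).
Proof.
  intros Hf Hg. apply bigO_trans with (1 := bigO_mult _ _ _ _ Hf Hg).
  apply bigO_intro with 1. intros; rewrite Rmult_1_l; lra.
Qed.

Lemma bigO_bdd_r e f g : bigO D e f -> bdd D g -> bigO D e (fun x => f x * g x).
Proof.
  intros Hf Hg. apply bigO_ext with (fun x => g x * f x); [intros; ring|].
  now apply bigO_bdd_l.
Qed.

Lemma bdd_const (c : R) : bdd D (fun _ => c).
Proof. apply bdd_intro with (Rabs c). intros; lra. Qed.

Lemma bdd_mult f g : bdd D f -> bdd D g -> bdd D (fun x => f x * g x).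
Proof. intros; now apply bigO_bdd_l. Qed.

Lemma bdd_pow f n : bdd D f -> bdd D (fun x => f x ^ n).
Proof.
  intros Hf. induction n; simpl; [apply bdd_const|now apply bdd_mult].
Qed.

Lemma bdd_sin f : bdd D (fun x => sin (f x)).
Proof. apply bdd_intro with 1. intros; apply Rabs_le, SIN_bound. Qed.

Lemma bdd_cos f : bdd D (fun x => cos (f x)).
Proof. apply bdd_intro with 1. intros; apply Rabs_le, COS_bound. Qed.

Lemma bdd_inv f (m : R) : 0 < m -> (forall x, D x -> m <= Rabs (f x)) ->
  bdd D (fun x => / f x).
Proof.
  intros Hm H. apply bdd_intro with (/ m). intros x Hx.
  rewrite Rabs_inv. apply Rinv_le_contravar; auto.
Qed.

Lemma bigO_bdd e f : bdd D e -> bigO D e f -> bdd D f.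
Proof. intros He Hf. apply bigO_trans with (1 := Hf), He. Qed.

Lemma bigO_mult_sqr e f g : bigO D e f -> bigO D e g ->
  bigO D (fun x => e x ^ 2) (fun x => f x * g x).
Proof.
  intros Hf Hg. apply bigO_trans with (1 := bigO_mult _ _ _ _ Hf Hg).
  apply bigO_intro with 1. intros x _. simpl. rewrite Rmult_1_r; lra.
Qed.

Lemma bigO_sqr e : bdd D e -> bigO D e (fun x => e x ^ 2).
Proof.
  intros He. apply bigO_ext with (fun x => e x * e x); [intros; ring|].
  apply bigO_bdd_l; [exact He|apply bigO_refl].
Qed.

End BigO.

(** Boundedness by structure. A quotient leaves the inverse of its denominator as a goal, which is
    closed as a constant or by a hypothesis bounding that inverse. *)
Ltac bdd_step :=
  first
  [ assumption
  | match goal with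
    | |- bdd ?D (fun x => ?c) => apply (bdd_const D c)
    | |- bdd _ (fun x => @?f x + @?g x) => apply (bigO_plus _ _ f g)
    | |- bdd _ (fun x => @?f x - @?g x) => apply (bigO_minus _ _ f g)
    | |- bdd _ (fun x => - @?f x) => apply (bigO_opp _ _ f)
    | |- bdd _ (fun x => @?f x * @?g x) => apply (bdd_mult _ f g)
    | |- bdd _ (fun x => @?f x / @?g x) => apply (bdd_mult _ f (fun x => / g x))
    | |- bdd _ (fun x => @?f x ^ ?n) => apply (bdd_pow _ f n)
    | |- bdd _ (fun x => sin (@?f x)) => apply (bdd_sin _ f)
    | |- bdd _ (fun x => cos (@?f x)) => apply (bdd_cos _ f)
    | |- bigO ?D (fun x => 1) ?f => change (bdd D f)
    end ].
Ltac bdd_solve := cbv beta; repeat (bdd_step; cbv beta).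

(** Boundedness is bundled with the Lipschitz bound because the pair, unlike the Lipschitz bound
    alone, is stable under products. *)
Definition bounded_lipschitz {X : Type} (D : X -> Prop) (dist : X -> X -> R) (f : X -> R) :=
  exists C, 0 <= C /\ forall x y, D x -> D y ->
    Rabs (f x) <= C /\ Rabs (f x - f y) <= C * dist x y.

Lemma Rabs_sin_minus_le (x y : R) : Rabs (sin x - sin y) <= Rabs (x - y).
Proof.
  destruct (MVT_gen sin y x cos) as [c [_ Hc]].
  - intros z _. apply is_derive_Reals, derivable_pt_lim_sin.
  - intros z _. apply continuity_sin.
  - rewrite Hc, Rabs_mult. generalize (Rabs_pos (x - y)) (COS_bound c).
    intros H1 H2. apply Rabs_le in H2. nra.
Qed.

Lemma Rabs_cos_minus_le (x y : R) : Rabs (cos x - cos y) <= Rabs (x - y).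
Proof.
  rewrite !cos_sin. apply Rle_trans with (1 := Rabs_sin_minus_le _ _).
  replace (PI / 2 + x - (PI / 2 + y)) with (x - y) by ring. lra.
Qed.

Section BoundedLipschitz.
Context {X : Type} (D : X -> Prop) (dist : X -> X -> R).
Context (dist_pos : forall x y, 0 <= dist x y).
Implicit Types f g : X -> R.

Lemma bl_const (c : R) : bounded_lipschitz D dist (fun _ => c).
Proof.
  exists (Rabs c); split; [apply Rabs_pos|]. intros x y _ _. split; [lra|].
  rewrite Rminus_diag, Rabs_R0. apply Rmult_le_pos; [apply Rabs_pos|apply dist_pos].
Qed.

Lemma bl_plus f g : bounded_lipschitz D dist f -> bounded_lipschitz D dist g ->
  bounded_lipschitz D dist (fun x => f x + g x).
Proof.
  intros [C [HC H]] [C' [HC' H']]. exists (C + C'); split; [lra|].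
  intros x y Hx Hy. destruct (H x y Hx Hy), (H' x y Hx Hy). split.
  - triangle; lra.
  - replace (f x + g x - (f y + g y)) with ((f x - f y) + (g x - g y)) by ring.
    triangle; lra.
Qed.

Lemma bl_mult f g : bounded_lipschitz D dist f -> bounded_lipschitz D dist g ->
  bounded_lipschitz D dist (fun x => f x * g x).
Proof.
  intros [C [HC H]] [C' [HC' H']]. exists (2 * C * C' ).
  assert (0 <= C * C') by now apply Rmult_le_pos.
  split; [lra|]. intros x y Hx Hy.
  destruct (H x y Hx Hy) as [H1 H2], (H' x y Hx Hy) as [H3 H4].
  destruct (H y y Hy Hy) as [H5 _]. split.
  - rewrite Rabs_mult. apply Rle_trans with (C * C'); [|lra].
    apply Rmult_le_compat; auto using Rabs_pos.
  - replace (f x * g x - f y * g y) with ((f x - f y) * g x + f y * (g x - g y)) by ring.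
    triangle. rewrite !Rabs_mult.
    replace (2 * C * C' * dist x y) with ((C * dist x y) * C' + C * (C' * dist x y)) by ring.
    apply Rplus_le_compat; apply Rmult_le_compat; auto using Rabs_pos.
Qed.

Lemma bl_opp f : bounded_lipschitz D dist f -> bounded_lipschitz D dist (fun x => - f x).
Proof.
  intros [C [HC H]]. exists C; split; [exact HC|]. intros x y Hx Hy.
  destruct (H x y Hx Hy) as [H1 H2]. split; [now rewrite Rabs_Ropp|].
  replace (- f x - - f y) with (- (f x - f y)) by ring. now rewrite Rabs_Ropp.
Qed.

Lemma bl_minus f g : bounded_lipschitz D dist f -> bounded_lipschitz D dist g ->
  bounded_lipschitz D dist (fun x => f x - g x).
Proof. intros Hf Hg. apply (bl_plus f (fun x => - g x) Hf), bl_opp, Hg. Qed.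

Lemma bl_pow f n : bounded_lipschitz D dist f -> bounded_lipschitz D dist (fun x => f x ^ n).
Proof. intros Hf; induction n; simpl; [apply bl_const|now apply bl_mult]. Qed.

Lemma bl_inv f (m : R) : 0 < m -> (forall x, D x -> m <= f x) ->
  bounded_lipschitz D dist f -> bounded_lipschitz D dist (fun x => / f x).
Proof.
  intros Hm Hf [C [HC H]].
  assert (Him : 0 < / m) by now apply Rinv_0_lt_compat.
  assert (Hi : forall x, D x -> 0 < / f x <= / m).
  { intros x Hx. specialize (Hf x Hx). split; [apply Rinv_0_lt_compat; lra|].
    now apply Rinv_le_contravar. }
  exists (/ m + C * / m * / m). split.
  { assert (0 <= C * / m * / m) by (repeat apply Rmult_le_pos; lra). lra. }
  intros x y Hx Hy. destruct (H x y Hx Hy) as [_ H2].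
  generalize (Hi x Hx) (Hi y Hy) (Hf x Hx) (Hf y Hy). intros H3 H4 H5 H6. split.
  - rewrite Rabs_right by lra.
    assert (0 <= C * / m * / m) by (repeat apply Rmult_le_pos; lra). lra.
  - replace (/ f x - / f y) with ((f y - f x) * (/ f x * / f y)) by (field; lra).
    rewrite Rabs_mult, Rabs_minus_sym, (Rabs_right (/ f x * / f y))
      by (apply Rle_ge, Rmult_le_pos; lra).
    apply Rle_trans with ((C * dist x y) * (/ m * / m)).
    + apply Rmult_le_compat; [apply Rabs_pos|apply Rmult_le_pos; lra|exact H2|].
      apply Rmult_le_compat; lra.
    + assert (0 <= / m * dist x y) by (apply Rmult_le_pos; [lra|apply dist_pos]). lra.
Qed.

Lemma bl_sin f : bounded_lipschitz D dist f -> bounded_lipschitz D dist (fun x => sin (f x)).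
Proof.
  intros [C [HC H]]. exists (C + 1); split; [lra|]. intros x y Hx Hy.
  destruct (H x y Hx Hy) as [_ H2]. split.
  - generalize (SIN_bound (f x)). intros H3. apply Rabs_le in H3. lra.
  - generalize (Rabs_sin_minus_le (f x) (f y)) (dist_pos x y). lra.
Qed.

Lemma bl_cos f : bounded_lipschitz D dist f -> bounded_lipschitz D dist (fun x => cos (f x)).
Proof.
  intros [C [HC H]]. exists (C + 1); split; [lra|]. intros x y Hx Hy.
  destruct (H x y Hx Hy) as [_ H2]. split.
  - generalize (COS_bound (f x)). intros H3. apply Rabs_le in H3. lra.
  - generalize (Rabs_cos_minus_le (f x) (f y)) (dist_pos x y). lra.
Qed.

End BoundedLipschitz.

Ltac bl_step :=
  first
  [ assumption
  | match goal with
    | |- bounded_lipschitz ?D ?d (fun x => ?c) => apply (bl_const D d); assumption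
    | |- bounded_lipschitz ?D ?d (fun x => @?f x + @?g x) => apply (bl_plus D d f g)
    | |- bounded_lipschitz ?D ?d (fun x => @?f x - @?g x) => apply (bl_minus D d f g)
    | |- bounded_lipschitz ?D ?d (fun x => - @?f x) => apply (bl_opp D d f)
    | |- bounded_lipschitz ?D ?d (fun x => @?f x * @?g x) => apply (bl_mult D d f g)
    | |- bounded_lipschitz ?D ?d (fun x => @?f x / @?g x) =>
        apply (bl_mult D d f (fun x => / g x))
    | |- bounded_lipschitz ?D ?d (fun x => @?f x ^ ?n) => apply (bl_pow D d); [assumption|]
    | |- bounded_lipschitz ?D ?d (fun x => sin (@?f x)) => apply (bl_sin D d); [assumption|]
    | |- bounded_lipschitz ?D ?d (fun x => cos (@?f x)) => apply (bl_cos D d); [assumption|]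
    end ].
Ltac bl_solve := cbv beta; repeat (bl_step; cbv beta).

(** * Stationary points *)

Definition clamp (lo hi x : R) : R := Rmax lo (Rmin hi x).

Lemma clamp_bounds (lo hi x : R) : lo <= hi -> lo <= clamp lo hi x <= hi.
Proof.
  intros H. unfold clamp. split; [apply Rmax_l|].
  apply Rmax_lub; [exact H|apply Rmin_l].
Qed.

Lemma clamp_id (lo hi x : R) : lo <= x <= hi -> clamp lo hi x = x.
Proof. intros H. unfold clamp. rewrite Rmin_right, Rmax_right; lra. Qed.

Lemma clamp_lipschitz (lo hi x y : R) :
  Rabs (clamp lo hi x - clamp lo hi y) <= Rabs (x - y).
Proof.
  unfold clamp, Rmax, Rmin.
  repeat destruct (Rle_dec _ _); unfold Rabs; repeat destruct (Rcase_abs _); lra.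
Qed.

Definition dist3 (x b s x' b' s' : R) : R := Rabs (x - x') + Rabs (b - b') + Rabs (s - s').

(** The bound on the values keeps the solutions near those at eps = 0; the bound on the differences
    makes the equations contractions. *)
Definition small_lipschitz (box : R -> R -> R -> Prop) (C e0 : R)
    (H : R -> R -> R -> R -> R) : Prop :=
  forall eps x b s x' b' s', 0 < eps < e0 -> box x b s -> box x' b' s' ->
    Rabs (H eps x b s) <= C * eps /\
    Rabs (H eps x b s - H eps x' b' s') <= C * eps * dist3 x b s x' b' s'.

(* The range of amplitude, phase and detuning in the variables x = a / a0,
   b = beta + PI / 2. *)
Definition phase_box (x1 x2 M x b s : R) : Prop :=
  x1 <= x <= x2 /\ - (PI / 2) <= b <= 3 * PI / 2 /\ - M <= s <= M.

(* The phase equation at eps = 0, solved for the detuning. *)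
Definition detuning0 (lam s0 x b : R) : R := s0 * x ^ 2 - lam / 2 * (sin b / x).

(** The amplitude equation divided by - eps lam a0 / 2 and the phase equation divided by - eps; see
    [stationary_normalized]. *)
Definition normalized_stationary (lam s0 : R) (H1 H2 : R -> R -> R -> R -> R)
    (eps x b s : R) : Prop :=
  x = cos b + H1 eps x b s /\ s = detuning0 lam s0 x b + H2 eps x b s.

Lemma detuning0_lipschitz (lam s0 x1 x2 : R) : 0 < x1 ->
  exists L, 0 <= L /\ forall x b x' b', x1 <= x <= x2 -> x1 <= x' <= x2 ->
    Rabs (detuning0 lam s0 x b - detuning0 lam s0 x' b')
      <= L * (Rabs (x - x') + Rabs (b - b')).
Proof.
  intros H1.
  set (D := fun p : R * R => x1 <= fst p <= x2).
  set (dist := fun p q : R * R => Rabs (fst p - fst q) + Rabs (snd p - snd q)).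
  assert (dpos : forall p q, 0 <= dist p q).
  { intros p q. unfold dist.
    generalize (Rabs_pos (fst p - fst q)) (Rabs_pos (snd p - snd q)); lra. }
  assert (Bx : bounded_lipschitz D dist fst).
  { exists (Rabs x1 + Rabs x2 + 1).
    assert (Hp := Rabs_pos x1). assert (Hp' := Rabs_pos x2).
    split; [lra|]. intros p q Hx Hy. split.
    - generalize (Rle_abs x2). unfold D in Hx. intros H2. rewrite Rabs_right; lra.
    - apply Rle_trans with (1 * dist p q).
      + unfold dist. generalize (Rabs_pos (snd p - snd q)). lra.
      + apply Rmult_le_compat_r; [apply dpos|lra]. }
  assert (Bs : bounded_lipschitz D dist (fun p => sin (snd p))).
  { exists 1. split; [lra|]. intros p q _ _. split.
    - apply Rabs_le, SIN_bound.
    - apply Rle_trans with (1 := Rabs_sin_minus_le _ _). unfold dist.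
      generalize (Rabs_pos (fst p - fst q)). lra. }
  assert (Bi : bounded_lipschitz D dist (fun p => / fst p)).
  { apply (bl_inv D dist dpos fst x1 H1); [|exact Bx]. intros p [Hp _]; exact Hp. }
  assert (B : bounded_lipschitz D dist (fun p => detuning0 lam s0 (fst p) (snd p))).
  { unfold detuning0. bl_solve. }
  destruct B as [L [HL HB]]. exists L; split; [exact HL|]. intros x b x' b' Hx Hx'.
  exact (proj2 (HB (x, b) (x', b') Hx Hx')).
Qed.

(* For a given phase b the equations are solved for s, then for x, by
   contraction; clamping the arguments to the box makes the maps globally
   Lipschitz. *)
Lemma stationary_curve (lam s0 x1 x2 M C e0 : R) (H1 H2 : R -> R -> R -> R -> R) :
  0 < x1 < 1 -> 1 < x2 -> Rabs s0 < M -> 0 <= C -> 0 < e0 ->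
  small_lipschitz (phase_box x1 x2 M) C e0 H1 ->
  small_lipschitz (phase_box x1 x2 M) C e0 H2 ->
  exists e1 eta, 0 < e1 <= e0 /\ 0 < eta /\
  forall eps, 0 < eps < e1 -> exists X S : R -> R, exists L,
    (forall b b', Rabs (X b - X b') <= L * Rabs (b - b')) /\
    (forall b b', Rabs (S b - S b') <= L * Rabs (b - b')) /\
    (forall b, Rabs b <= eta ->
       phase_box x1 x2 M (X b) b (S b) /\
       normalized_stationary lam s0 H1 H2 eps (X b) b (S b)) /\
    (forall x b s, phase_box x1 x2 M x b s ->
       normalized_stationary lam s0 H1 H2 eps x b s -> x = X b /\ s = S b).
Proof.
  intros Hx1 Hx2 HM HC He0 HH1 HH2.
  destruct (detuning0_lipschitz lam s0 x1 x2) as [L [HL Hlip]]; [lra|].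
  (* Margin between the values x = 1, s = s0 of the unperturbed solution at b = 0 and the boundary
     of the box, capped at 1. *)
  set (g := Rmin (Rmin (1 - x1) (x2 - 1)) (Rmin (M - Rabs s0) 1)).
  assert (Hg : 0 < g /\ g <= 1 - x1 /\ g <= x2 - 1 /\ g <= M - Rabs s0 /\ g <= 1).
  { unfold g. repeat split.
    - repeat apply Rmin_glb_lt; lra.
    - apply Rle_trans with (1 := Rmin_l _ _), Rmin_l.
    - apply Rle_trans with (1 := Rmin_l _ _), Rmin_r.
    - apply Rle_trans with (1 := Rmin_r _ _), Rmin_l.
    - apply Rle_trans with (1 := Rmin_r _ _), Rmin_r. }
  destruct Hg as [Hg [Hg1 [Hg2 [Hg3 Hg4]]]].
  assert (Hs0 := Rabs_pos s0).
  assert (HPI := PI2_1).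
  set (L' := 2 * (L + C + 1)).
  (* Requiring eps q <= g / 4 makes both contraction factors at most 1 / 2 and, for |b| <= eta,
     keeps all displacements within the margin. *)
  set (q := (C + 1) * (L' + L + 2)).
  assert (Hq : 0 < q) by (unfold q, L'; apply Rmult_lt_0_compat; lra).
  destruct (small_epsilon q (g / 4)) as [eq [[Heq Heq1] Hsmall]]; [lra|lra|].
  destruct (common_bound e0 eq He0 Heq) as [e1 [He1 [He1' He1'']]].
  exists e1, (g / (4 * (L + 1))).
  assert (Heta : 0 < g / (4 * (L + 1))) by (apply Rdiv_lt_0_compat; lra).
  split; [lra|]. split; [exact Heta|].
  intros eps Heps.
  assert (Hepsq : eps * q <= g / 4) by (rewrite Rmult_comm; apply Rlt_le, Hsmall; lra).
  assert (HCe : 0 <= C * eps) by (apply Rmult_le_pos; lra).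
  assert (Hq1 : C * eps * (L' + L + 2) <= g / 4).
  { apply Rle_trans with (2 := Hepsq). unfold q.
    replace (C * eps * (L' + L + 2)) with (eps * (L' + L + 2) * C) by ring.
    replace (eps * ((C + 1) * (L' + L + 2))) with (eps * (L' + L + 2) * (C + 1)) by ring.
    apply Rmult_le_compat_l; [|lra]. apply Rmult_le_pos; unfold L'; lra. }
  assert (HL'0 : 2 <= L') by (unfold L'; lra).
  assert (HCe1 : C * eps * (1 + L') <= 1 / 4) by nra.
  assert (HCe2 : C * eps * (1 + L) <= g / 4) by nra.
  assert (HCe4 : C * eps <= 1 / 4) by nra.
  set (kx := clamp x1 x2). set (kb := clamp (- (PI / 2)) (3 * PI / 2)). set (ks := clamp (- M) M).
  assert (Hbox : forall x b s, phase_box x1 x2 M (kx x) (kb b) (ks s)).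
  { intros x b s. unfold phase_box, kx, kb, ks.
    split; [|split]; apply clamp_bounds; lra. }
  assert (Hkx : forall x, x1 <= kx x <= x2) by (intros; apply clamp_bounds; lra).
  set (F2 := fun (y : R * R) s =>
    detuning0 lam s0 (kx (fst y)) (kb (snd y)) + H2 eps (kx (fst y)) (kb (snd y)) (ks s)).
  set (dist := fun y y' : R * R => Rabs (fst y - fst y') + Rabs (snd y - snd y')).
  assert (Hdk : forall x b s x' b' s', dist3 (kx x) (kb b) (ks s) (kx x') (kb b') (ks s')
     <= Rabs (x - x') + Rabs (b - b') + Rabs (s - s')).
  { intros. unfold dist3, kx, kb, ks.
    repeat apply Rplus_le_compat; apply clamp_lipschitz. }
  assert (Heps' : 0 < eps < e0) by lra.
  assert (HF2 : forall y y' s s',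
    Rabs (F2 y s - F2 y' s') <= 1 / 2 * Rabs (s - s') + (L + C) * dist y y').
  { intros [x b] [x' b'] s s'. unfold F2, dist; simpl.
    destruct (HH2 eps _ _ _ _ _ _ Heps' (Hbox x b s) (Hbox x' b' s')) as [_ Hl].
    match goal with |- Rabs (?a + ?b - (?c + ?d)) <= _ =>
      replace (a + b - (c + d)) with ((a - c) + (b - d)) by ring end.
    triangle.
    generalize (Hlip (kx x) (kb b) (kx x') (kb b') (Hkx x) (Hkx x')). intros Hd.
    generalize (Hdk x b s x' b' s'). intros Hd3.
    generalize (clamp_lipschitz x1 x2 x x') (clamp_lipschitz (- (PI / 2)) (3 * PI / 2) b b').
    fold kx kb. intros Hc1 Hc2.
    assert (C * eps * dist3 (kx x) (kb b) (ks s) (kx x') (kb b') (ks s')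
      <= C * eps * (Rabs (x - x') + Rabs (b - b') + Rabs (s - s')))
      by (apply Rmult_le_compat_l; lra).
    assert (L * (Rabs (kx x - kx x') + Rabs (kb b - kb b')) <= L * (Rabs (x - x') + Rabs (b - b')))
      by (apply Rmult_le_compat_l; lra).
    assert (C * eps * Rabs (s - s') <= 1 / 4 * Rabs (s - s'))
      by (apply Rmult_le_compat_r; [apply Rabs_pos|lra]).
    assert (C * eps * (Rabs (x - x') + Rabs (b - b')) <= C * (Rabs (x - x') + Rabs (b - b'))).
    { apply Rmult_le_compat_r; [|nra].
      generalize (Rabs_pos (x - x')) (Rabs_pos (b - b')); lra. }
    generalize (Rabs_pos (s - s')). lra. }
  destruct (contraction_fixpoint_parametric (R * R) dist F2 (1 / 2) (L + C))
    as [S2 [HS2 [HS2u HS2l]]]; [lra| |exact HF2|].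
  { intros [x b]; unfold dist; simpl. rewrite !Rminus_diag, Rabs_R0; ring. }
  replace ((L + C) / (1 - 1 / 2)) with (2 * (L + C)) in HS2l by field.
  (* With s eliminated as [S2 (x, b)], the amplitude equation becomes a fixed-point problem for x
     with parameter b. *)
  set (F1 := fun b x => cos (kb b) + H1 eps (kx x) (kb b) (ks (S2 (x, b)))).
  assert (HF1 : forall b b' x x',
    Rabs (F1 b x - F1 b' x') <= 1 / 2 * Rabs (x - x') + 2 * Rabs (b - b')).
  { intros b b' x x'. unfold F1.
    destruct (HH1 eps _ _ _ _ _ _ Heps' (Hbox x b (S2 (x, b))) (Hbox x' b' (S2 (x', b'))))
      as [_ Hl].
    match goal with |- Rabs (?a + ?b - (?c + ?d)) <= _ =>
      replace (a + b - (c + d)) with ((a - c) + (b - d)) by ring end.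
    triangle.
    generalize (Hdk x b (S2 (x, b)) x' b' (S2 (x', b'))). intros Hd3.
    generalize (clamp_lipschitz (- (PI / 2)) (3 * PI / 2) b b') (Rabs_cos_minus_le (kb b) (kb b')).
    fold kb. intros Hc2 Hc3.
    generalize (HS2l (x, b) (x', b')). unfold dist; simpl. intros Hs.
    set (dd := Rabs (x - x') + Rabs (b - b')) in *.
    assert (Hdd : 0 <= dd) by (unfold dd; generalize (Rabs_pos (x - x')) (Rabs_pos (b - b')); lra).
    assert (C * eps * dist3 (kx x) (kb b) (ks (S2 (x, b))) (kx x') (kb b') (ks (S2 (x', b')))
      <= C * eps * ((1 + L') * dd)).
    { apply Rmult_le_compat_l; [lra|]. unfold L'. lra. }
    assert (C * eps * ((1 + L') * dd) <= 1 / 4 * dd).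
    { rewrite <- Rmult_assoc. now apply Rmult_le_compat_r. }
    unfold dd in *. generalize (Rabs_pos (x - x')) (Rabs_pos (b - b')). lra. }
  destruct (contraction_fixpoint_parametric R (fun b b' => Rabs (b - b')) F1 (1 / 2) 2)
    as [X [HX [HXu HXl]]]; [lra| |exact HF1|].
  { intros b. now rewrite Rminus_diag, Rabs_R0. }
  replace (2 / (1 - 1 / 2)) with 4 in HXl by field.
  exists X, (fun b => S2 (X b, b)), (4 + 2 * (L + C) * 5).
  split; [|split; [|split]].
  - intros b b'. apply Rle_trans with (1 := HXl b b').
    apply Rmult_le_compat_r; [apply Rabs_pos|nra].
  - intros b b'. apply Rle_trans with (1 := HS2l _ _). unfold dist; simpl.
    generalize (HXl b b') (Rabs_pos (b - b')). intros H3 H4.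
    apply Rle_trans with (2 * (L + C) * (5 * Rabs (b - b'))).
    + apply Rmult_le_compat_l; lra.
    + lra.
  (* For |b| <= eta the fixed point stays within the margin, so the clamps act as the identity and
     the clamped equations are the true ones. *)
  - intros b Hb.
    assert (Hb1 : Rabs b <= g / 4).
    { apply Rle_trans with (1 := Hb). apply Rmult_le_reg_r with (4 * (L + 1)); [lra|].
      replace (g / (4 * (L + 1)) * (4 * (L + 1))) with g by (field; lra). nra. }
    assert (Hb2 : L * Rabs b <= g / 4).
    { apply Rle_trans with (L * (g / (4 * (L + 1)))); [now apply Rmult_le_compat_l|].
      apply Rmult_le_reg_r with (4 * (L + 1)); [lra|].
      replace (L * (g / (4 * (L + 1))) * (4 * (L + 1))) with (L * g) by (field; lra). nra. }
    assert (Ekb : kb b = b).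
    { apply clamp_id. apply Rabs_le_between in Hb1. lra. }
    generalize (HX b). unfold F1. rewrite Ekb. intros EX.
    destruct (HH1 eps _ _ _ _ _ _ Heps' (Hbox (X b) b (S2 (X b, b))) (Hbox (X b) b (S2 (X b, b))))
      as [Hv1 _]. rewrite Ekb in Hv1.
    assert (HXb : Rabs (X b - 1) <= Rabs b + C * eps).
    { rewrite <- EX.
      match goal with |- Rabs (?a + ?b - 1) <= _ =>
        replace (a + b - 1) with ((a - cos 0) + b) by (rewrite cos_0; ring) end.
      triangle.
      generalize (Rabs_cos_minus_le b 0). rewrite Rminus_0_r. lra. }
    assert (Hr : x1 <= X b <= x2) by (apply Rabs_le_between in HXb; nra).
    assert (Ekx : kx (X b) = X b) by now apply clamp_id.
    generalize (HS2 (X b, b)). unfold F2; simpl. rewrite Ekb, Ekx. intros ES.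
    destruct (HH2 eps _ _ _ _ _ _ Heps' (Hbox (X b) b (S2 (X b, b))) (Hbox (X b) b (S2 (X b, b))))
      as [Hv2 _]. rewrite Ekb, Ekx in Hv2.
    assert (HSb : Rabs (S2 (X b, b) - s0) <= L * (2 * Rabs b + C * eps) + C * eps).
    { rewrite <- ES.
      assert (E0 : s0 = detuning0 lam s0 1 0) by (unfold detuning0; rewrite sin_0; field).
      match goal with |- Rabs (?a + ?b - s0) <= _ =>
        replace (a + b - s0) with ((a - detuning0 lam s0 1 0) + b) by (rewrite <- E0; ring) end.
      triangle. apply Rplus_le_compat; [|exact Hv2].
      apply Rle_trans with (1 := Hlip (X b) b 1 0 Hr ltac:(lra)).
      apply Rmult_le_compat_l; [exact HL|]. rewrite Rminus_0_r. lra. }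
    assert (Hs : - M <= S2 (X b, b) <= M).
    { apply Rabs_le_between in HSb.
      generalize (Rle_abs s0) (Rle_abs (- s0)). rewrite Rabs_Ropp. lra. }
    assert (Eks : ks (S2 (X b, b)) = S2 (X b, b)) by now apply clamp_id.
    rewrite Eks in *. rewrite Ekx in EX. split.
    + split; [exact Hr|]. split; [|exact Hs]. apply Rabs_le_between in Hb1. lra.
    + split; [symmetry; exact EX|symmetry; exact ES].
  (* Inside the box the clamps are the identity, so a stationary point of any phase in the box is a
     fixed point of the clamped maps. *)
  - intros x b s [Bx [Bb Bs]] [Ex Es].
    assert (Ekb : kb b = b) by now apply clamp_id.
    assert (Ekx : kx x = x) by now apply clamp_id.
    assert (Eks : ks s = s) by now apply clamp_id.
    assert (E2 : s = S2 (x, b)).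
    { apply HS2u. unfold F2; simpl. now rewrite Ekb, Ekx, Eks. }
    assert (E1 : x = X b).
    { apply HXu. unfold F1. now rewrite Ekb, <- E2, Ekx, Eks. }
    split; [exact E1|]. now rewrite <- E1.
Qed.

Lemma Rabs_sin_le (x : R) : Rabs (sin x) <= Rabs x.
Proof. generalize (Rabs_sin_minus_le x 0). now rewrite sin_0, !Rminus_0_r. Qed.

Lemma one_minus_cos_bounds (x : R) : 0 <= 1 - cos x <= x ^ 2 / 2.
Proof.
  split; [generalize (COS_bound x); lra|].
  replace x with (2 * (x / 2)) at 1 by field. rewrite cos_2a_sin.
  generalize (Rabs_sin_le (x / 2)). intros H.
  assert (Rsqr (sin (x / 2)) <= Rsqr (x / 2)) by now apply Rsqr_le_abs_1.
  unfold Rsqr in *. nra.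
Qed.

Lemma sin_ge_half (x : R) : 0 <= x <= 1 -> x / 2 <= sin x.
Proof.
  intros Hx.
  destruct (MVT_gen sin 0 x cos) as [c [Hc E]].
  - intros z _. apply is_derive_Reals, derivable_pt_lim_sin.
  - intros z _. apply continuity_sin.
  - rewrite sin_0, !Rminus_0_r in E. rewrite Rmin_left, Rmax_right in Hc by lra.
    generalize (one_minus_cos_bounds c). nra.
Qed.

(** The range of phases is not symmetric about 0. Up to PI the cosine is monotone on each side;
    beyond PI it is nonpositive, hence below cos h >= 0. *)
Lemma cos_le_of_far (h b : R) : 0 <= h <= PI / 2 -> - (PI / 2) <= b <= 3 * PI / 2 ->
  h <= Rabs b -> cos b <= cos h.
Proof.
  intros Hh Hb Hhb. unfold Rabs in Hhb.
  destruct (Rcase_abs b).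
  - rewrite <- cos_neg. apply cos_decr_1; lra.
  - destruct (Rle_dec b PI); [apply cos_decr_1; lra|].
    assert (cos b <= 0).
    { apply cos_le_0; lra. }
    generalize (cos_ge_0 h); lra.
Qed.

(** Along the curve the detuning depends continuously on b, which yields every s near s0 by the
    intermediate value theorem, and the amplitude attains a maximum over [- eta, eta]; phases
    farther away have smaller amplitude than b = 0. *)
Lemma stationary_existence (lam s0 x1 x2 M C e0 : R) (H1 H2 : R -> R -> R -> R -> R) :
  0 < lam -> 0 < x1 < 1 -> 1 < x2 -> Rabs s0 < M -> 0 <= C -> 0 < e0 ->
  small_lipschitz (phase_box x1 x2 M) C e0 H1 ->
  small_lipschitz (phase_box x1 x2 M) C e0 H2 ->
  exists e1 eta delta, 0 < e1 <= e0 /\ 0 < eta /\ 0 < delta /\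
  forall eps, 0 < eps < e1 ->
    (forall b, Rabs b <= eta -> exists x s, phase_box x1 x2 M x b s /\
       normalized_stationary lam s0 H1 H2 eps x b s) /\
    (forall s, Rabs (s - s0) <= delta -> exists x b, phase_box x1 x2 M x b s /\
       normalized_stationary lam s0 H1 H2 eps x b s) /\
    (exists x b s, phase_box x1 x2 M x b s /\
       normalized_stationary lam s0 H1 H2 eps x b s /\
       forall x' b' s', phase_box x1 x2 M x' b' s' ->
         normalized_stationary lam s0 H1 H2 eps x' b' s' -> x' <= x).
Proof.
  intros Hlam Hx1 Hx2 HM HC He0 HH1 HH2.
  destruct (stationary_curve lam s0 x1 x2 M C e0 H1 H2 Hx1 Hx2 HM HC He0 HH1 HH2)
    as [e1 [eta0 [He1 [Heta0 Hcurve]]]].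
  assert (Hs0 := Rabs_pos s0). assert (HPI := PI2_1).
  (* Small enough that the variation of s0 x^2, of order eta^2, is dominated by that of the sine
     term, of order lam eta. *)
  set (eta := Rmin eta0 (Rmin (1 / 2) (lam / (32 * (Rabs s0 + 1))))).
  assert (Heta : 0 < eta /\ eta <= eta0 /\ eta <= 1 / 2 /\ eta * (Rabs s0 + 1) <= lam / 32).
  { unfold eta. repeat split.
    - repeat apply Rmin_glb_lt; try lra. apply Rdiv_lt_0_compat; lra.
    - apply Rmin_l.
    - apply Rle_trans with (1 := Rmin_r _ _), Rmin_l.
    - apply Rle_trans with (lam / (32 * (Rabs s0 + 1)) * (Rabs s0 + 1)).
      + apply Rmult_le_compat_r; [lra|].
        apply Rle_trans with (1 := Rmin_r _ _), Rmin_r.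
      + right; field; lra. }
  destruct Heta as [Heta [Heta1 [Heta2 Heta3]]].
  assert (Hcoseta : cos eta < 1).
  { rewrite <- cos_0. apply cos_decreasing_1; lra. }
  set (k := Rmin (Rmin (lam * eta / 128) ((1 - cos eta) / 4)) (1 / 4)).
  assert (Hk : 0 < k /\ k <= lam * eta / 128 /\ k <= (1 - cos eta) / 4 /\ k <= 1 / 4).
  { unfold k. repeat split.
    - assert (0 < lam * eta) by now apply Rmult_lt_0_compat.
      repeat apply Rmin_glb_lt; lra.
    - apply Rle_trans with (1 := Rmin_l _ _), Rmin_l.
    - apply Rle_trans with (1 := Rmin_l _ _), Rmin_r.
    - apply Rmin_r. }
  destruct Hk as [Hk [Hk1 [Hk2 Hk3]]].
  set (q := (C + 1) * (3 * Rabs s0 + 1)).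
  assert (Hq : 0 < q) by (unfold q; apply Rmult_lt_0_compat; lra).
  destruct (small_epsilon q k) as [eq [[Heq0 _] Hsmall]]; [lra|exact Hk|].
  destruct (common_bound e1 eq (proj1 He1) Heq0) as [e2 [He2 [He21 He2q]]].
  exists e2, eta, (lam * eta / 64).
  split; [lra|].
  split; [exact Heta|].
  split; [apply Rdiv_lt_0_compat; [now apply Rmult_lt_0_compat|lra]|].
  intros eps Heps.
  assert (Heq : eps * q <= k) by (rewrite Rmult_comm; apply Rlt_le, Hsmall; lra).
  assert (HCe1 : C * eps * (3 * Rabs s0 + 1) <= k).
  { apply Rle_trans with (2 := Heq). unfold q.
    replace (C * eps * (3 * Rabs s0 + 1)) with (eps * (3 * Rabs s0 + 1) * C) by ring.
    replace (eps * ((C + 1) * (3 * Rabs s0 + 1)))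
      with (eps * (3 * Rabs s0 + 1) * (C + 1)) by ring.
    apply Rmult_le_compat_l; [|lra]. apply Rmult_le_pos; lra. }
  assert (HCe2 : C * eps <= k) by nra.
  destruct (Hcurve eps ltac:(lra)) as [X [S [L [HX [HS [Hsol Huniq]]]]]].
  assert (Hval : forall x b s, phase_box x1 x2 M x b s ->
    normalized_stationary lam s0 H1 H2 eps x b s ->
    Rabs (x - cos b) <= C * eps /\ Rabs (s - detuning0 lam s0 x b) <= C * eps).
  { intros x b s B [E1 E2].
    destruct (HH1 eps x b s x b s ltac:(lra) B B) as [B1 _].
    destruct (HH2 eps x b s x b s ltac:(lra) B B) as [B2 _]. split.
    - replace (x - cos b) with (H1 eps x b s) by lra. exact B1.
    - replace (s - detuning0 lam s0 x b) with (H2 eps x b s) by lra. exact B2. }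
  split; [|split].
  - intros b Hb. destruct (Hsol b) as [B E]; [lra|]. exists (X b), (S b). auto.
  - intros s Hs.
    (* At b = eta and b = - eta the sine term separates S b from s0 by at least lam eta / 64, on
       opposite sides. *)
    assert (Hend : forall b, Rabs b = eta -> Rabs (S b - s0 + lam / 2 * (sin b / X b))
              <= lam * eta / 16 + k).
    { intros b Hb. destruct (Hsol b) as [B E]; [lra|].
      destruct (Hval _ _ _ B E) as [V1 V2]. unfold detuning0 in V2.
      assert (Hb2 : b ^ 2 = eta ^ 2) by (rewrite <- Hb; symmetry; apply pow2_abs).
      generalize (one_minus_cos_bounds b). rewrite Hb2. intros Hc.
      assert (HX1 : Rabs (X b - 1) <= eta ^ 2 / 2 + C * eps).
      { replace (X b - 1) with ((X b - cos b) + - (1 - cos b)) by ring.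
        triangle.
        rewrite Rabs_Ropp, (Rabs_right (1 - cos b)); lra. }
      assert (HXb : Rabs (X b - 1) <= 1).
      { apply Rle_trans with (1 := HX1). nra. }
      replace (S b - s0 + lam / 2 * (sin b / X b))
        with ((S b - (s0 * X b ^ 2 - lam / 2 * (sin b / X b))) + s0 * ((X b - 1) * (X b + 1)))
        by ring.
      triangle.
      assert (Rabs (s0 * ((X b - 1) * (X b + 1))) <= Rabs s0 * ((eta ^ 2 / 2 + C * eps) * 3)).
      { rewrite Rabs_mult. apply Rmult_le_compat_l; [exact Hs0|]. rewrite Rabs_mult.
        apply Rmult_le_compat; try apply Rabs_pos; [exact HX1|].
        apply Rabs_le_between in HXb. apply Rabs_le. lra. }
      nra. }
    assert (Hsin : eta / 2 <= sin eta) by (apply sin_ge_half; lra).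
    assert (Hfr : forall b, Rabs b = eta -> 0 < X b <= 5 / 4).
    { intros b Hb. destruct (Hsol b) as [B E]; [lra|].
      destruct (Hval _ _ _ B E) as [V1 _]. destruct B as [B _].
      generalize (COS_bound b). apply Rabs_le_between in V1. lra. }
    assert (Hq4 : forall b, Rabs b = eta -> 2 / 5 * eta <= sin eta / X b).
    { intros b Hb. specialize (Hfr b Hb). apply Rmult_le_reg_r with (X b); [lra|].
      replace (sin eta / X b * X b) with (sin eta) by (field; lra).
      assert (eta * X b <= eta * (5 / 4)) by (apply Rmult_le_compat_l; lra). lra. }
    assert (Hp : S eta <= s0 - lam * eta / 64).
    { assert (Ha : Rabs eta = eta) by (apply Rabs_right; lra).
      generalize (Hend eta Ha) (Hq4 eta Ha). intros G1 G2. apply Rabs_le_between in G1.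
      nra. }
    assert (Hm : s0 + lam * eta / 64 <= S (- eta)).
    { assert (Ha : Rabs (- eta) = eta) by (rewrite Rabs_Ropp; apply Rabs_right; lra).
      generalize (Hend (- eta) Ha) (Hq4 (- eta) Ha). intros G1 G2.
      rewrite sin_neg in G1. apply Rabs_le_between in G1.
      replace (- sin eta / X (- eta)) with (- (sin eta / X (- eta))) in G1
        by (unfold Rdiv; ring). nra. }
    apply Rabs_le_between in Hs.
    destruct (IVT_gen S (- eta) eta s) as [b [Hb Eb]].
    + apply (lipschitz_continuity S L HS).
    + split; [apply Rle_trans with (1 := Rmin_r _ _); lra|].
      apply Rle_trans with (2 := Rmax_l _ _); lra.
    + rewrite Rmin_left, Rmax_right in Hb by lra.
      destruct (Hsol b) as [B E]; [apply Rabs_le; lra|].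
      exists (X b), b. rewrite <- Eb. auto.
  - destruct (continuity_ab_maj X (- eta) eta) as [bm [Hmax Hbm]].
    + lra.
    + intros c _. apply (lipschitz_continuity X L HX).
    + destruct (Hsol bm) as [B E]; [apply Rabs_le; lra|].
      exists (X bm), bm, (S bm). split; [exact B|]. split; [exact E|].
      intros x' b' s' B' E'.
      destruct (Hval _ _ _ B' E') as [V _].
      destruct (Rle_dec (Rabs b') eta) as [Hb'|Hb'].
      * destruct (Huniq _ _ _ B' E') as [-> _]. apply Hmax.
        now apply Rabs_le_between.
      (* For |b'| > eta the leading terms of X 0 and x' differ by at least 1 - cos eta, while each
         correction is at most a quarter of this. *)
      * destruct (Hsol 0) as [B0 E0]; [rewrite Rabs_R0; lra|].
        destruct (Hval _ _ _ B0 E0) as [V0 _]. rewrite cos_0 in V0.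
        assert (Hf : cos b' <= cos eta).
        { apply cos_le_of_far; [lra|apply B'|lra]. }
        apply Rle_trans with (X 0); [|apply Hmax; lra].
        apply Rabs_le_between in V. apply Rabs_le_between in V0. lra.
Qed.

(** * Second-order trigonometric estimates and expansion of the corrections *)

Lemma dist3_pos x b s x' b' s' : 0 <= dist3 x b s x' b' s'.
Proof.
  unfold dist3.
  generalize (Rabs_pos (x - x')) (Rabs_pos (b - b')) (Rabs_pos (s - s')); lra.
Qed.

(** On [- h, h] the derivative cos t - 1 of sin t - t is at most h in absolute value. The factor h
    turns differences at small phases into second-order terms. *)
Lemma Rabs_sin_minus_id_le (x y h : R) : Rabs x <= h -> Rabs y <= h ->
  Rabs (sin x - sin y - (x - y)) <= h * Rabs (x - y).
Proof.
  intros Hx Hy.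
  destruct (MVT_gen (fun t => sin t - t) y x (fun t => cos t - 1)) as [c [Hc E]].
  - intros z _. auto_derive; [trivial|ring].
  - intros z _. apply continuity_pt_minus; [apply continuity_sin|].
    apply derivable_continuous_pt, derivable_pt_id.
  - replace (sin x - sin y - (x - y)) with (sin x - x - (sin y - y)) by ring.
    rewrite E, Rabs_mult. apply Rmult_le_compat_r; [apply Rabs_pos|].
    generalize (Rabs_cos_minus_le c 0). rewrite cos_0, Rminus_0_r.
    intros H; apply Rle_trans with (1 := H). apply Rabs_le_between in Hx, Hy.
    apply Rabs_le. revert Hc. unfold Rmin, Rmax. repeat destruct (Rle_dec _ _); lra.
Qed.

Lemma Rabs_cos_minus_le_small (x y h : R) : Rabs x <= h -> Rabs y <= h ->
  Rabs (cos x - cos y) <= h * Rabs (x - y).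
Proof.
  intros Hx Hy.
  destruct (MVT_gen cos y x (fun t => - sin t)) as [c [Hc E]].
  - intros z _. auto_derive; [trivial|ring].
  - intros z _. apply continuity_cos.
  - rewrite E, Rabs_mult, Rabs_Ropp. apply Rmult_le_compat_r; [apply Rabs_pos|].
    apply Rle_trans with (1 := Rabs_sin_le c). apply Rabs_le_between in Hx, Hy.
    apply Rabs_le. revert Hc. unfold Rmin, Rmax. repeat destruct (Rle_dec _ _); lra.
Qed.

(** On [-1, 1] the cosine is at least 1 / 2, so its second derivative is at most - 1 / 2. The
    resulting quadratic loss is what locates the maximum. *)
Lemma cos_strong_concavity (x y : R) : Rabs x <= 1 -> Rabs y <= 1 ->
  cos x <= cos y - sin y * (x - y) - (x - y) ^ 2 / 4.
Proof.
  intros Hx Hy. apply Rabs_le_between in Hx, Hy.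
  destruct (MVT_gen (fun t => cos y - sin y * (t - y) - (t - y) ^ 2 / 4 - cos t) y x
              (fun t => - sin y - (t - y) / 2 + sin t)) as [c [Hc E]].
  - intros z _. auto_derive; [trivial|field].
  - intros z _. apply continuity_pt_filterlim.
    apply (ex_derive_continuous (fun t => cos y - sin y * (t - y) - (t - y) ^ 2 / 4 - cos t)).
    auto_derive. trivial.
  - destruct (MVT_gen sin y c cos) as [d [Hd F]].
    + intros z _. apply is_derive_Reals, derivable_pt_lim_sin.
    + intros z _. apply continuity_sin.
    + assert (Hcos : 1 / 2 <= cos d).
      { generalize (one_minus_cos_bounds d).
        assert (-1 <= d <= 1); [|nra].
        revert Hc Hd. unfold Rmin, Rmax. repeat destruct (Rle_dec _ _); lra. }
      assert (Hsgn : 0 <= (c - y) * (x - y)).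
      { revert Hc. unfold Rmin, Rmax. destruct (Rle_dec _ _); nra. }
      replace (- sin y - (c - y) / 2 + sin c) with ((cos d - 1 / 2) * (c - y)) in E by lra.
      assert (0 <= (cos d - 1 / 2) * (c - y) * (x - y)).
      { rewrite Rmult_assoc. apply Rmult_le_pos; lra. }
      rewrite Rminus_diag in E. lra.
Qed.

(** [A_1] times 2 / (lam a0) in the variables x and b; eliminating d and Fm through s0 and a0 also
    removes a0. See [amplitude_correction_eq]. *)
Definition amplitude_correction (om lam s0 x b s : R) : R :=
  (s0 * x ^ 3 - s * cos b / 2 + lam * sin b / 4 - 3 / 2 * s0 * x ^ 2 * cos b) / om.

Definition lipschitz_on_box (box : R -> R -> R -> Prop) (C : R) (f : R -> R -> R -> R) : Prop :=
  forall x b s x' b' s', box x b s -> box x' b' s' ->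
    Rabs (f x b s) <= C /\ Rabs (f x b s - f x' b' s') <= C * dist3 x b s x' b' s'.

(** The distance is abstract in the premise, so that [bl_solve] sees the three coordinates only
    through hypotheses; it is then instantiated by [dist3]. *)
Lemma lipschitz_on_box_intro (x1 x2 M : R) (f : R -> R -> R -> R) :
  (forall dist : R * R * R -> R * R * R -> R,
     let D := fun p => phase_box x1 x2 M (fst (fst p)) (snd (fst p)) (snd p) in
     (forall p q, 0 <= dist p q) ->
     bounded_lipschitz D dist (fun p => fst (fst p)) ->
     bounded_lipschitz D dist (fun p => snd (fst p)) ->
     bounded_lipschitz D dist (fun p => snd p) ->
     bounded_lipschitz D dist (fun p => f (fst (fst p)) (snd (fst p)) (snd p))) ->
  exists C, 0 <= C /\ lipschitz_on_box (phase_box x1 x2 M) C f.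
Proof.
  intros H.
  set (dist := fun p q : R * R * R => dist3 (fst (fst p)) (snd (fst p)) (snd p)
                                        (fst (fst q)) (snd (fst q)) (snd q)).
  set (D := fun p => phase_box x1 x2 M (fst (fst p)) (snd (fst p)) (snd p)).
  assert (dpos : forall p q, 0 <= dist p q) by (intros; apply dist3_pos).
  set (B := Rabs x1 + Rabs x2 + Rabs M + Rabs (PI / 2) + Rabs (3 * PI / 2) + 1).
  assert (HB : 1 <= B /\ Rabs x1 <= B /\ Rabs x2 <= B /\ Rabs M <= B /\
               Rabs (PI / 2) <= B /\ Rabs (3 * PI / 2) <= B).
  { unfold B. generalize (Rabs_pos x1) (Rabs_pos x2) (Rabs_pos M) (Rabs_pos (PI / 2))
      (Rabs_pos (3 * PI / 2)). lra. }
  assert (Hbd : forall lo hi t, Rabs lo <= B -> Rabs hi <= B -> lo <= t <= hi -> Rabs t <= B).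
  { intros lo hi t H1 H2 H3. apply Rabs_le_between in H1, H2. apply Rabs_le. lra. }
  assert (Hl : forall u p q, Rabs u <= dist p q -> Rabs u <= B * dist p q).
  { intros u p q Hu. apply Rle_trans with (1 := Hu). generalize (dpos p q); nra. }
  destruct (H dist dpos) as [C [HC HL]].
  - exists B. split; [lra|]. intros p q [Hp _] _.
    split; [apply (Hbd x1 x2); lra|]. apply Hl. unfold dist, dist3.
    generalize (Rabs_pos (snd (fst p) - snd (fst q))) (Rabs_pos (snd p - snd q)). lra.
  - exists B. split; [lra|]. intros p q [_ [Hp _]] _.
    split; [apply (Hbd (- (PI / 2)) (3 * PI / 2)); rewrite ?Rabs_Ropp; lra|].
    apply Hl. unfold dist, dist3.
    generalize (Rabs_pos (fst (fst p) - fst (fst q))) (Rabs_pos (snd p - snd q)). lra.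
  - exists B. split; [lra|]. intros p q [_ [_ Hp]] _.
    split; [apply (Hbd (- M) M); rewrite ?Rabs_Ropp; lra|].
    apply Hl. unfold dist, dist3.
    generalize (Rabs_pos (fst (fst p) - fst (fst q)))
      (Rabs_pos (snd (fst p) - snd (fst q))). lra.
  - exists C. split; [exact HC|]. intros x b s x' b' s' Hb Hb'.
    exact (HL (x, b, s) (x', b', s') Hb Hb').
Qed.

Lemma amplitude_correction_lipschitz (om lam s0 x1 x2 M : R) :
  exists C, 0 <= C /\
    lipschitz_on_box (phase_box x1 x2 M) C (amplitude_correction om lam s0).
Proof.
  apply lipschitz_on_box_intro. intros dist D dpos Hx Hb Hs.
  unfold amplitude_correction. bl_solve.
Qed.

(** What the O(eps^3) terms of the system become after division by a multiple of eps. *)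
Definition remainder2 (box : R -> R -> R -> Prop) (C e0 : R) (r : R -> R -> R -> R -> R) : Prop :=
  forall eps x b s x' b' s', 0 < eps < e0 -> box x b s -> box x' b' s' ->
    Rabs (r eps x b s) <= C * eps ^ 2 /\
    Rabs (r eps x b s - r eps x' b' s') <= C * eps ^ 2 * dist3 x b s x' b' s'.

Lemma remainder2_le (box : R -> R -> R -> Prop) (C C' e0 : R) (r : R -> R -> R -> R -> R) :
  C <= C' -> remainder2 box C e0 r -> remainder2 box C' e0 r.
Proof.
  intros HC Hr eps x b s x' b' s' He B B'. destruct (Hr _ _ _ _ _ _ _ He B B') as [V1 V2].
  assert (C * eps ^ 2 <= C' * eps ^ 2) by (apply Rmult_le_compat_r; [apply pow2_ge_0|exact HC]).
  split; [lra|]. apply Rle_trans with (1 := V2).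
  apply Rmult_le_compat_r; [apply dist3_pos|assumption].
Qed.

Lemma small_lipschitz_expansion (box : R -> R -> R -> Prop) (C C' e0 : R)
    (f : R -> R -> R -> R) (r : R -> R -> R -> R -> R) :
  0 <= C' -> e0 <= 1 -> lipschitz_on_box box C f -> remainder2 box C' e0 r ->
  small_lipschitz box (C + C') e0 (fun eps x b s => eps * f x b s + r eps x b s).
Proof.
  intros HC' He0 Hf Hr eps x b s x' b' s' He B B'.
  destruct (Hf _ _ _ _ _ _ B B') as [F1 F2].
  destruct (Hr _ _ _ _ _ _ _ He B B') as [R1 R2].
  assert (Hd := dist3_pos x b s x' b' s').
  assert (He2 : eps ^ 2 <= eps) by nra.
  assert (HCe : C' * eps ^ 2 <= C' * eps) by now apply Rmult_le_compat_l.
  split.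
  - triangle.
    rewrite Rabs_mult, (Rabs_right eps) by lra.
    assert (eps * Rabs (f x b s) <= eps * C) by (apply Rmult_le_compat_l; lra). lra.
  - match goal with |- Rabs (eps * ?a + ?b - (eps * ?c + ?d)) <= _ =>
      replace (eps * a + b - (eps * c + d)) with (eps * (a - c) + (b - d)) by ring end.
    triangle.
    rewrite Rabs_mult, (Rabs_right eps) by lra.
    assert (eps * Rabs (f x b s - f x' b' s') <= eps * (C * dist3 x b s x' b' s'))
      by (apply Rmult_le_compat_l; lra).
    assert (C' * eps ^ 2 * dist3 x b s x' b' s' <= C' * eps * dist3 x b s x' b' s')
      by (apply Rmult_le_compat_r; lra).
    lra.
Qed.

(** * Location of the maximum *)

(** A stationary point (x, b, s) and a competitor (x', eps lam / (2 om), s') at the same eps. The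
    phase of the competitor is determined by eps and is not stored. *)
Record point_pair := PointPair
  { pp_e : R; pp_x : R; pp_b : R; pp_s : R; pp_x' : R; pp_s' : R }.

Section Location.
Context (om lam s0 x1 x2 M C e0 : R) (alpha2 : R -> R -> R -> R)
  (r1 r2 : R -> R -> R -> R -> R).
Context (Hom : 0 < om) (Hlam : 0 < lam) (Hx1 : 0 < x1 < 1) (Hx2 : 1 < x2)
  (HM : Rabs s0 < M) (HC : 0 <= C) (He0 : 0 < e0 <= 1).
Local Notation box := (phase_box x1 x2 M).
Context (Ha2 : lipschitz_on_box box C alpha2)
  (Hr1 : remainder2 box C e0 r1) (Hr2 : remainder2 box C e0 r2).
Local Notation alpha1 := (amplitude_correction om lam s0).
Local Notation H1 := (fun eps x b s => eps * alpha1 x b s + r1 eps x b s).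
Local Notation H2 := (fun eps x b s => eps * alpha2 x b s + r2 eps x b s).
Local Notation stat := (normalized_stationary lam s0 H1 H2).
Local Notation beta := (lam / (2 * om)).

Lemma beta_pos : 0 < beta.
Proof. apply Rdiv_lt_0_compat; lra. Qed.

Lemma corrections_small : exists C1, 0 <= C1 /\
  small_lipschitz box C1 e0 H1 /\ small_lipschitz box C1 e0 H2.
Proof.
  destruct (amplitude_correction_lipschitz om lam s0 x1 x2 M) as [Ca [HCa Ha1]].
  assert (S1 := small_lipschitz_expansion box Ca C e0 alpha1 r1 HC (proj2 He0) Ha1 Hr1).
  assert (S2 := small_lipschitz_expansion box C C e0 alpha2 r2 HC (proj2 He0) Ha2 Hr2).
  exists (Ca + C + C). split; [lra|].
  split; intros eps x b s x' b' s' He B B'; assert (Hd := dist3_pos x b s x' b' s').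
  - destruct (S1 _ _ _ _ _ _ _ He B B') as [V1 V2]. split.
    + apply Rle_trans with (1 := V1). apply Rmult_le_compat_r; lra.
    + apply Rle_trans with (1 := V2). apply Rmult_le_compat_r; [lra|].
      apply Rmult_le_compat_r; lra.
  - destruct (S2 _ _ _ _ _ _ _ He B B') as [V1 V2]. split.
    + apply Rle_trans with (1 := V1). apply Rmult_le_compat_r; lra.
    + apply Rle_trans with (1 := V2). apply Rmult_le_compat_r; [lra|].
      apply Rmult_le_compat_r; lra.
Qed.

Definition comparison (e1 : R) (p : point_pair) : Prop :=
  0 < pp_e p < e1 /\ box (pp_x p) (pp_b p) (pp_s p) /\
  stat (pp_e p) (pp_x p) (pp_b p) (pp_s p) /\
  box (pp_x' p) (pp_e p * beta) (pp_s' p) /\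
  stat (pp_e p) (pp_x' p) (pp_e p * beta) (pp_s' p) /\ pp_x' p <= pp_x p.

Lemma comparison_bdd e1 : e1 <= e0 -> let D := comparison e1 in
  bdd D pp_e /\ bdd D pp_x /\ bdd D pp_x' /\ bdd D pp_s' /\
  bdd D (fun p => / pp_x p) /\ bdd D (fun p => / pp_x' p).
Proof.
  intros He1 D. repeat split.
  - apply bdd_intro with 1. intros p [He _]. rewrite Rabs_right; lra.
  - apply bdd_intro with x2. intros p [_ [[Hp _] _]]. rewrite Rabs_right; lra.
  - apply bdd_intro with x2. intros p [_ [_ [_ [[Hp _] _]]]]. rewrite Rabs_right; lra.
  - apply bdd_intro with M. intros p [_ [_ [_ [[_ [_ Hp]] _]]]]. now apply Rabs_le.
  - apply bdd_inv with x1; [lra|]. intros p [_ [[Hp _] _]]. rewrite Rabs_right; lra.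
  - apply bdd_inv with x1; [lra|]. intros p [_ [_ [_ [[Hp _] _]]]]. rewrite Rabs_right; lra.
Qed.

(** From x' <= x and the amplitude equations, cos b >= cos (eps beta) - 2 C1 eps. As cos 1 <= 3 / 4,
    this excludes |b| > 1 once K eps < 1 / 5. *)
Lemma near_maximum : exists e1 K, 0 < e1 <= e0 /\ 0 <= K /\
  forall eps x b s x' s', 0 < eps < e1 -> box x b s -> stat eps x b s ->
    box x' (eps * beta) s' -> stat eps x' (eps * beta) s' -> x' <= x ->
    Rabs (x - 1) <= K * eps /\ Rabs (x' - 1) <= K * eps /\ Rabs b <= 1.
Proof.
  destruct corrections_small as [C1 [HC1 [S1 _]]]. assert (Hb := beta_pos).
  set (K := 2 * C1 + beta). assert (HK : 0 < K) by (unfold K; lra).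
  destruct (small_epsilon K (1 / 5)) as [eq [[Heq _] Hsmall]]; [lra|lra|].
  destruct (common_bound e0 eq (proj1 He0) Heq) as [e1 [He1 [He10 He1q]]].
  exists e1, K. split; [lra|]. split; [lra|].
  intros eps x b s x' s' He B [Ex _] B' [Ex' _] Hle.
  assert (He' : 0 < eps < e0) by lra.
  assert (HKe : K * eps < 1 / 5) by (apply Hsmall; lra).
  destruct (S1 _ _ _ _ _ _ _ He' B B) as [V _].
  destruct (S1 _ _ _ _ _ _ _ He' B' B') as [V' _].
  cbv beta in V, V'.
  assert (Vx : Rabs (x - cos b) <= C1 * eps).
  { apply Rle_trans with (2 := V). right. f_equal. lra. }
  assert (Vx' : Rabs (x' - cos (eps * beta)) <= C1 * eps).
  { apply Rle_trans with (2 := V'). right. f_equal. lra. }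
  assert (Hc : Rabs (cos (eps * beta) - 1) <= eps * beta).
  { generalize (Rabs_cos_minus_le (eps * beta) 0). rewrite cos_0, Rminus_0_r.
    rewrite (Rabs_right (eps * beta)); [easy|]. apply Rle_ge, Rmult_le_pos; lra. }
  generalize (COS_bound b). intros Hcb.
  apply Rabs_le_between in Vx, Vx', Hc.
  unfold K in *. split; [apply Rabs_le; nra|]. split; [apply Rabs_le; nra|].
  destruct (Rle_dec (Rabs b) 1) as [|Hn]; [assumption|exfalso].
  assert (HPI := PI2_1).
  assert (cos b <= cos 1).
  { apply cos_le_of_far; [lra|apply B|lra]. }
  generalize (cos_strong_concavity 1 0). rewrite Rabs_R1, Rabs_R0, cos_0, sin_0.
  intros Hs. specialize (Hs ltac:(lra) ltac:(lra)). nra.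
Qed.

(* The competitor is the stationary point of phase eps beta.  With
   d = b - eps beta, subtracting the two amplitude equations gives
   0 <= x - x' <= - d^2 / 4 + O(eps (|d| + eps) |d|), because the terms linear
   in d cancel. *)
Lemma maximum_phase : exists e1 K, 0 < e1 <= e0 /\ 0 <= K /\
  forall eps x b s x' s', 0 < eps < e1 -> box x b s -> stat eps x b s ->
    box x' (eps * beta) s' -> stat eps x' (eps * beta) s' -> x' <= x ->
    Rabs (b - eps * beta) <= K * eps ^ 2 /\ Rabs (x - 1) <= K * eps.
Proof.
  destruct near_maximum as [ea [Ka [Hea [HKa Hnear]]]].
  destruct corrections_small as [C1 [HC1 [_ S2]]].
  destruct (detuning0_lipschitz lam s0 x1 x2 (proj1 Hx1)) as [L [HL Hdet]].
  assert (Hb := beta_pos).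
  destruct (small_epsilon C1 (1 / 2) HC1) as [eq [[Heq _] Hsmall]]; [lra|].
  destruct (common_bound ea eq (proj1 Hea) Heq) as [eb [Heb [Heba Hebq]]].
  set (D := comparison eb).
  destruct (comparison_bdd eb ltac:(lra)) as [Be [Bx [Bx' [Bs' [Bix Bix']]]]].
  fold D in Be, Bx, Bx', Bs', Bix, Bix'.
  set (b' := fun p => pp_e p * beta).
  set (dx := fun p => pp_x p - pp_x' p). set (db := fun p => pp_b p - b' p).
  set (ds := fun p => pp_s p - pp_s' p).
  set (U := fun p => Rabs (dx p) + Rabs (db p)).
  (* Gauge for the admissible errors in the difference of the corrections. After multiplication by
     eps it is absorbed by d^2 / 4 and x - x', up to a multiple of eps^2 |d|. *)
  set (W := fun p => (Rabs (pp_b p) + pp_e p) * Rabs (db p) + Rabs (dx p)).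
  assert (Hn : forall p, D p -> Rabs (pp_x p - 1) <= Ka * pp_e p /\
     Rabs (pp_x' p - 1) <= Ka * pp_e p /\ Rabs (pp_b p) <= 1).
  { intros p [He [B [S [B' [S' Hle]]]]].
    apply (Hnear (pp_e p) _ _ (pp_s p) _ (pp_s' p)); auto. lra. }
  assert (HW : forall p, D p -> 0 <= U p /\ 0 <= W p /\ Rabs (U p) = U p /\ Rabs (W p) = W p).
  { intros p [He _]. assert (G1 := Rabs_pos (dx p)). assert (G2 := Rabs_pos (db p)).
    assert (G3 := Rabs_pos (pp_b p)).
    assert (0 <= U p) by (unfold U; lra).
    assert (0 <= W p) by (unfold W; nra).
    rewrite !Rabs_right by lra. auto. }
  assert (Ox : bigO D pp_e (fun p => pp_x p - 1)).
  { apply bigO_intro with Ka. intros p Hp. rewrite (Rabs_right (pp_e p)).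
    - apply Hn, Hp.
    - apply Rle_ge, Rlt_le. apply Hp. }
  assert (Wx : bigO D W dx).
  { apply bigO_intro with 1. intros p Hp. destruct (HW p Hp) as [_ [_ [_ ->]]]. unfold W.
    generalize (Rabs_pos (pp_b p)) (Rabs_pos (db p)). destruct Hp as [He _]. nra. }
  assert (Wb : bigO D W (fun p => pp_b p * db p)).
  { apply bigO_intro with 1. intros p Hp. destruct (HW p Hp) as [_ [_ [_ ->]]]. unfold W.
    rewrite Rabs_mult.
    generalize (Rabs_pos (dx p)) (Rabs_pos (db p)). destruct Hp as [He _]. nra. }
  assert (We : bigO D W (fun p => pp_e p * db p)).
  { apply bigO_intro with 1. intros p Hp. destruct (HW p Hp) as [_ [_ [_ ->]]]. unfold W.
    rewrite Rabs_mult. destruct Hp as [He _]. rewrite (Rabs_right (pp_e p)) by lra.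
    generalize (Rabs_pos (dx p)) (Rabs_pos (db p)) (Rabs_pos (pp_b p)). nra. }
  (* The difference of the phase equations contains ds on the right with a factor C1 eps < 1 / 2,
     which is moved to the left-hand side. *)
  assert (Us : bigO D U ds).
  { apply bigO_intro with (2 * (L + C1)). intros p Hp.
    destruct (HW p Hp) as [HU [_ [-> _]]].
    destruct Hp as [He [B [[_ E] [B' [[_ E'] _]]]]].
    destruct (S2 (pp_e p) _ _ _ _ _ _ ltac:(lra) B B') as [_ V]. cbv beta in V.
    generalize (Hdet (pp_x p) (pp_b p) (pp_x' p) (b' p) (proj1 B) (proj1 B')).
    fold (dx p) (db p) (U p). intros V'. unfold dist3 in V. fold (dx p) (b' p) (db p) (ds p) in V.
    assert (T : Rabs (ds p) <= L * U p + C1 * pp_e p * (U p + Rabs (ds p))).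
    { apply Rle_trans with (2 := Rplus_le_compat _ _ _ _ V' V).
      apply Rle_trans with (2 := Rabs_triang _ _). right. f_equal.
      unfold ds. rewrite E at 1. rewrite E' at 1. unfold b'. ring. }
    assert (HCe : C1 * pp_e p < 1 / 2) by (apply Hsmall; lra).
    assert (C1 * pp_e p <= C1) by nra.
    generalize (Rabs_pos (ds p)). intros.
    assert (C1 * pp_e p * U p <= C1 * U p) by (apply Rmult_le_compat_r; lra).
    assert (C1 * pp_e p * Rabs (ds p) <= 1 / 2 * Rabs (ds p)) by (apply Rmult_le_compat_r; lra).
    lra. }
  assert (WeU : bigO D W (fun p => pp_e p * U p)).
  { apply bigO_intro with 1. intros p Hp. generalize (HW p Hp); intros [HU [_ [_ ->]]].
    destruct Hp as [He _]. rewrite Rabs_right by (apply Rle_ge, Rmult_le_pos; lra).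
    unfold W, U.
    generalize (Rabs_pos (dx p)) (Rabs_pos (db p)) (Rabs_pos (pp_b p)). intros.
    nra. }
  assert (Hds : exists Ks, 0 <= Ks /\ forall p, D p ->
            Rabs (dx p) + Rabs (db p) + Rabs (ds p) <= Ks * U p).
  { destruct Us as [Ku [HKu Hu]]. exists (1 + Ku). split; [lra|]. intros p Hp.
    generalize (Hu p Hp) (HW p Hp). intros V [_ [_ [EU _]]]. rewrite EU in V. unfold U in *. lra. }
  destruct Hds as [Ks [HKs Hds]].
  assert (WH2 : bigO D W (fun p => H2 (pp_e p) (pp_x p) (pp_b p) (pp_s p)
                                   - H2 (pp_e p) (pp_x' p) (b' p) (pp_s' p))).
  { apply bigO_trans with (fun p => pp_e p * U p); [|exact WeU].
    apply bigO_intro with (C1 * Ks). intros p Hp.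
    generalize (Hds p Hp) (HW p Hp). intros V [HU _].
    destruct Hp as [He [B [_ [B' _]]]].
    destruct (S2 (pp_e p) _ _ _ _ _ _ ltac:(lra) B B') as [_ V']. cbv beta in V'.
    unfold b'. apply Rle_trans with (1 := V').
    rewrite (Rabs_right (pp_e p * U p)) by (apply Rle_ge, Rmult_le_pos; lra).
    replace (C1 * Ks * (pp_e p * U p)) with (C1 * pp_e p * (Ks * U p)) by ring.
    apply Rmult_le_compat_l; [apply Rmult_le_pos; lra|]. exact V. }
  assert (Hbb : forall p, D p -> Rabs (pp_b p) <= Rabs (pp_b p) + beta * pp_e p /\
                               Rabs (b' p) <= Rabs (pp_b p) + beta * pp_e p).
  { intros p [He _]. unfold b'.
    assert (0 <= pp_e p * beta) by (apply Rmult_le_pos; lra).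
    rewrite (Rabs_right (pp_e p * beta)) by lra.
    generalize (Rabs_pos (pp_b p)). lra. }
  assert (Hw : forall p, D p -> (Rabs (pp_b p) + beta * pp_e p) * Rabs (db p) <= (1 + beta) * W p).
  { intros p [He _]. unfold W.
    generalize (Rabs_pos (dx p)) (Rabs_pos (db p)) (Rabs_pos (pp_b p)). intros.
    assert (0 <= Rabs (pp_b p) * Rabs (db p)) by (apply Rmult_le_pos; lra).
    nra. }
  assert (Wsin : bigO D W (fun p => sin (pp_b p) - sin (b' p) - db p)).
  { apply bigO_intro with (1 + beta). intros p Hp.
    destruct (Hbb p Hp) as [G1 G2]. destruct (HW p Hp) as [_ [_ [_ ->]]].
    apply Rle_trans with (2 := Hw p Hp). now apply Rabs_sin_minus_id_le. }
  assert (Wcos : bigO D W (fun p => cos (pp_b p) - cos (b' p))).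
  { apply bigO_intro with (1 + beta). intros p Hp.
    destruct (Hbb p Hp) as [G1 G2]. destruct (HW p Hp) as [_ [_ [_ ->]]].
    apply Rle_trans with (2 := Hw p Hp). now apply Rabs_cos_minus_le_small. }
  assert (Wcb : bigO D W (fun p => (cos (pp_b p) - 1) * db p)).
  { apply bigO_trans with (2 := Wb). apply bigO_intro with 1. intros p _.
    rewrite !Rabs_mult, Rmult_1_l. apply Rmult_le_compat_r; [apply Rabs_pos|].
    generalize (Rabs_cos_minus_le (pp_b p) 0). now rewrite cos_0, Rminus_0_r. }
  assert (Wix : bigO D W (fun p => (/ pp_x p - 1) * db p)).
  { apply bigO_ext with (fun p => - (/ pp_x p) * ((pp_x p - 1) * db p)).
    - intros p [_ [[Hp _] _]]. field. lra.
    - apply bigO_bdd_l; [bdd_solve|]. apply bigO_trans with (2 := We).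
      apply bigO_mult; [exact Ox|apply bigO_refl]. }
  (* Linear part of the phase equation at x = 1, b = 0: the detuning moves by - lam / 2 times the
     change of phase. *)
  assert (Wds : bigO D W (fun p => ds p + lam / 2 * db p)).
  { apply bigO_ext with (fun p => s0 * (pp_x p + pp_x' p) * dx p
      - lam / 2 * ((/ pp_x p) * (sin (pp_b p) - sin (b' p) - db p)
                   + (/ pp_x p - 1) * db p
                   - sin (b' p) * / pp_x p * / pp_x' p * dx p)
      + (H2 (pp_e p) (pp_x p) (pp_b p) (pp_s p) - H2 (pp_e p) (pp_x' p) (b' p) (pp_s' p))).
    - intros p [He [B [[_ E] [B' [[_ E'] _]]]]]. unfold ds. rewrite E at 1. rewrite E' at 1.
      unfold detuning0, dx, db, b'. destruct B as [B _], B' as [B' _]. field. lra.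
    - apply bigO_plus; [|exact WH2]. apply bigO_minus.
      + apply bigO_bdd_l; [bdd_solve|exact Wx].
      + apply bigO_bdd_l; [bdd_solve|]. apply bigO_minus; [apply bigO_plus|].
        * apply bigO_bdd_l; [bdd_solve|exact Wsin].
        * exact Wix.
        * apply bigO_bdd_l; [bdd_solve|exact Wx]. }
  (* The slope beta = lam / (2 om) is a sum of two equal parts lam / (4 om): one from the term lam
     sin b / 4, the other from - s cos b / 2 because s moves according to [Wds]. *)
  assert (Walpha : bigO D W (fun p => alpha1 (pp_x p) (pp_b p) (pp_s p)
                       - alpha1 (pp_x' p) (b' p) (pp_s' p) - beta * db p)).
  { apply bigO_ext with (fun p => / om * (
        s0 * (pp_x p ^ 2 + pp_x p * pp_x' p + pp_x' p ^ 2) * dx p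
        - cos (pp_b p) / 2 * (ds p + lam / 2 * db p)
        + lam / 4 * ((cos (pp_b p) - 1) * db p)
        - pp_s' p / 2 * (cos (pp_b p) - cos (b' p))
        + lam / 4 * (sin (pp_b p) - sin (b' p) - db p)
        - 3 / 2 * s0 * (pp_x p + pp_x' p) * cos (pp_b p) * dx p
        - 3 / 2 * s0 * pp_x' p ^ 2 * (cos (pp_b p) - cos (b' p)))).
    - intros p _. unfold amplitude_correction, dx, ds, db. field. lra.
    - apply bigO_bdd_l; [bdd_solve|].
      repeat first [apply bigO_minus | apply bigO_plus];
        (apply bigO_bdd_l; [bdd_solve|assumption]). }
  destruct Walpha as [K1 [HK1 Halpha]].
  set (K2 := C * Ks). assert (HK2 : 0 <= K2) by (apply Rmult_le_pos; lra).
  (* Coefficients of eps^2 |d|: from sin (eps beta) - eps beta, from eps times the difference of the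
     corrections, and from the remainders. *)
  set (K := beta ^ 2 + K1 * (beta + 1) + K2).
  assert (HK : 0 <= K).
  { unfold K. assert (0 <= K1 * (beta + 1)) by (apply Rmult_le_pos; lra).
    generalize (pow2_ge_0 beta). lra. }
  destruct (small_epsilon (K1 + K2 + 1) (1 / 8)) as [ek [[Hek _] Hsmallk]]; [lra|lra|].
  destruct (common_bound eb ek Heb Hek) as [e1 [He1 [He1b He1k]]].
  exists e1, (8 * K + Ka). split; [lra|]. split; [lra|].
  intros eps x b s x' s' He B S B' S' Hle.
  set (p := PointPair eps x b s x' s').
  assert (Hp : D p) by (unfold D, comparison, p; simpl; repeat split; try apply B; try apply B';
    try apply S; try apply S'; lra).
  destruct (Hn p Hp) as [N1 [N2 N3]]. unfold p in N1, N2, N3; simpl in N1, N2, N3.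
  split.
  2: { apply Rle_trans with (1 := N1). apply Rmult_le_compat_r; lra. }
  generalize (Halpha p Hp) (Hds p Hp) (HW p Hp). unfold W, U, dx, db, ds, b', p; simpl.
  intros V1 V2 [_ [_ [_ EW]]]. rewrite EW in V1. clear EW.
  destruct (Hr1 eps _ _ _ _ _ _ ltac:(lra) B B') as [_ V3]. unfold dist3 in V3.
  set (d := b - eps * beta) in *.
  rewrite (Rabs_right (x - x')) in * by lra.
  set (y := x - x') in *. assert (Hy : 0 <= y) by (unfold y; lra).
  assert (Hd := Rabs_pos d).
  assert (Hbe : 0 <= eps * beta) by (apply Rmult_le_pos; lra).
  assert (Hbe1 : eps * beta <= 1).
  { destruct (Hnear eps x' (eps * beta) s' x' s') as [_ [_ G]]; auto; try lra.
    rewrite Rabs_right in G; lra. }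
  assert (V4 := cos_strong_concavity b (eps * beta) N3 ltac:(rewrite Rabs_right; lra)).
  fold d in V4.
  assert (V5 : Rabs (sin (eps * beta) - eps * beta) <= (eps * beta) ^ 2).
  { generalize (Rabs_sin_minus_id_le (eps * beta) 0 (eps * beta)).
    rewrite Rabs_R0, sin_0, !Rminus_0_r, (Rabs_right (eps * beta)) by lra.
    intros G. specialize (G ltac:(lra) Hbe). lra. }
  assert (V6 : - sin (eps * beta) * d <= - (eps * beta) * d + eps ^ 2 * beta ^ 2 * Rabs d).
  { assert (T : Rabs ((sin (eps * beta) - eps * beta) * d) <= (eps * beta) ^ 2 * Rabs d)
      by (rewrite Rabs_mult; now apply Rmult_le_compat_r).
    apply Rabs_le_between in T. lra. }
  assert (Hbd : Rabs b <= Rabs d + beta * eps).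
  { replace b with (d + eps * beta) at 1 by (unfold d; ring).
    triangle. rewrite (Rabs_right (eps * beta)); lra. }
  set (da := alpha1 x b s - alpha1 x' (eps * beta) s') in *.
  set (dr := r1 eps x b s - r1 eps x' (eps * beta) s') in *.
  assert (Ey : y = cos b - cos (eps * beta) + eps * da + dr).
  { unfold y, da, dr. destruct S as [E _], S' as [E' _].
    rewrite E at 1. rewrite E' at 1. ring. }
  assert (Hdd : Rabs d * Rabs d = d ^ 2) by (rewrite <- (pow2_abs d); ring).
  assert (V7 : da <= beta * d + K1 * ((Rabs d + (beta + 1) * eps) * Rabs d + y)).
  { apply Rabs_le_between in V1.
    assert (K1 * ((Rabs b + eps) * Rabs d + y) <= K1 * ((Rabs d + (beta + 1) * eps) * Rabs d + y)).
    { apply Rmult_le_compat_l; [exact HK1|]. apply Rplus_le_compat_r.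
      apply Rmult_le_compat_r; lra. }
    lra. }
  assert (V8 : eps * da <= eps * beta * d + K1 * eps * d ^ 2 + K1 * (beta + 1) * eps ^ 2 * Rabs d
                 + K1 * eps * y).
  { rewrite <- Hdd. apply Rmult_le_compat_l with (r := eps) in V7; [lra|lra]. }
  assert (V9 : dr <= K2 * eps ^ 2 * (y + Rabs d)).
  { apply Rabs_le_between in V3. apply Rle_trans with (1 := proj2 V3). unfold K2.
    replace (C * Ks * eps ^ 2 * (y + Rabs d)) with (C * eps ^ 2 * (Ks * (y + Rabs d))) by ring.
    apply Rmult_le_compat_l; [|exact V2]. apply Rmult_le_pos; [exact HC|apply pow2_ge_0]. }
  assert (HeK : (K1 + K2 + 1) * eps < 1 / 8) by (apply Hsmallk; lra).
  assert (T1 : K1 * eps * d ^ 2 <= 1 / 8 * d ^ 2) by (apply Rmult_le_compat_r; nra).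
  assert (T2 : K1 * eps * y + K2 * eps ^ 2 * y <= 1 / 8 * y).
  { rewrite <- Rmult_plus_distr_r. apply Rmult_le_compat_r; [exact Hy|].
    assert (K2 * eps ^ 2 <= K2 * eps) by (apply Rmult_le_compat_l; nra). lra. }
  (* As y >= 0, the loss d^2 / 4 is at most the sum of the errors; [T1] absorbs half of it and [T2]
     part of y. Dividing by |d| then gives the bound. *)
  assert (F : d ^ 2 / 8 <= K * eps ^ 2 * Rabs d).
  { unfold K. lra. }
  assert (He2 := pow2_ge_0 eps).
  destruct (Rle_lt_dec (Rabs d) 0) as [Hz|Hz].
  - apply Rle_trans with (1 := Hz). apply Rmult_le_pos; lra.
  - assert (Rabs d <= 8 * K * eps ^ 2).
    { apply Rmult_le_reg_r with (1 := Hz). lra. }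
    assert (0 <= Ka * eps ^ 2) by (apply Rmult_le_pos; lra). lra.
Qed.

(** Origin of the coefficients: [amplitude_correction] at (1, 0, s0) is - s0 / om; in the detuning,
    s0 x^2 contributes - 2 s0^2 / om and the sine term, at b = eps lam / (2 om), contributes - lam^2
    / (4 om). *)
Lemma maximum_location : exists e1 K, 0 < e1 <= e0 /\ 0 <= K /\
  forall eps x b s x' s', 0 < eps < e1 -> box x b s -> stat eps x b s ->
    box x' (eps * beta) s' -> stat eps x' (eps * beta) s' -> x' <= x ->
    Rabs (b - eps * beta) <= K * eps ^ 2 /\
    Rabs (x - (1 - eps * (s0 / om))) <= K * eps ^ 2 /\
    Rabs (s - (s0 + eps * (- 2 * s0 ^ 2 / om - lam ^ 2 / (4 * om) + alpha2 1 0 s0)))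
      <= K * eps ^ 2.
Proof.
  destruct maximum_phase as [e1 [K [He1 [HK Hphase]]]].
  destruct corrections_small as [C1 [HC1 [S1 S2]]].
  destruct (detuning0_lipschitz lam s0 x1 x2 (proj1 Hx1)) as [L [HL Hdet]].
  destruct (amplitude_correction_lipschitz om lam s0 x1 x2 M) as [Ca [HCa Ha1]].
  set (D := comparison e1).
  destruct (comparison_bdd e1 ltac:(lra)) as [Be [Bx [Bx' [Bs' [Bix Bix']]]]].
  fold D in Be, Bx, Bx', Bs', Bix, Bix'.
  set (e2 := fun p => pp_e p ^ 2).
  assert (He : forall p, D p -> 0 < pp_e p <= 1 /\ Rabs (pp_e p) = pp_e p /\ Rabs (e2 p) = e2 p).
  { intros p [He _]. unfold e2. generalize (pow2_ge_0 (pp_e p)). intros.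
    rewrite !Rabs_right; lra. }
  assert (Hph : forall p, D p -> Rabs (pp_b p - pp_e p * beta) <= K * pp_e p ^ 2 /\
                          Rabs (pp_x p - 1) <= K * pp_e p).
  { intros p [He' [B [S [B' [S' Hle]]]]]. apply (Hphase _ _ _ (pp_s p) (pp_x' p) (pp_s' p)); auto. }
  assert (Ob : bigO D e2 (fun p => pp_b p - pp_e p * beta)).
  { apply bigO_intro with K. intros p Hp. destruct (He p Hp) as [_ [_ ->]]. now apply Hph. }
  assert (Ox : bigO D pp_e (fun p => pp_x p - 1)).
  { apply bigO_intro with K. intros p Hp. destruct (He p Hp) as [_ [-> _]]. now apply Hph. }
  assert (Oe2 : bigO D pp_e e2) by now apply bigO_sqr.
  assert (Ob1 : bigO D pp_e pp_b).
  { apply bigO_ext with (fun p => (pp_b p - pp_e p * beta) + pp_e p * beta); [intros; ring|].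
    apply bigO_plus; [apply bigO_trans with (1 := Ob), Oe2|].
    apply bigO_bdd_r; [apply bigO_refl|apply bdd_const]. }
  assert (Obb : bigO D e2 (fun p => pp_b p * pp_b p)).
  { now apply bigO_mult_sqr. }
  assert (Osin : bigO D e2 (fun p => sin (pp_b p) - pp_b p)).
  { apply bigO_trans with (2 := Obb). apply bigO_intro with 1. intros p _.
    generalize (Rabs_sin_minus_id_le (pp_b p) 0 (Rabs (pp_b p))).
    rewrite sin_0, Rabs_R0, !Rminus_0_r, Rabs_mult, Rmult_1_l.
    intros G; apply G; [lra|apply Rabs_pos]. }
  assert (Ocos : bigO D e2 (fun p => cos (pp_b p) - 1)).
  { apply bigO_trans with (2 := Obb). apply bigO_intro with 1. intros p _.
    generalize (one_minus_cos_bounds (pp_b p)) (pow2_ge_0 (pp_b p)). intros G1 G2.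
    rewrite Rabs_minus_sym, !Rabs_right; nra. }
  assert (Os : bigO D pp_e (fun p => pp_s p - s0)).
  { apply bigO_ext with (fun p => (detuning0 lam s0 (pp_x p) (pp_b p) - detuning0 lam s0 1 0)
       + H2 (pp_e p) (pp_x p) (pp_b p) (pp_s p)).
    - intros p [_ [_ [[_ E] _]]]. rewrite E at 1. unfold detuning0 at 3. rewrite sin_0. field.
    - apply bigO_plus.
      + destruct Ox as [Kx [HKx Ox]], Ob1 as [Kb [HKb Ob1]].
        apply bigO_intro with (L * (Kx + Kb)). intros p Hp.
        assert (B : x1 <= pp_x p <= x2) by apply Hp.
        apply Rle_trans with (1 := Hdet _ _ 1 0 B ltac:(lra)).
        rewrite Rminus_0_r. generalize (Ox p Hp) (Ob1 p Hp). intros.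
        rewrite Rmult_assoc. apply Rmult_le_compat_l; lra.
      + apply bigO_intro with C1. intros p Hp. destruct (He p Hp) as [_ [-> _]].
        destruct Hp as [He' [B _]].
        apply (S2 (pp_e p) _ _ _ _ _ _ ltac:(lra) B B). }
  assert (Hcentre : box 1 0 s0).
  { assert (HP := PI_RGT_0). apply Rlt_le, Rabs_le_between in HM. repeat split; lra. }
  assert (Olip : forall f Cf, 0 <= Cf -> lipschitz_on_box box Cf f ->
     bigO D pp_e (fun p => f (pp_x p) (pp_b p) (pp_s p) - f 1 0 s0)).
  { intros f Cf HCf Hf. destruct Ox as [Kx [HKx Ox]], Ob1 as [Kb [HKb Ob1]], Os as [Ks [HKs Os]].
    apply bigO_intro with (Cf * (Kx + Kb + Ks)). intros p Hp.
    assert (B : box (pp_x p) (pp_b p) (pp_s p)) by apply Hp.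
    destruct (Hf _ _ _ _ _ _ B Hcentre) as [_ V]. unfold dist3 in V.
    rewrite Rminus_0_r in V. apply Rle_trans with (1 := V).
    generalize (Ox p Hp) (Ob1 p Hp) (Os p Hp). intros.
    rewrite Rmult_assoc. apply Rmult_le_compat_l; lra. }
  assert (Orem : forall r, remainder2 box C e0 r ->
     bigO D e2 (fun p => r (pp_e p) (pp_x p) (pp_b p) (pp_s p))).
  { intros r Hr. apply bigO_intro with C. intros p Hp. destruct (He p Hp) as [_ [_ ->]].
    destruct Hp as [He' [B _]].
    apply (Hr (pp_e p) _ _ _ _ _ _ ltac:(lra) B B). }
  assert (Omul : forall f, bigO D pp_e f -> bigO D e2 (fun p => pp_e p * f p)).
  { intros f Hf. apply bigO_mult_sqr; [apply bigO_refl|exact Hf]. }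
  assert (Qx : bigO D e2 (fun p => pp_x p - (1 - pp_e p * (s0 / om)))).
  { apply bigO_ext with (fun p => (cos (pp_b p) - 1)
      + pp_e p * (alpha1 (pp_x p) (pp_b p) (pp_s p) - alpha1 1 0 s0)
      + r1 (pp_e p) (pp_x p) (pp_b p) (pp_s p)).
    - intros p [_ [_ [[E _] _]]]. rewrite E at 1. unfold amplitude_correction at 3.
      rewrite cos_0, sin_0. field. lra.
    - apply bigO_plus; [apply bigO_plus|].
      + exact Ocos.
      + apply Omul. apply (Olip alpha1 Ca HCa Ha1).
      + apply Orem, Hr1. }
  assert (Qs : bigO D e2 (fun p => pp_s p
     - (s0 + pp_e p * (- 2 * s0 ^ 2 / om - lam ^ 2 / (4 * om) + alpha2 1 0 s0)))).
  { apply bigO_ext with (fun p =>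
        s0 * (pp_x p + 1) * (pp_x p - (1 - pp_e p * (s0 / om)))
        - s0 * (s0 / om) * (pp_e p * (pp_x p - 1))
        - lam / 2 * (/ pp_x p * (sin (pp_b p) - pp_b p)
                     + / pp_x p * (pp_b p - pp_e p * beta)
                     - beta * / pp_x p * (pp_e p * (pp_x p - 1)))
        + pp_e p * (alpha2 (pp_x p) (pp_b p) (pp_s p) - alpha2 1 0 s0)
        + r2 (pp_e p) (pp_x p) (pp_b p) (pp_s p)).
    - intros p [_ [[B _] [[_ E] _]]]. rewrite E at 1. unfold detuning0. field. lra.
    - apply bigO_plus; [apply bigO_plus|].
      + apply bigO_minus; [apply bigO_minus|].
        * apply bigO_bdd_l; [bdd_solve|exact Qx].
        * apply bigO_bdd_l; [bdd_solve|apply Omul, Ox].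
        * apply bigO_bdd_l; [bdd_solve|]. apply bigO_minus; [apply bigO_plus|].
          -- apply bigO_bdd_l; [bdd_solve|exact Osin].
          -- apply bigO_bdd_l; [bdd_solve|exact Ob].
          -- apply bigO_bdd_l; [bdd_solve|apply Omul, Ox].
      + apply Omul. apply (Olip alpha2 C HC Ha2).
      + apply Orem, Hr2. }
  destruct Ob as [Kb [HKb Ob]], Qx as [Kx [HKx Qx]], Qs as [Ks [HKs Qs]].
  exists e1, (Kb + Kx + Ks). split; [lra|]. split; [lra|].
  intros eps x b s x' s' Heps B S B' S' Hle.
  set (p := PointPair eps x b s x' s').
  assert (Hp : D p) by (unfold D, comparison, p; simpl; repeat split; try apply B; try apply B';
    try apply S; try apply S'; lra).
  generalize (Ob p Hp) (Qx p Hp) (Qs p Hp) (He p Hp). unfold e2, p; simpl.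
  intros V1 V2 V3 [_ [_ E]]. rewrite E in *. clear E.
  assert (E0 := pow2_ge_0 eps). simpl in E0.
  split; [|split].
  - apply Rle_trans with (1 := V1). apply Rmult_le_compat_r; lra.
  - apply Rle_trans with (1 := V2). apply Rmult_le_compat_r; lra.
  - apply Rle_trans with (1 := V3). apply Rmult_le_compat_r; lra.
Qed.

End Location.

(** * Forced response *)

(** Multiple angles are reduced to powers of cos x, times sin x for the sines. In this normal form
    the residual identities become rational identities for [field]. *)
Lemma cos_2 x : cos (2 * x) = 2 * cos x ^ 2 - 1.
Proof. rewrite cos_2a_cos. ring. Qed.

Lemma sin_2 x : sin (2 * x) = 2 * sin x * cos x.
Proof. apply sin_2a. Qed.

Lemma sin_pow2 x : sin x ^ 2 = 1 - cos x ^ 2.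
Proof. generalize (sin2_cos2 x). unfold Rsqr. intros; lra. Qed.

Lemma cos_3 x : cos (3 * x) = 4 * cos x ^ 3 - 3 * cos x.
Proof.
  replace (3 * x) with (2 * x + x) by ring. rewrite cos_plus, cos_2, sin_2.
  ring [(sin_pow2 x)].
Qed.

Lemma sin_3 x : sin (3 * x) = sin x * (4 * cos x ^ 2 - 1).
Proof.
  replace (3 * x) with (2 * x + x) by ring. rewrite sin_plus, cos_2, sin_2. ring.
Qed.

Lemma cos_4 x : cos (4 * x) = 8 * cos x ^ 4 - 8 * cos x ^ 2 + 1.
Proof. replace (4 * x) with (2 * (2 * x)) by ring. rewrite !cos_2. ring. Qed.

Lemma cos_5 x : cos (5 * x) = 16 * cos x ^ 5 - 20 * cos x ^ 3 + 5 * cos x.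
Proof.
  replace (5 * x) with (4 * x + x) by ring. rewrite cos_plus, cos_4.
  replace (4 * x) with (2 * (2 * x)) by ring. rewrite sin_2, sin_2, cos_2.
  ring [(sin_pow2 x)].
Qed.

(** Parameters over which the bounds are uniform: eps, amplitude, detuning, phase, rotating
    coordinates of the error, scaled residual. For stationary points the field [op_phi] holds
    beta. *)
Record orbit_point := OrbitPoint
  { op_e : R; op_a : R; op_s : R; op_phi : R; op_p : R; op_q : R; op_rho : R }.

(** Makes the clamped restoring force globally Lipschitz, as global existence requires. *)
Lemma clamped_poly_lipschitz (m A B C : R) : 0 <= m ->
  exists L, 0 <= L /\ forall x y,
    let f := fun x => A * x + B * clamp (- m) m x ^ 2 + C * clamp (- m) m x ^ 3 in
    Rabs (f x - f y) <= L * Rabs (x - y).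
Proof.
  intros Hm. exists (Rabs A + Rabs B * (2 * m) + Rabs C * (3 * m ^ 2)).
  assert (HA := Rabs_pos A). assert (HB := Rabs_pos B). assert (HC := Rabs_pos C).
  assert (Hm2 := pow2_ge_0 m).
  split.
  { assert (0 <= Rabs B * (2 * m)) by (apply Rmult_le_pos; lra).
    assert (0 <= Rabs C * (3 * m ^ 2)) by (apply Rmult_le_pos; lra). lra. }
  intros x y f. unfold f.
  assert (Hx := clamp_bounds (- m) m x ltac:(lra)).
  assert (Hy := clamp_bounds (- m) m y ltac:(lra)).
  assert (Hd := clamp_lipschitz (- m) m x y).
  set (X := clamp (- m) m x) in *. set (Y := clamp (- m) m y) in *.
  replace (A * x + B * X ^ 2 + C * X ^ 3 - (A * y + B * Y ^ 2 + C * Y ^ 3))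
    with (A * (x - y) + B * ((X + Y) * (X - Y)) + C * ((X ^ 2 + X * Y + Y ^ 2) * (X - Y)))
    by ring.
  assert (H1 : Rabs (X + Y) <= 2 * m) by (apply Rabs_le; lra).
  assert (H2 : Rabs (X ^ 2 + X * Y + Y ^ 2) <= 3 * m ^ 2).
  { apply Rabs_le. generalize (pow2_ge_0 (X + Y)) (pow2_ge_0 (X - Y)). nra. }
  triangle.
  apply Rle_trans with (1 := Rplus_le_compat_r _ _ _ (Rabs_triang _ _)).
  replace ((Rabs A + Rabs B * (2 * m) + Rabs C * (3 * m ^ 2)) * Rabs (x - y))
    with (Rabs A * Rabs (x - y) + Rabs B * (2 * m * Rabs (x - y))
          + Rabs C * (3 * m ^ 2 * Rabs (x - y))) by ring.
  rewrite !Rabs_mult. apply Rplus_le_compat; [apply Rplus_le_compat|].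
  - lra.
  - apply Rmult_le_compat_l; [exact HB|].
    apply Rmult_le_compat; auto using Rabs_pos.
  - apply Rmult_le_compat_l; [exact HC|].
    apply Rmult_le_compat; auto using Rabs_pos.
Qed.

Lemma open_interval_locally (T t : R) (P : R -> Prop) :
  0 < t < T -> (forall r, 0 < r < T -> P r) -> locally t P.
Proof.
  intros Ht HP.
  assert (Hd : 0 < Rmin t (T - t)) by (apply Rmin_glb_lt; lra).
  exists (mkposreal _ Hd). intros r Hr. apply HP.
  change (Rabs (r - t) < Rmin t (T - t)) in Hr.
  generalize (Rmin_l t (T - t)) (Rmin_r t (T - t)). apply Rabs_lt_between in Hr. lra.
Qed.

(** * Correctors, residual and energy of the forced response *)

Section ForcedResponse.
Context (om lam c d Fm a0 s0 K0 K : R) (Hom : 0 < om) (Hlam : 0 < lam) (HK0 : 0 <= K0)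
  (Hbackbone : 3 * d * a0 ^ 2 = 8 * om * s0).

(* Fourier coefficients of the correctors, chosen to cancel the nonresonant
   harmonics of the residual at orders eps ([residual_order1]) and eps^2
   ([residual_order2]). *)
Definition v1_const (a : R) := - (c * a ^ 2) / (2 * om ^ 2).
Definition v1_cos2 (a : R) := c * a ^ 2 / (6 * om ^ 2).
Definition v1_cos3 (a : R) := d * a ^ 3 / (32 * om ^ 2).

Definition v2_const (a : R) := - (3 * d * a ^ 2 / 2 * (v1_const a + v1_cos2 a / 2)) / om ^ 2.
Definition v2_cos2 (a s : R) :=
  (- 8 * om * s * v1_cos2 a + c * a * v1_cos3 a + 3 * d * a ^ 2 / 2 * (v1_cos2 a + v1_const a))
  / (3 * om ^ 2).
Definition v2_sin2 (a : R) := - (2 * lam * om * v1_cos2 a) / (3 * om ^ 2).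
Definition v2_cos3 (a s : R) :=
  (- 18 * om * s * v1_cos3 a + c * a * v1_cos2 a + 3 * d * a ^ 2 / 2 * v1_cos3 a) / (8 * om ^ 2).
Definition v2_sin3 (a : R) := - (3 * lam * om * v1_cos3 a) / (8 * om ^ 2).
Definition v2_cos4 (a : R) := (c * a * v1_cos3 a + 3 * d * a ^ 2 / 4 * v1_cos2 a) / (15 * om ^ 2).
Definition v2_cos5 (a : R) := 3 * d * a ^ 2 / 4 * v1_cos3 a / (24 * om ^ 2).

Definition v1 (a phi : R) := v1_const a + v1_cos2 a * cos (2 * phi) + v1_cos3 a * cos (3 * phi).
Definition v1' (a phi : R) := - 2 * v1_cos2 a * sin (2 * phi) - 3 * v1_cos3 a * sin (3 * phi).
Definition v1'' (a phi : R) := - 4 * v1_cos2 a * cos (2 * phi) - 9 * v1_cos3 a * cos (3 * phi).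

Definition v2 (a s phi : R) :=
  v2_const a + v2_cos2 a s * cos (2 * phi) + v2_sin2 a * sin (2 * phi) + v2_cos3 a s * cos (3 * phi)
  + v2_sin3 a * sin (3 * phi) + v2_cos4 a * cos (4 * phi) + v2_cos5 a * cos (5 * phi).
Definition v2' (a s phi : R) :=
  - 2 * v2_cos2 a s * sin (2 * phi) + 2 * v2_sin2 a * cos (2 * phi)
  - 3 * v2_cos3 a s * sin (3 * phi)
  + 3 * v2_sin3 a * cos (3 * phi) - 4 * v2_cos4 a * sin (4 * phi) - 5 * v2_cos5 a * sin (5 * phi).
Definition v2'' (a s phi : R) :=
  - 4 * v2_cos2 a s * cos (2 * phi) - 4 * v2_sin2 a * sin (2 * phi)
  - 9 * v2_cos3 a s * cos (3 * phi)
  - 9 * v2_sin3 a * sin (3 * phi) - 16 * v2_cos4 a * cos (4 * phi) - 25 * v2_cos5 a * cos (5 * phi).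

Ltac unfold_harmonics :=
  unfold v2'', v2', v2, v1'', v1', v1, v2_const, v2_cos2, v2_sin2, v2_cos3, v2_sin3,
    v2_cos4, v2_cos5, v1_const, v1_cos2, v1_cos3.

Lemma v1_derive a phi : is_derive (v1 a) phi (v1' a phi).
Proof. unfold v1, v1'. auto_derive; [trivial|ring]. Qed.
Lemma v1'_derive a phi : is_derive (v1' a) phi (v1'' a phi).
Proof. unfold v1', v1''. auto_derive; [trivial|ring]. Qed.
Lemma v2_derive a s phi : is_derive (v2 a s) phi (v2' a s phi).
Proof. unfold v2, v2'. auto_derive; [trivial|ring]. Qed.
Lemma v2'_derive a s phi : is_derive (v2' a s) phi (v2'' a s phi).
Proof. unfold v2', v2''. auto_derive; [trivial|ring]. Qed.

Definition vapp (eps a s phi : R) := a * cos phi + eps * v1 a phi + eps ^ 2 * v2 a s phi.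
Definition vapp' (eps a s phi : R) := - a * sin phi + eps * v1' a phi + eps ^ 2 * v2' a s phi.
Definition vapp'' (eps a s phi : R) := - a * cos phi + eps * v1'' a phi + eps ^ 2 * v2'' a s phi.

Lemma vapp_derive eps a s phi : is_derive (vapp eps a s) phi (vapp' eps a s phi).
Proof.
  unfold vapp, vapp'. auto_derive.
  - split; [eexists; apply v1_derive|]. split; [eexists; apply v2_derive|trivial].
  - rewrite (is_derive_unique (fun x : R => v1 a x) _ _ (v1_derive a phi)),
      (is_derive_unique (fun x : R => v2 a s x) _ _ (v2_derive a s phi)). ring.
Qed.
Lemma vapp'_derive eps a s phi : is_derive (vapp' eps a s) phi (vapp'' eps a s phi).
Proof.
  unfold vapp', vapp''. auto_derive.
  - split; [eexists; apply v1'_derive|]. split; [eexists; apply v2'_derive|trivial].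
  - rewrite (is_derive_unique (fun x : R => v1' a x) _ _ (v1'_derive a phi)),
      (is_derive_unique (fun x : R => v2' a s x) _ _ (v2'_derive a s phi)). ring.
Qed.

(** The defect of u = eps vapp in the equation, divided by eps; om + eps s is the time derivative of
    the phase, and phi - b is the phase of the forcing. *)
Definition residual (eps a b s phi : R) : R :=
  (om + eps * s) ^ 2 * vapp'' eps a s phi + om ^ 2 * vapp eps a s phi
  + eps * lam * (om + eps * s) * vapp' eps a s phi + eps * c * vapp eps a s phi ^ 2
  + eps * d * vapp eps a s phi ^ 3 - eps * Fm * cos (phi - b).

(* Coefficients of cos phi and sin phi in [residual / eps], up to O(eps^2). *)
Definition resonance_cos (eps a b s : R) : R :=
  - 2 * om * s * a + 3 * d * a ^ 3 / 4 - Fm * cos b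
  + eps * (- s ^ 2 * a - 5 * c ^ 2 * a ^ 3 / (6 * om ^ 2) + 3 * d ^ 2 * a ^ 5 / (128 * om ^ 2)).
Definition resonance_sin (eps a b s : R) : R :=
  - lam * om * a - Fm * sin b - eps * lam * s * a.

Definition residual_tail (eps a s phi : R) : R :=
  let f0 := a * cos phi in let f1 := v1 a phi in let f2 := v2 a s phi in
  2 * om * s * v2'' a s phi + s ^ 2 * v1'' a phi + eps * s ^ 2 * v2'' a s phi
  + lam * om * v2' a s phi + lam * s * v1' a phi + eps * lam * s * v2' a s phi
  + c * (f1 ^ 2 + 2 * f0 * f2 + 2 * eps * f1 * f2 + eps ^ 2 * f2 ^ 2)
  + d * (3 * f0 ^ 2 * f2 + 3 * f0 * f1 ^ 2 + eps * (6 * f0 * f1 * f2 + f1 ^ 3)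
         + eps ^ 2 * (3 * f0 * f2 ^ 2 + 3 * f1 ^ 2 * f2)
         + eps ^ 3 * 3 * f1 * f2 ^ 2 + eps ^ 4 * f2 ^ 3).

Lemma residual_order1 a b s phi :
  om ^ 2 * (v1'' a phi + v1 a phi) - 2 * om * s * a * cos phi - lam * om * a * sin phi
  + c * (a * cos phi) ^ 2 + d * (a * cos phi) ^ 3 - Fm * cos (phi - b)
  = resonance_cos 0 a b s * cos phi + resonance_sin 0 a b s * sin phi.
Proof.
  unfold v1'', v1, v1_const, v1_cos2, v1_cos3, resonance_cos, resonance_sin.
  rewrite cos_minus, cos_2, cos_3. field. lra.
Qed.

Lemma residual_order2 a s phi :
  om ^ 2 * (v2'' a s phi + v2 a s phi) + 2 * om * s * v1'' a phi - s ^ 2 * a * cos phi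
  + lam * om * v1' a phi - lam * s * a * sin phi + 2 * c * a * cos phi * v1 a phi
  + 3 * d * (a * cos phi) ^ 2 * v1 a phi
  = (- s ^ 2 * a - 5 * c ^ 2 * a ^ 3 / (6 * om ^ 2) + 3 * d ^ 2 * a ^ 5 / (128 * om ^ 2))
      * cos phi - lam * s * a * sin phi.
Proof.
  unfold_harmonics. rewrite cos_2, cos_3, cos_4, cos_5, sin_2, sin_3. field. lra.
Qed.

(** Expansion in powers of eps: order 0 vanishes because the cosine solves v'' + v = 0, orders 1 and
    2 are the two preceding identities, and [residual_tail] is everything else. *)
Lemma residual_eq eps a b s phi :
  residual eps a b s phi
  = eps * (resonance_cos eps a b s * cos phi + resonance_sin eps a b s * sin phi)
    + eps ^ 3 * residual_tail eps a s phi.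
Proof.
  generalize (residual_order1 a b s phi) (residual_order2 a s phi).
  unfold residual, vapp, vapp', vapp'', residual_tail, resonance_cos, resonance_sin.
  set (F := Fm * cos (phi - b)). set (f1 := v1 a phi). set (f1' := v1' a phi).
  set (f1'' := v1'' a phi). set (f2 := v2 a s phi). set (f2' := v2' a s phi).
  set (f2'' := v2'' a s phi). set (Y := cos phi). set (Z := sin phi). intros R1 R2.
  replace (eps * Fm * cos (phi - b)) with (eps * F) by (unfold F; ring).
  match type of R1 with ?l = ?r => assert (E1 : eps * (l - r) = 0) by (rewrite R1; ring) end.
  match type of R2 with ?l = ?r => assert (E2 : eps ^ 2 * (l - r) = 0) by (rewrite R2; ring) end.
  match type of E1 with ?l1 = 0 => match type of E2 with ?l2 = 0 =>
  match goal with |- ?l = ?r =>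
    assert (E : l - r = l1 + l2) by ring end end end.
  rewrite E1, E2 in E. lra.
Qed.

(* Weight that makes the form in [averaged_decay] definite in spite of the
   coupling 4 s0 p q. *)
Definition kappa : R := 1 + 16 * s0 ^ 2 / lam ^ 2.

Lemma kappa_ge1 : 1 <= kappa.
Proof.
  unfold kappa. assert (0 <= 16 * s0 ^ 2 / lam ^ 2); [|lra].
  apply Rmult_le_pos; [generalize (pow2_ge_0 s0); lra|].
  apply Rlt_le, Rinv_0_lt_compat, pow_lt, Hlam.
Qed.

(* The corrector with coefficients Wpp, Wpq, Wqq is built from primitives in phi
   (C = cos phi, S = sin phi) so that om times its derivative cancels the
   oscillating part of the derivative of kappa p^2 + q^2. *)
Definition I1 C S := om * s0 * S ^ 2 + 2 * c * a0 * C ^ 3 / 3 + 3 * d * a0 ^ 2 * C ^ 4 / 4.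
Definition I2 C S := om * s0 * S * C - 2 * c * a0 * (S - S ^ 3 / 3)
  - 3 * d * a0 ^ 2 * (S * C ^ 3 / 4 + 3 * S * C / 8).
Definition I3 C S := - 2 * c * a0 * S - 3 * d * a0 ^ 2 * S * C / 2.

Definition Wpp C S := - (2 / om ^ 2) * (- kappa * I1 C S + lam * om * kappa * S * C / 2).
Definition Wpq C S :=
  - (2 / om ^ 2) * ((1 + kappa) * I2 C S - kappa * I3 C S + lam * om * (kappa + 1) * S ^ 2 / 2).
Definition Wqq C S := - (2 / om ^ 2) * (I1 C S - lam * om * S * C / 2).

(** Derivatives in phi, computed with C' = - S and S' = C. *)
Definition dI1 C S := 2 * om * s0 * S * C - 2 * c * a0 * S * C ^ 2 - 3 * d * a0 ^ 2 * S * C ^ 3.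
Definition dI2 C S := om * s0 * (C ^ 2 - S ^ 2) - 2 * c * a0 * (C - S ^ 2 * C)
  - 3 * d * a0 ^ 2 * ((C ^ 4 - 3 * S ^ 2 * C ^ 2) / 4 + 3 * (C ^ 2 - S ^ 2) / 8).
Definition dI3 C S := - 2 * c * a0 * C - 3 * d * a0 ^ 2 * (C ^ 2 - S ^ 2) / 2.

Definition dWpp C S :=
  - (2 / om ^ 2) * (- kappa * dI1 C S + lam * om * kappa * (C ^ 2 - S ^ 2) / 2).
Definition dWpq C S :=
  - (2 / om ^ 2) * ((1 + kappa) * dI2 C S - kappa * dI3 C S + lam * om * (kappa + 1) * S * C).
Definition dWqq C S := - (2 / om ^ 2) * (dI1 C S - lam * om * (C ^ 2 - S ^ 2) / 2).

Definition quad (A B D p q : R) : R := A * p ^ 2 + B * p * q + D * q ^ 2.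

Definition lyapunov (eps C S p q : R) : R :=
  kappa * p ^ 2 + q ^ 2 + eps * quad (Wpp C S) (Wpq C S) (Wqq C S) p q.

Definition dlyapunov (eps Om g C S p q : R) : R :=
  2 * g * (- kappa * S * p + C * q)
  + eps * (Om * quad (dWpp C S) (dWpq C S) (dWqq C S) p q
           + g * (- S * (2 * Wpp C S * p + Wpq C S * q) + C * (Wpq C S * p + 2 * Wqq C S * q))).

Lemma lyapunov_derive (eps Om g t : R) (C S p q : R -> R) :
  is_derive C t (- Om * S t) -> is_derive S t (Om * C t) ->
  is_derive p t (- S t * g) -> is_derive q t (C t * g) ->
  is_derive (fun r => lyapunov eps (C r) (S r) (p r) (q r)) t
    (dlyapunov eps Om g (C t) (S t) (p t) (q t)).
Proof.
  intros HC HS Hp Hq.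
  unfold lyapunov, dlyapunov, quad, Wpp, Wpq, Wqq, dWpp, dWpq, dWqq, I1, I2, I3, dI1, dI2, dI3.
  auto_derive.
  - repeat split; eexists; eassumption.
  - rewrite (is_derive_unique (fun x : R => C x) _ _ HC),
      (is_derive_unique (fun x : R => S x) _ _ HS),
      (is_derive_unique (fun x : R => p x) _ _ Hp),
      (is_derive_unique (fun x : R => q x) _ _ Hq).
    field. lra.
Qed.

(** [error_force] without rho, at eps = 0, a = a0 and s = s0. *)
Definition leading_force (C y z : R) : R :=
  2 * om * s0 * y - lam * om * z - 2 * c * a0 * C * y - 3 * d * a0 ^ 2 * C ^ 2 * y.

(* The averaged linearization at the maximum is a Jordan block with eigenvalue
   - lam / 2 and coupling - 2 s0. *)
Lemma averaged_decay (C S p q : R) : C ^ 2 + S ^ 2 = 1 ->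
  2 / om * leading_force C (p * C + q * S) (- p * S + q * C) * (- kappa * S * p + C * q)
  + om * quad (dWpp C S) (dWpq C S) (dWqq C S) p q
  = - (lam * kappa * p ^ 2 + lam * q ^ 2 + 4 * s0 * p * q).
Proof.
  intros HCS. assert (HS : S ^ 2 = 1 - C ^ 2) by lra.
  assert (Es : s0 = 3 * d * a0 ^ 2 / (8 * om)) by (rewrite Hbackbone; field; lra).
  unfold leading_force, quad, dWpp, dWpq, dWqq, dI1, dI2, dI3. generalize kappa. intros k.
  rewrite Es. field [HS]. lra.
Qed.

(* Restoring force in the equation satisfied by y = (u - eps vapp) / eps^3. *)
Definition error_force (eps a s rho phi y z : R) : R :=
  let va := vapp eps a s phi in
  (2 * om * s + eps * s ^ 2) * y - lam * (om + eps * s) * z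
  - c * (2 * va * y + eps ^ 2 * y ^ 2)
  - d * (3 * va ^ 2 * y + 3 * eps ^ 2 * va * y ^ 2 + eps ^ 4 * y ^ 3) - rho.

Definition near_backbone (e1 eps a s : R) : Prop :=
  0 < eps < e1 /\ Rabs (a - a0) <= K0 * eps /\ Rabs (s - s0) <= K0 * eps.

Lemma frequency_bounds : exists e1, 0 < e1 <= 1 /\
  forall eps a s, near_backbone e1 eps a s -> om / 2 <= om + eps * s <= 2 * om.
Proof.
  set (k := Rabs s0 + K0 + 1). assert (Hk : 1 <= k) by (unfold k; generalize (Rabs_pos s0); lra).
  destruct (small_epsilon k (om / 2)) as [e1 [He1 Hsmall]]; [lra|lra|].
  exists e1. split; [exact He1|]. intros eps a s [He [_ Hs]].
  assert (He2 : k * eps < om / 2) by now apply Hsmall.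
  assert (Hsk : Rabs s <= k).
  { replace s with (s0 + (s - s0)) by ring. triangle.
    unfold k. assert (K0 * eps <= K0 * 1) by (apply Rmult_le_compat_l; lra). lra. }
  assert (T : Rabs (eps * s) <= om / 2).
  { rewrite Rabs_mult, (Rabs_right eps) by lra.
    assert (eps * Rabs s <= eps * k) by (apply Rmult_le_compat_l; lra). lra. }
  apply Rabs_le_between in T. lra.
Qed.

Definition orbit_domain (e1 B R0 : R) (x : orbit_point) : Prop :=
  near_backbone e1 (op_e x) (op_a x) (op_s x) /\
  Rabs (op_p x) <= B /\ Rabs (op_q x) <= B /\ Rabs (op_rho x) <= R0.

Lemma orbit_domain_bounds (e1 B R0 : R) : e1 <= 1 ->
  let D := orbit_domain e1 B R0 in
  bdd D op_e /\ bdd D op_a /\ bdd D op_s /\ bdd D op_p /\ bdd D op_q /\ bdd D op_rho /\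
  bigO D op_e (fun x => op_a x - a0) /\ bigO D op_e (fun x => op_s x - s0).
Proof.
  intros He1 D.
  assert (He : forall x, D x -> 0 < op_e x <= 1 /\ Rabs (op_e x) = op_e x).
  { intros x [[He _] _]. rewrite Rabs_right; lra. }
  assert (Be : bdd D op_e).
  { apply bdd_intro with 1. intros x Hx. destruct (He x Hx) as [G ->]. lra. }
  assert (Oa : bigO D op_e (fun x => op_a x - a0)).
  { apply bigO_intro with K0. intros x Hx. destruct (He x Hx) as [_ ->]. apply Hx. }
  assert (Os : bigO D op_e (fun x => op_s x - s0)).
  { apply bigO_intro with K0. intros x Hx. destruct (He x Hx) as [_ ->]. apply Hx. }
  repeat split; try assumption.
  - apply bigO_ext with (fun x => a0 + (op_a x - a0)); [intros; ring|].
    apply bigO_plus; [apply bdd_const|]. apply (bigO_bdd D op_e); assumption.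
  - apply bigO_ext with (fun x => s0 + (op_s x - s0)); [intros; ring|].
    apply bigO_plus; [apply bdd_const|]. apply (bigO_bdd D op_e); assumption.
  - apply bdd_intro with B. intros x Hx; apply Hx.
  - apply bdd_intro with B. intros x Hx; apply Hx.
  - apply bdd_intro with R0. intros x Hx; apply Hx.
Qed.

Lemma vapp_bdd (e1 B R0 : R) : e1 <= 1 ->
  let D := orbit_domain e1 B R0 in
  bdd D (fun x => v1 (op_a x) (op_phi x)) /\
  bdd D (fun x => v2 (op_a x) (op_s x) (op_phi x)) /\
  bdd D (fun x => vapp (op_e x) (op_a x) (op_s x) (op_phi x)) /\
  bigO D op_e (fun x => vapp (op_e x) (op_a x) (op_s x) (op_phi x)
                        - a0 * cos (op_phi x)).
Proof.
  intros He1 D.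
  destruct (orbit_domain_bounds e1 B R0 He1) as [Be [Ba [Bs [Bp [Bq [Br [Oa Os]]]]]]].
  fold D in Be, Ba, Bs, Bp, Bq, Br, Oa, Os.
  assert (B1 : bdd D (fun x => v1 (op_a x) (op_phi x)))
    by (unfold_harmonics; bdd_solve).
  assert (B2 : bdd D (fun x => v2 (op_a x) (op_s x) (op_phi x)))
    by (unfold_harmonics; bdd_solve).
  split; [exact B1|]. split; [exact B2|]. split; [unfold vapp; bdd_solve|].
  apply bigO_ext with (fun x => cos (op_phi x) * (op_a x - a0)
    + (v1 (op_a x) (op_phi x) + op_e x * v2 (op_a x) (op_s x) (op_phi x))
      * op_e x); [intros; unfold vapp; ring|].
  apply bigO_plus; (apply bigO_bdd_l; [bdd_solve|try assumption; apply bigO_refl]).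
Qed.

(** The resonance coefficients are O(eps^2) and enter with a factor eps, so the whole residual is
    O(eps^3), the scale on which y is measured. *)
Lemma residual_bound : exists R0, 0 <= R0 /\
  forall eps a b s phi, near_backbone 1 eps a s ->
    Rabs (resonance_cos eps a b s) <= K0 * eps ^ 2 ->
    Rabs (resonance_sin eps a b s) <= K0 * eps ^ 2 ->
    Rabs (residual eps a b s phi / eps ^ 3) <= R0.
Proof.
  destruct (orbit_domain_bounds 1 0 0 ltac:(lra)) as [Be [Ba [Bs _]]].
  destruct (vapp_bdd 1 0 0 ltac:(lra)) as [B1 [B2 _]]. cbv zeta in Be, Ba, Bs, B1, B2.
  assert (Bt : bdd (orbit_domain 1 0 0)
    (fun x => residual_tail (op_e x) (op_a x) (op_s x) (op_phi x))).
  { unfold residual_tail. cbv zeta. bdd_solve; unfold_harmonics; bdd_solve. }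
  destruct (bdd_elim _ _ Bt) as [Kt [HKt Ht]].
  exists (2 * K0 + Kt). split; [lra|]. intros eps a b s phi Hn Rc Rs.
  assert (V := Ht (OrbitPoint eps a s phi 0 0 0)). simpl in V.
  assert (Hd : orbit_domain 1 0 0 (OrbitPoint eps a s phi 0 0 0)).
  { split; [exact Hn|]. simpl. rewrite Rabs_R0. lra. }
  specialize (V Hd). destruct Hn as [He _].
  rewrite (residual_eq eps a b s phi).
  assert (Hc : Rabs (cos phi) <= 1) by apply Rabs_le, COS_bound.
  assert (Hs : Rabs (sin phi) <= 1) by apply Rabs_le, SIN_bound.
  assert (He3 : 0 < eps ^ 3) by (apply pow_lt; lra).
  unfold Rdiv. rewrite Rabs_mult, (Rabs_right (/ eps ^ 3))
    by (apply Rle_ge, Rlt_le, Rinv_0_lt_compat, He3).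
  apply Rmult_le_reg_r with (1 := He3). rewrite Rmult_assoc, Rinv_l, Rmult_1_r by lra.
  triangle.
  rewrite !Rabs_mult, (Rabs_right eps), (Rabs_right (eps ^ 3)) by lra.
  assert (Ht2 : Rabs (resonance_cos eps a b s * cos phi
      + resonance_sin eps a b s * sin phi) <= 2 * K0 * eps ^ 2).
  { triangle. rewrite !Rabs_mult.
    generalize (Rabs_pos (resonance_cos eps a b s))
      (Rabs_pos (resonance_sin eps a b s)) (Rabs_pos (cos phi)) (Rabs_pos (sin phi)).
    nra. }
  assert (eps * Rabs (resonance_cos eps a b s * cos phi
      + resonance_sin eps a b s * sin phi) <= eps * (2 * K0 * eps ^ 2))
    by (apply Rmult_le_compat_l; lra).
  assert (eps ^ 3 * Rabs (residual_tail eps a s phi) <= eps ^ 3 * Kt)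
    by (apply Rmult_le_compat_l; lra).
  lra.
Qed.

Local Notation y_of := (fun x => op_p x * cos (op_phi x) + op_q x * sin (op_phi x)).
Local Notation z_of := (fun x => - op_p x * sin (op_phi x) + op_q x * cos (op_phi x)).
Local Notation Om_of := (fun x => om + op_e x * op_s x).
Local Notation G_of := (fun x => error_force (op_e x) (op_a x) (op_s x) (op_rho x)
  (op_phi x) (y_of x) (z_of x)).
Local Notation l_of := (fun x => - kappa * sin (op_phi x) * op_p x + cos (op_phi x) * op_q x).
Local Notation dV_of := (fun x => dlyapunov (op_e x) (Om_of x)
  (op_e x * G_of x / Om_of x) (cos (op_phi x)) (sin (op_phi x)) (op_p x) (op_q x)).

(** The first estimate isolates the averaged slope of order eps and the contribution of the
    residual; the second is the crude bound used backward in time. *)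
Lemma lyapunov_error (B R0 : R) : exists e1 Ke, 0 < e1 <= 1 /\ 0 <= Ke /\
  forall x, orbit_domain e1 B R0 x ->
    Rabs (dV_of x + op_e x * (lam * kappa * op_p x ^ 2 + lam * op_q x ^ 2
                              + 4 * s0 * op_p x * op_q x
                              + 2 / Om_of x * op_rho x * l_of x))
      <= Ke * op_e x ^ 2 /\
    Rabs (dV_of x) <= Ke * op_e x.
Proof.
  destruct frequency_bounds as [e1 [He1 HOm]].
  set (D := orbit_domain e1 B R0).
  destruct (orbit_domain_bounds e1 B R0 (proj2 He1)) as [Be [Ba [Bs [Bp [Bq [Br [Oa Os]]]]]]].
  destruct (vapp_bdd e1 B R0 (proj2 He1)) as [B1 [B2 [Bv Ov]]].
  fold D in Be, Ba, Bs, Bp, Bq, Br, Oa, Os, B1, B2, Bv, Ov.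
  assert (HOm' : forall x, D x -> om / 2 <= Om_of x <= 2 * om).
  { intros x [Hx _]. exact (HOm _ _ _ Hx). }
  assert (Bi : bdd D (fun x => / (om + op_e x * op_s x))).
  { apply bdd_inv with (om / 2); [lra|]. intros x Hx. specialize (HOm' x Hx).
    rewrite Rabs_right; lra. }
  set (g0 := fun x => leading_force (cos (op_phi x)) (y_of x) (z_of x)).
  assert (Bg0 : bdd D g0) by (unfold g0, leading_force; bdd_solve).
  set (va := fun x => vapp (op_e x) (op_a x) (op_s x) (op_phi x)).
  fold va in Bv. change (bigO D op_e (fun x => va x - a0 * cos (op_phi x))) in Ov.
  assert (BG : bdd D G_of).
  { unfold error_force. fold va. bdd_solve. }
  (* Replacing a and s by a0 and s0 and dropping the correctors and the terms quadratic and cubic in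
     y costs O(eps). *)
  assert (Od : bigO D op_e (fun x => G_of x + op_rho x - g0 x)).
  { apply bigO_ext with (fun x => 2 * om * y_of x * (op_s x - s0)
      + (op_s x ^ 2 * y_of x - lam * op_s x * z_of x
         - c * op_e x * y_of x ^ 2
         - d * (3 * op_e x * va x * y_of x ^ 2 + op_e x ^ 3 * y_of x ^ 3)) * op_e x
      - (2 * c * y_of x + 3 * d * (va x + a0 * cos (op_phi x)) * y_of x)
        * (va x - a0 * cos (op_phi x))).
    - intros x _. unfold g0, leading_force, error_force, va. ring.
    - apply bigO_minus; [apply bigO_plus|]; (apply bigO_bdd_l; [bdd_solve|]);
        try assumption. apply bigO_refl. }
  set (dW := fun x => quad (dWpp (cos (op_phi x)) (sin (op_phi x)))
    (dWpq (cos (op_phi x)) (sin (op_phi x)))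
    (dWqq (cos (op_phi x)) (sin (op_phi x))) (op_p x) (op_q x)).
  assert (BdW : bdd D dW).
  { unfold dW, quad, dWpp, dWpq, dWqq, dI1, dI2, dI3. bdd_solve. }
  set (W1 := fun x =>
    - sin (op_phi x) * (2 * Wpp (cos (op_phi x)) (sin (op_phi x)) * op_p x
       + Wpq (cos (op_phi x)) (sin (op_phi x)) * op_q x)
    + cos (op_phi x) * (Wpq (cos (op_phi x)) (sin (op_phi x)) * op_p x
       + 2 * Wqq (cos (op_phi x)) (sin (op_phi x)) * op_q x)).
  assert (BW1 : bdd D W1).
  { unfold W1, Wpp, Wpq, Wqq, I1, I2, I3. bdd_solve. }
  assert (Herr : bigO D (fun x => op_e x * op_e x) (fun x =>
      dV_of x + op_e x * (lam * kappa * op_p x ^ 2 + lam * op_q x ^ 2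
                              + 4 * s0 * op_p x * op_q x
                              + 2 / Om_of x * op_rho x * l_of x))).
  { apply bigO_ext with (fun x => op_e x * (
      2 * l_of x * / Om_of x * (G_of x + op_rho x - g0 x)
      + (- 2 * l_of x * op_s x / om * / Om_of x * g0 x
         + op_s x * dW x + G_of x * / Om_of x * W1 x) * op_e x)).
    - intros x Hx. assert (HO := HOm' x Hx). cbv beta in HO.
      assert (Hid := averaged_decay (cos (op_phi x))
        (sin (op_phi x)) (op_p x) (op_q x)).
      assert (Hcs : cos (op_phi x) ^ 2 + sin (op_phi x) ^ 2 = 1)
        by (rewrite sin_pow2; ring).
      specialize (Hid Hcs).
      fold (g0 x) in Hid. fold (dW x) in Hid.
      unfold dlyapunov. fold (dW x). fold (W1 x).
      match type of Hid with _ = - ?q => replace q with (- (- q)) by ring; rewrite <- Hid end.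
      field. lra.
    - apply bigO_mult; [apply bigO_refl|]. apply bigO_plus.
      + apply bigO_bdd_l; [bdd_solve|exact Od].
      + apply bigO_bdd_l; [bdd_solve|apply bigO_refl]. }
  assert (HdV : bigO D op_e dV_of).
  { apply bigO_ext with (fun x => (2 * (G_of x * / Om_of x) * l_of x + Om_of x * dW x
      + op_e x * (G_of x * / Om_of x) * W1 x) * op_e x).
    - intros x Hx. assert (HO := HOm' x Hx). cbv beta in HO.
      unfold dlyapunov. fold (dW x). fold (W1 x). field. lra.
    - apply bigO_bdd_l; [bdd_solve|apply bigO_refl]. }
  destruct Herr as [Ke [HKe Herr]], HdV as [Kd [HKd HdV]].
  exists e1, (Ke + Kd). split; [exact He1|]. split; [lra|]. intros x Hx.
  generalize (Herr x Hx) (HdV x Hx). intros V1 V2.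
  destruct Hx as [[He _] _].
  rewrite Rabs_mult, (Rabs_right (op_e x)) in V1 by lra. rewrite (Rabs_right (op_e x)) in V2 by lra.
  assert (E2 : 0 <= Kd * op_e x ^ 2) by (apply Rmult_le_pos; [lra|apply pow2_ge_0]).
  assert (0 <= Ke * op_e x) by (apply Rmult_le_pos; lra).
  split; lra.
Qed.

(** * The error equation in the rotating frame *)

Definition scaled_error (eps a b s : R) (u : R -> R) (t : R) : R :=
  (u t - eps * vapp eps a s ((om + eps * s) * t + b)) / eps ^ 3.

(** Normalized by the frequency so that (y, z) turns at constant speed up to O(eps): y' = Om z and
    z' = - Om y + O(eps). *)
Definition scaled_velocity (eps a b s : R) (u : R -> R) (t : R) : R :=
  (Derive u t - eps * (om + eps * s) * vapp' eps a s ((om + eps * s) * t + b))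
  / ((om + eps * s) * eps ^ 3).

Definition twice_derivable (u : R -> R) (t : R) : Prop := ex_derive u t /\ ex_derive (Derive u) t.

Definition forced_equation (eps s : R) (u : R -> R) (t : R) : Prop :=
  Derive_n u 2 t + om ^ 2 * u t + eps * lam * Derive u t + c * u t ^ 2 + d / eps * u t ^ 3
  = eps ^ 2 * Fm * cos ((om + eps * s) * t).

Section Trajectory.
Context (eps a b s : R) (u : R -> R) (He : 0 < eps) (HOm : 0 < om + eps * s).
Local Notation Om := (om + eps * s).
Local Notation y := (scaled_error eps a b s u).
Local Notation z := (scaled_velocity eps a b s u).
Local Notation phi := (fun t => Om * t + b).

Lemma scaled_error_derive t : ex_derive u t -> is_derive y t (Om * z t).
Proof.
  intros Hu. unfold scaled_error, scaled_velocity.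
  assert (Hv := vapp_derive eps a s (Om * t + b)).
  auto_derive.
  - split; [exact Hu|]. split; [eexists; exact Hv|trivial].
  - rewrite (is_derive_unique (fun x : R => vapp eps a s x) _ _ Hv).
    change (Derive (fun x : R => u x) t) with (Derive u t). field. split; lra.
Qed.

Definition acceleration (t : R) : R :=
  (Derive_n u 2 t - eps * Om ^ 2 * vapp'' eps a s (Om * t + b)) / (Om * eps ^ 3).

Lemma scaled_velocity_derive t : ex_derive (Derive u) t -> is_derive z t (acceleration t).
Proof.
  intros Hu. unfold acceleration, scaled_velocity.
  assert (Hv := vapp'_derive eps a s (Om * t + b)).
  auto_derive.
  - split; [exact Hu|]. split; [eexists; exact Hv|trivial].
  - rewrite (is_derive_unique (fun x : R => vapp' eps a s x) _ _ Hv).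
    change (Derive (fun x : R => Derive u x) t) with (Derive_n u 2 t).
    field. split; lra.
Qed.

(** With u = eps (vapp + eps^2 y), the terms free of y and z sum to the residual, and the
    differences of squares and cubes that remain factor through y. *)
Lemma acceleration_eq t : forced_equation eps s u t ->
  acceleration t = - Om * y t + eps * error_force eps a s
    (residual eps a b s (Om * t + b) / eps ^ 3) (Om * t + b) (y t) (z t) / Om.
Proof.
  intros E. unfold forced_equation in E.
  set (f := Om * t + b).
  assert (Eu : u t = eps * (vapp eps a s f + eps ^ 2 * y t))
    by (unfold scaled_error; fold f; field; lra).
  assert (Eu' : Derive u t = eps * Om * (vapp' eps a s f + eps ^ 2 * z t))
    by (unfold scaled_velocity; fold f; field; lra).
  assert (Eu'' : Derive_n u 2 t = eps * Om ^ 2 * vapp'' eps a s f + Om * eps ^ 3 * acceleration t)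
    by (unfold acceleration; fold f; field; lra).
  rewrite Eu, Eu', Eu'' in E. unfold error_force, residual.
  replace (f - b) with (Om * t) by (unfold f; ring).
  set (A := acceleration t) in *. set (Y := y t) in *. set (Z := z t) in *.
  set (v := vapp eps a s f) in *. set (w := vapp' eps a s f) in *. set (x := vapp'' eps a s f) in *.
  set (G := cos (Om * t)) in *.
  assert (EA : A = (eps ^ 2 * Fm * G - (eps * Om ^ 2 * x + om ^ 2 * (eps * (v + eps ^ 2 * Y))
    + eps * lam * (eps * Om * (w + eps ^ 2 * Z)) + c * (eps * (v + eps ^ 2 * Y)) ^ 2
    + d / eps * (eps * (v + eps ^ 2 * Y)) ^ 3)) / (Om * eps ^ 3)).
  { rewrite <- E. field. split; lra. }
  rewrite EA. field. lra.
Qed.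

(** In these coordinates the rotation disappears: the derivatives of p and q are - sin phi and cos
    phi times Om y + z', which is of order eps. *)
Definition rot_p (t : R) : R := y t * cos (phi t) - z t * sin (phi t).
Definition rot_q (t : R) : R := y t * sin (phi t) + z t * cos (phi t).

Lemma rot_inv t : rot_p t * cos (phi t) + rot_q t * sin (phi t) = y t /\
  - rot_p t * sin (phi t) + rot_q t * cos (phi t) = z t.
Proof.
  unfold rot_p, rot_q. assert (E := sin_pow2 (Om * t + b)).
  split; ring [E].
Qed.

Lemma scaled_bounds (B t : R) : Rabs (rot_p t) <= B -> Rabs (rot_q t) <= B ->
  Rabs (y t) <= 2 * B /\ Rabs (z t) <= 2 * B.
Proof.
  intros Hp Hq. destruct (rot_inv t) as [<- <-].
  assert (Hmul : forall x w, Rabs x <= B -> Rabs w <= 1 -> Rabs (x * w) <= B).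
  { intros x w Hx Hw. rewrite Rabs_mult, <- (Rmult_1_r B).
    apply Rmult_le_compat; auto using Rabs_pos. }
  assert (Hc : Rabs (cos (phi t)) <= 1) by apply Rabs_le, COS_bound.
  assert (Hs : Rabs (sin (phi t)) <= 1) by apply Rabs_le, SIN_bound.
  assert (Hp' : Rabs (- rot_p t) <= B) by now rewrite Rabs_Ropp.
  split; triangle.
  - generalize (Hmul _ _ Hp Hc) (Hmul _ _ Hq Hs). lra.
  - generalize (Hmul _ _ Hp' Hs) (Hmul _ _ Hq Hc). lra.
Qed.

Definition energy (t : R) : R :=
  lyapunov eps (cos (phi t)) (sin (phi t)) (rot_p t) (rot_q t).

Lemma energy_derive t : twice_derivable u t ->
  is_derive energy t (dlyapunov eps Om (Om * y t + acceleration t)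
    (cos (phi t)) (sin (phi t)) (rot_p t) (rot_q t)).
Proof.
  intros [H1 H2].
  assert (Hy := scaled_error_derive t H1). assert (Hz := scaled_velocity_derive t H2).
  apply (lyapunov_derive eps Om _ t (fun r => cos (Om * r + b))
    (fun r => sin (Om * r + b)) rot_p rot_q).
  - auto_derive; [trivial|ring].
  - auto_derive; [trivial|ring].
  - unfold rot_p. auto_derive.
    + repeat split; eexists; eassumption.
    + rewrite (is_derive_unique (fun x : R => y x) _ _ Hy),
        (is_derive_unique (fun x : R => z x) _ _ Hz). ring.
  - unfold rot_q. auto_derive.
    + repeat split; eexists; eassumption.
    + rewrite (is_derive_unique (fun x : R => y x) _ _ Hy),
        (is_derive_unique (fun x : R => z x) _ _ Hz). ring.
Qed.
End Trajectory.

(** The coefficients of the corrector are trigonometric polynomials, hence bounded, so for small eps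
    the correction is at most (p^2 + q^2) / 2; kappa >= 1 does the rest. *)
Lemma lyapunov_bounds : exists e1, 0 < e1 <= 1 /\ forall eps phi p q, 0 < eps < e1 ->
  (p ^ 2 + q ^ 2) / 2 <= lyapunov eps (cos phi) (sin phi) p q
    <= 2 * kappa * (p ^ 2 + q ^ 2).
Proof.
  set (D := fun _ : R => True).
  assert (Bpp : bdd D (fun phi => Wpp (cos phi) (sin phi)))
    by (unfold Wpp, I1; bdd_solve; fail).
  assert (Bpq : bdd D (fun phi => Wpq (cos phi) (sin phi)))
    by (unfold Wpq, I2, I3; bdd_solve; fail).
  assert (Bqq : bdd D (fun phi => Wqq (cos phi) (sin phi)))
    by (unfold Wqq, I1; bdd_solve; fail).
  destruct (bdd_elim _ _ Bpp) as [Kpp [HKpp Vpp]].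
  destruct (bdd_elim _ _ Bpq) as [Kpq [HKpq Vpq]].
  destruct (bdd_elim _ _ Bqq) as [Kqq [HKqq Vqq]].
  set (k := Kpp + Kpq + Kqq + 1).
  assert (Hk : 1 <= k) by (unfold k; lra).
  destruct (small_epsilon k (1 / 2)) as [e1 [He1 Hsmall]]; [lra|lra|].
  exists e1. split; [exact He1|]. intros eps phi p q He.
  assert (Hek : eps * k <= 1 / 2) by (rewrite Rmult_comm; now apply Rlt_le, Hsmall).
  assert (Hq : Rabs (quad (Wpp (cos phi) (sin phi))
    (Wpq (cos phi) (sin phi)) (Wqq (cos phi) (sin phi)) p q)
    <= k * (p ^ 2 + q ^ 2)).
  { unfold quad. specialize (Vpp phi I). specialize (Vpq phi I). specialize (Vqq phi I).
    assert (Hp2 := pow2_ge_0 p). assert (Hq2 := pow2_ge_0 q).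
    assert (Hpq : Rabs (p * q) <= p ^ 2 + q ^ 2).
    { apply Rabs_le. generalize (pow2_ge_0 (p + q)) (pow2_ge_0 (p - q)). lra. }
    triangle.
    apply Rle_trans with (1 := Rplus_le_compat_r _ _ _ (Rabs_triang _ _)).
    rewrite Rmult_assoc, !Rabs_mult, <- (Rabs_mult p q), (Rabs_right (p ^ 2)),
      (Rabs_right (q ^ 2)) by lra.
    assert (Rabs (Wpp (cos phi) (sin phi)) * p ^ 2 <= Kpp * (p ^ 2 + q ^ 2)).
    { apply Rmult_le_compat; try apply Rabs_pos; lra. }
    assert (Rabs (Wpq (cos phi) (sin phi)) * Rabs (p * q)
              <= Kpq * (p ^ 2 + q ^ 2)).
    { apply Rmult_le_compat; try apply Rabs_pos; lra. }
    assert (Rabs (Wqq (cos phi) (sin phi)) * q ^ 2 <= Kqq * (p ^ 2 + q ^ 2)).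
    { apply Rmult_le_compat; try apply Rabs_pos; lra. }
    unfold k. lra. }
  unfold lyapunov. set (Q := quad _ _ _ p q) in *.
  assert (Hp2 := pow2_ge_0 p). assert (Hq2 := pow2_ge_0 q).
  assert (Hk1 := kappa_ge1).
  assert (HeQ : Rabs (eps * Q) <= (p ^ 2 + q ^ 2) / 2).
  { rewrite Rabs_mult, (Rabs_right eps) by lra.
    apply Rle_trans with (eps * (k * (p ^ 2 + q ^ 2))); [apply Rmult_le_compat_l; lra|].
    rewrite <- Rmult_assoc.
    apply Rle_trans with (1 / 2 * (p ^ 2 + q ^ 2)); [apply Rmult_le_compat_r; lra|lra]. }
  apply Rabs_le_between in HeQ.
  assert (p ^ 2 <= kappa * p ^ 2) by nra. assert (q ^ 2 <= kappa * q ^ 2) by nra.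
  split; lra.
Qed.

(** * Confinement of the error by the energy *)

Definition admissible (e1 eps a b s : R) : Prop :=
  near_backbone e1 eps a s /\
  Rabs (resonance_cos eps a b s) <= K0 * eps ^ 2 /\
  Rabs (resonance_sin eps a b s) <= K0 * eps ^ 2.

Lemma admissible_le e1 e2 eps a b s : e1 <= e2 ->
  admissible e1 eps a b s -> admissible e2 eps a b s.
Proof. intros H [[He H1] H2]. split; [split; [lra|exact H1]|exact H2]. Qed.

(* The equation is only required while |u| <= L eps, so that solutions of the
   equation with clamped nonlinearity qualify. *)
Definition truncated_solution (L eps s : R) (u : R -> R) (t : R) : Prop :=
  twice_derivable u t /\
  (Rabs (u t) <= L * eps -> forced_equation eps s u t).

(** The order of the quantifiers matters: K3 does not depend on B, so the energy level is fixed from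
    K3, then B from the level, and only then e1, L and Kd. *)
Lemma energy_slope : exists K3, 0 <= K3 /\ forall B, 0 <= B ->
  exists e1 L Kd, 0 < e1 <= 1 /\ 0 <= L /\ 0 <= Kd /\
  forall eps a b s u t, admissible e1 eps a b s ->
    truncated_solution L eps s u t ->
    Rabs (rot_p eps a b s u t) <= B -> Rabs (rot_q eps a b s u t) <= B ->
    Rabs (u t) <= L * eps /\
    exists l, is_derive (energy eps a b s u) t l /\ Rabs l <= Kd * eps /\
      l <= - eps * (lam / 4 * (rot_p eps a b s u t ^ 2 + rot_q eps a b s u t ^ 2) - K3)
           + Kd * eps ^ 2.
Proof.
  destruct (residual_bound) as [R0 [HR0 Hres]].
  assert (Hk1 := kappa_ge1).
  (* Bounds the term linear in rho, with 2 / Om <= 4 / om, |rho| <= R0 and kappa >= 1. *)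
  set (M1 := 4 * kappa * R0 / om).
  assert (HM1 : 0 <= M1).
  { unfold M1. apply Rmult_le_pos; [apply Rmult_le_pos; lra|].
    apply Rlt_le, Rinv_0_lt_compat, Hom. }
  exists (2 * M1 ^ 2 / lam).
  assert (HK3 : 0 <= M1 ^ 2 / lam).
  { apply Rmult_le_pos; [apply pow2_ge_0|apply Rlt_le, Rinv_0_lt_compat, Hlam]. }
  split; [lra|].
  intros B HB.
  destruct (frequency_bounds) as [ea [Hea HOm]].
  destruct (lyapunov_error B R0)
    as [eb [Ke [Heb [HKe Herr]]]].
  destruct (vapp_bdd 1 0 0 ltac:(lra)) as [_ [_ [Bv _]]].
  cbv zeta in Bv. destruct (bdd_elim _ _ Bv) as [Kv [HKv Hv]].
  destruct (common_bound ea eb (proj1 Hea) (proj1 Heb)) as [e1 [He1 [He1a He1b]]].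
  exists e1, (Kv + 2 * B), Ke.
  split; [lra|]. split; [lra|]. split; [exact HKe|].
  intros eps a b s u t [Hn [Hrc Hrs]] [Hu Heq] Hp Hq.
  assert (He : 0 < eps < e1) by apply Hn.
  assert (Hn1 : near_backbone 1 eps a s) by (split; [lra|apply Hn]).
  assert (HOm2 : om / 2 <= om + eps * s <= 2 * om).
  { apply (HOm eps a s). split; [lra|apply Hn]. }
  set (phi := (om + eps * s) * t + b).
  destruct (rot_inv eps a b s u t) as [Ey Ez]. cbv beta in Ey, Ez. fold phi in Ey, Ez.
  set (y := scaled_error eps a b s u t) in *.
  set (z := scaled_velocity eps a b s u t) in *.
  set (p := rot_p eps a b s u t) in *. set (q := rot_q eps a b s u t) in *.
  assert (Hc : Rabs (cos phi) <= 1) by apply Rabs_le, COS_bound.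
  assert (Hs : Rabs (sin phi) <= 1) by apply Rabs_le, SIN_bound.
  assert (Hy : Rabs y <= 2 * B) by now apply scaled_bounds.
  assert (Hut : Rabs (u t) <= (Kv + 2 * B) * eps).
  { replace (u t) with (eps * (vapp eps a s phi + eps ^ 2 * y))
      by (unfold y, scaled_error; fold phi; field; lra).
    rewrite Rabs_mult, (Rabs_right eps) by lra. rewrite (Rmult_comm eps).
    apply Rmult_le_compat_r; [lra|]. triangle.
    assert (Hd : orbit_domain 1 0 0 (OrbitPoint eps a s phi 0 0 0))
      by (split; [exact Hn1|]; simpl; rewrite Rabs_R0; lra).
    assert (V := Hv _ Hd). simpl in V.
    assert (Rabs (eps ^ 2 * y) <= 1 * (2 * B)).
    { rewrite Rabs_mult. apply Rmult_le_compat; try apply Rabs_pos; [|exact Hy].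
      rewrite Rabs_right; nra. }
    lra. }
  split; [exact Hut|].
  specialize (Heq Hut).
  assert (HOmp : 0 < om + eps * s) by lra.
  assert (Hder := energy_derive eps a b s u (proj1 He) HOmp t Hu).
  rewrite (acceleration_eq eps a b s u (proj1 He) HOmp t Heq) in Hder.
  fold y z in Hder. cbv beta in Hder. fold phi p q in Hder.
  set (rho := residual eps a b s phi / eps ^ 3) in *.
  assert (Hrho : Rabs rho <= R0).
  { now apply Hres. }
  set (G := error_force eps a s rho phi y z) in *.
  replace ((om + eps * s) * y + (- (om + eps * s) * y + eps * G / (om + eps * s)))
    with (eps * G / (om + eps * s)) in Hder by ring.
  assert (Hd : orbit_domain eb B R0 (OrbitPoint eps a s phi p q rho)).
  { split; [split; [simpl; lra|apply Hn]|]. simpl. auto. }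
  destruct (Herr _ Hd) as [V Vd]. cbn [op_e op_a op_s op_phi op_p op_q op_rho] in V, Vd.
  rewrite Ey, Ez in V, Vd. fold G in V, Vd.
  set (dl := dlyapunov eps (om + eps * s) (eps * G / (om + eps * s))
               (cos phi) (sin phi) p q) in *.
  set (l := 2 / (om + eps * s) * rho * (- kappa * sin phi * p + cos phi * q)) in *.
  assert (Hl : Rabs l <= M1 * (Rabs p + Rabs q)).
  { unfold l. rewrite !Rabs_mult.
    assert (H2 : Rabs (2 / (om + eps * s)) <= 4 / om).
    { rewrite Rabs_right by (apply Rle_ge, Rlt_le, Rdiv_lt_0_compat; lra).
      apply Rmult_le_reg_r with (om + eps * s); [lra|].
      replace (2 / (om + eps * s) * (om + eps * s)) with (4 / om * (om / 2)) by (field; lra).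
      apply Rmult_le_compat_l; [apply Rlt_le, Rdiv_lt_0_compat; lra|lra]. }
    assert (H3 : Rabs (- kappa * sin phi * p + cos phi * q) <= kappa * (Rabs p + Rabs q)).
    { triangle.
      rewrite !Rabs_mult, Rabs_Ropp, (Rabs_right kappa) by lra.
      assert (Rabs (sin phi) * Rabs p <= 1 * Rabs p)
        by (apply Rmult_le_compat_r; [apply Rabs_pos|exact Hs]).
      assert (Rabs (cos phi) * Rabs q <= 1 * Rabs q)
        by (apply Rmult_le_compat_r; [apply Rabs_pos|exact Hc]).
      assert (kappa * (Rabs (sin phi) * Rabs p) <= kappa * Rabs p)
        by (apply Rmult_le_compat_l; lra).
      assert (Rabs q <= kappa * Rabs q).
      { generalize (Rabs_pos q). nra. }
      rewrite Rmult_plus_distr_l. lra. }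
    replace (M1 * (Rabs p + Rabs q)) with (4 / om * R0 * (kappa * (Rabs p + Rabs q)))
      by (unfold M1; field; lra).
    apply Rmult_le_compat; [apply Rmult_le_pos; apply Rabs_pos|apply Rabs_pos| |exact H3].
    apply Rmult_le_compat; auto using Rabs_pos. }
  assert (Hp2 := pow2_ge_0 p). assert (Hq2 := pow2_ge_0 q).
  assert (He2 : 0 <= eps ^ 2 <= eps) by nra.
  exists dl. split; [exact Hder|].
  split; [exact Vd|].
  apply Rabs_le_between in V, Hl.
  (* Young's inequality: the residual costs half of the available dissipation lam / 2, and a
     constant M1^2 / lam for each coordinate. *)
  assert (Hyoung : forall x, M1 * Rabs x <= lam / 4 * x ^ 2 + M1 ^ 2 / lam).
  { intros x. rewrite <- (pow2_abs x). set (X := Rabs x).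
    assert (T : 0 <= (lam * X / 2 - M1) ^ 2 / lam).
    { apply Rmult_le_pos; [apply pow2_ge_0|apply Rlt_le, Rinv_0_lt_compat, Hlam]. }
    replace ((lam * X / 2 - M1) ^ 2 / lam)
      with (lam / 4 * X ^ 2 + M1 ^ 2 / lam - M1 * X) in T by (field; lra). lra. }
  generalize (Hyoung p) (Hyoung q). intros Y1 Y2.
  (* Completing the square in q; the choice of kappa leaves a positive multiple of p^2. *)
  assert (Hdec : lam / 2 * (p ^ 2 + q ^ 2) <= lam * kappa * p ^ 2 + lam * q ^ 2 + 4 * s0 * p * q).
  { assert (T : 0 <= (lam * q + 4 * s0 * p) ^ 2 / (2 * lam)).
    { apply Rmult_le_pos; [apply pow2_ge_0|apply Rlt_le, Rinv_0_lt_compat; lra]. }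
    assert (T2 : 0 <= (lam / 2 + 8 * s0 ^ 2 / lam) * p ^ 2).
    { apply Rmult_le_pos; [|lra].
      assert (0 <= 8 * s0 ^ 2 / lam); [|lra].
      apply Rmult_le_pos; [generalize (pow2_ge_0 s0); lra|].
      apply Rlt_le, Rinv_0_lt_compat, Hlam. }
    unfold kappa.
    match goal with |- ?a <= ?b => assert (E : b - a =
      (lam * q + 4 * s0 * p) ^ 2 / (2 * lam) + (lam / 2 + 8 * s0 ^ 2 / lam) * p ^ 2)
      by (field; lra) end.
    lra. }
  set (Q := lam * kappa * p ^ 2 + lam * q ^ 2 + 4 * s0 * p * q) in *.
  assert (T : lam / 4 * (p ^ 2 + q ^ 2) - 2 * M1 ^ 2 / lam <= Q + l).
  { replace (2 * M1 ^ 2 / lam) with (2 * (M1 ^ 2 / lam)) by (unfold Rdiv; ring). lra. }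
  apply Rmult_le_compat_l with (r := eps) in T; [|lra]. lra.
Qed.

Lemma v2_bounds : exists K2, 0 <= K2 /\ forall eps a s phi, near_backbone 1 eps a s ->
  Rabs (v2 a s phi) <= K2 /\ Rabs (v2' a s phi) <= K2 /\
  Rabs (v2'' a s phi) <= K2.
Proof.
  destruct (orbit_domain_bounds 1 0 0 ltac:(lra)) as [Be [Ba [Bs _]]].
  cbv zeta in Be, Ba, Bs. set (D := orbit_domain 1 0 0) in *.
  assert (B0 : bdd D (fun x => v2 (op_a x) (op_s x) (op_phi x)))
    by (unfold_harmonics; bdd_solve).
  assert (B1 : bdd D (fun x => v2' (op_a x) (op_s x) (op_phi x)))
    by (unfold_harmonics; bdd_solve).
  assert (B2 : bdd D (fun x => v2'' (op_a x) (op_s x) (op_phi x)))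
    by (unfold_harmonics; bdd_solve).
  destruct (bdd_elim _ _ B0) as [C0 [HC0 V0]]. destruct (bdd_elim _ _ B1) as [C1 [HC1 V1]].
  destruct (bdd_elim _ _ B2) as [C2 [HC2 V2]].
  exists (C0 + C1 + C2). split; [lra|]. intros eps a s phi Hn.
  assert (Hd : D (OrbitPoint eps a s phi 0 0 0))
    by (split; [exact Hn|]; simpl; rewrite Rabs_R0; lra).
  generalize (V0 _ Hd) (V1 _ Hd) (V2 _ Hd). simpl. lra.
Qed.

(** At phase 0, [initial_value] is eps times vapp without its v2 term, and the phase derivatives of
    cos and v1 vanish. Hence y and z start with size O(1). *)
Lemma initial_bound : exists N0 e1, 0 <= N0 /\ 0 < e1 <= 1 /\
  forall eps a b s u, near_backbone e1 eps a s ->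
    let t0 := - b / (om + eps * s) in
    Rabs (u t0 - initial_value om c d eps a) <= K * eps ^ 3 ->
    Rabs (Derive u t0) <= K * eps ^ 3 ->
    rot_p eps a b s u t0 ^ 2 + rot_q eps a b s u t0 ^ 2 <= N0.
Proof.
  destruct v2_bounds as [K2 [HK2 Hv2]].
  destruct (frequency_bounds) as [ea [Hea HOm]].
  set (Y := K + K2). set (Z := 2 * K / om + K2).
  exists (Y ^ 2 + Z ^ 2), ea. split; [generalize (pow2_ge_0 Y) (pow2_ge_0 Z); lra|].
  split; [exact Hea|].
  intros eps a b s u Hn t0 Hu Hv.
  assert (He : 0 < eps < ea) by apply Hn.
  assert (HOm2 := HOm _ _ _ Hn).
  assert (Hn1 : near_backbone 1 eps a s) by (split; [lra|apply Hn]).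
  assert (Hphi : (om + eps * s) * t0 + b = 0) by (unfold t0; field; lra).
  destruct (Hv2 eps a s 0 Hn1) as [V0 [V1 _]].
  assert (He3 : 0 < eps ^ 3) by (apply pow_lt; lra).
  unfold rot_p, rot_q. rewrite Hphi, cos_0, sin_0.
  assert (Ey : scaled_error eps a b s u t0
    = (u t0 - initial_value om c d eps a) / eps ^ 3 - v2 a s 0).
  { unfold scaled_error. rewrite Hphi. unfold vapp, v1, initial_value, v1_const, v1_cos2, v1_cos3.
    rewrite !Rmult_0_r, cos_0. field. split; lra. }
  assert (Ez : scaled_velocity eps a b s u t0
    = Derive u t0 / eps ^ 3 * / (om + eps * s) - v2' a s 0).
  { unfold scaled_velocity. rewrite Hphi. unfold vapp', v1'.
    rewrite !Rmult_0_r, sin_0. field. lra. }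
  assert (Hdiv : forall x, Rabs x <= K * eps ^ 3 -> Rabs (x / eps ^ 3) <= K).
  { intros x Hx. unfold Rdiv. rewrite Rabs_mult, (Rabs_right (/ eps ^ 3))
      by (apply Rle_ge, Rlt_le, Rinv_0_lt_compat, He3).
    apply Rmult_le_reg_r with (1 := He3). rewrite Rmult_assoc, Rinv_l; lra. }
  set (y := scaled_error eps a b s u t0) in *.
  set (z := scaled_velocity eps a b s u t0) in *.
  assert (Hy : Rabs y <= Y).
  { rewrite Ey. unfold Y, Rminus. triangle.
    rewrite Rabs_Ropp. apply Rplus_le_compat; [now apply Hdiv|exact V0]. }
  assert (Hz : Rabs z <= Z).
  { rewrite Ez. unfold Z, Rminus. triangle.
    rewrite Rabs_Ropp. apply Rplus_le_compat; [|exact V1].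
    rewrite Rabs_mult.
    replace (2 * K / om) with (K * / (om / 2)) by (field; lra).
    apply Rmult_le_compat; try apply Rabs_pos; [now apply Hdiv|].
    rewrite Rabs_right by (apply Rle_ge, Rlt_le, Rinv_0_lt_compat; lra).
    apply Rinv_le_contravar; lra. }
  replace (y * 1 - z * 0) with y by ring. replace (y * 0 + z * 1) with z by ring.
  apply Rplus_le_compat; apply pow_maj_Rabs; assumption.
Qed.

(* Forward in time the energy cannot cross a level on which it decreases;
   backward, on the bounded interval (0, t0], it grows at most like
   exp (t0 - t). *)
Lemma confinement : exists e1 L B, 0 < e1 <= 1 /\ 0 <= L /\ 0 <= B /\
  forall eps a b s T u, admissible e1 eps a b s -> - PI <= b ->
    let t0 := - b / (om + eps * s) in
    0 < t0 < T ->
    (forall t, 0 < t < T -> truncated_solution L eps s u t) ->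
    Rabs (u t0 - initial_value om c d eps a) <= K * eps ^ 3 ->
    Rabs (Derive u t0) <= K * eps ^ 3 ->
    forall t, 0 < t < T -> Rabs (rot_p eps a b s u t) <= B /\ Rabs (rot_q eps a b s u t) <= B /\
      Rabs (u t) <= L * eps.
Proof.
  destruct (energy_slope) as [K3 [HK3 Hslope]].
  destruct initial_bound as [N0 [ea [HN0 [Hea Hinit]]]].
  destruct (lyapunov_bounds) as [eb [Heb Hlb]].
  destruct (frequency_bounds) as [ec [Hec HOm]].
  assert (Hk1 := kappa_ge1).
  assert (HPI := PI_RGT_0).
  (* Upper bound of t0, since - PI <= b and the frequency is at least om / 2. *)
  set (T0 := PI / (om / 2)).
  (* On the level Bv, p^2 + q^2 >= 4 / lam (K3 + 2), so the slope is at most - 2 eps + Kd eps^2 < 0;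
     the summand N0 + 1 puts the initial energy below the level. *)
  set (Bv := 2 * kappa * (4 / lam * (K3 + 2) + N0 + 1)).
  assert (H4 : 0 <= 4 / lam * (K3 + 2)).
  { apply Rmult_le_pos; [apply Rlt_le, Rdiv_lt_0_compat|]; lra. }
  assert (HBv : 2 <= Bv) by (unfold Bv; nra).
  (* Contains the region where the energy is at most Bv exp T0, the bound reached backward in time,
     because V >= (p^2 + q^2) / 2. *)
  set (B := 2 * Bv * exp T0 + 1).
  assert (HexpT : 1 <= exp T0).
  { assert (0 < T0) by (unfold T0; apply Rdiv_lt_0_compat; lra).
    generalize (exp_ineq1_le T0). lra. }
  assert (HB : 1 <= B) by (unfold B; nra).
  destruct (Hslope B ltac:(lra)) as [ed [L [Kd [Hed [HL [HKd Hsl]]]]]].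
  destruct (small_epsilon Kd 1 HKd Rlt_0_1) as [ef [[Hef _] Hsmallf]].
  destruct (common_bound ea eb (proj1 Hea) (proj1 Heb)) as [eg [Heg [Hega Hegb]]].
  destruct (common_bound ec ed (proj1 Hec) (proj1 Hed)) as [eh [Heh [Hehc Hehd]]].
  destruct (common_bound eg eh Heg Heh) as [ei [Hei [Heig Heih]]].
  destruct (common_bound ei ef Hei Hef) as [e1 [He1 [He1i He1f]]].
  exists e1, L, B. split; [lra|]. split; [exact HL|]. split; [lra|].
  intros eps a b s T u Hadm Hb t0 Ht0 Hsol Hu0 Hv0.
  assert (Hn : near_backbone e1 eps a s) by apply Hadm.
  assert (He : 0 < eps < e1) by apply Hn.
  assert (HeK : Kd * eps < 1) by (apply Hsmallf; lra).
  assert (HOm2 : om / 2 <= om + eps * s <= 2 * om).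
  { apply (HOm eps a s). split; [lra|apply Hn]. }
  assert (HT0 : t0 <= T0).
  { unfold t0, T0. apply Rmult_le_compat; try lra.
    - apply Rlt_le, Rmult_lt_reg_r with (/ (om + eps * s)); [apply Rinv_0_lt_compat; lra|].
      destruct Ht0 as [H _]. unfold t0 in H. rewrite Rmult_0_l. exact H.
    - apply Rlt_le, Rinv_0_lt_compat; lra.
    - apply Rinv_le_contravar; lra. }
  set (V := energy eps a b s u). set (p := rot_p eps a b s u). set (q := rot_q eps a b s u).
  assert (HVb : forall t, (p t ^ 2 + q t ^ 2) / 2 <= V t <= 2 * kappa * (p t ^ 2 + q t ^ 2)).
  { intros t. apply Hlb. lra. }
  assert (Hsmall : forall t, V t <= Bv * exp T0 -> Rabs (p t) <= B /\ Rabs (q t) <= B).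
  { intros t Ht. destruct (HVb t) as [H1 _].
    generalize (pow2_ge_0 (p t)) (pow2_ge_0 (q t)). intros.
    split; apply Rsqr_incr_0; unfold Rsqr; try apply Rabs_pos; try lra;
      rewrite <- Rabs_mult, Rabs_right; unfold B in *; nra. }
  assert (Hstep : forall t, 0 < t < T -> V t <= Bv * exp T0 ->
    Rabs (u t) <= L * eps /\ exists l, is_derive V t l /\ Rabs l <= Kd * eps /\
      l <= - eps * (lam / 4 * (p t ^ 2 + q t ^ 2) - K3) + Kd * eps ^ 2).
  { intros t Ht HV. destruct (Hsmall t HV) as [Hp Hq].
    apply (Hsl eps a b s u t); auto. apply admissible_le with (2 := Hadm). lra. }
  assert (Hder : forall t, 0 < t < T -> ex_derive V t).
  { intros t Ht. destruct (Hsol t Ht) as [Htw _]. eexists.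
    apply energy_derive; try assumption; lra. }
  assert (HV0 : V t0 < Bv).
  { destruct (HVb t0) as [_ H1]. apply Rle_lt_trans with (1 := H1). unfold Bv.
    apply Rmult_lt_compat_l; [lra|].
    assert (p t0 ^ 2 + q t0 ^ 2 <= N0); [|lra].
    apply (Hinit eps a b s u); auto. split; [lra|apply Hn]. }
  clearbody V p q.
  assert (Hfwd : forall t, t0 <= t < T -> V t < Bv).
  { apply (barrier_right V t0 T Bv).
    - intros t Ht. apply (ex_derive_continuous V). apply Hder. lra.
    - exact HV0.
    - intros t Ht EV. destruct (Hstep t ltac:(lra)) as [_ [l [Hl [_ Hneg]]]].
      { rewrite EV. nra. }
      exists l. split; [exact Hl|]. destruct (HVb t) as [_ HN]. rewrite EV in HN.
      assert (HN2 : 4 / lam * (K3 + 2) <= p t ^ 2 + q t ^ 2).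
      { apply Rmult_le_reg_l with (2 * kappa); [lra|]. unfold Bv in HN. nra. }
      assert (HN3 : K3 + 2 <= lam / 4 * (p t ^ 2 + q t ^ 2)).
      { replace (K3 + 2) with (lam / 4 * (4 / lam * (K3 + 2))) by (field; lra).
        apply Rmult_le_compat_l; lra. }
      assert (eps * (K3 + 2) <= eps * (lam / 4 * (p t ^ 2 + q t ^ 2)))
        by (apply Rmult_le_compat_l; lra).
      assert (Kd * eps * eps <= 1 * eps) by (apply Rmult_le_compat_r; lra).
      lra. }
  (* At the barrier the weighted energy has derivative (l + V) exp (t - t0), positive because |l| <=
     Kd eps < 1 and V >= 2. *)
  assert (Hbwd : forall t, 0 < t <= t0 -> V t * exp (t - t0) < Bv).
  { apply (barrier_left (fun t => V t * exp (t - t0)) t0 0 Bv).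
    - intros t Ht. apply (ex_derive_continuous (fun t => V t * exp (t - t0))).
      auto_derive. apply Hder; lra.
    - rewrite Rminus_diag, exp_0, Rmult_1_r. exact HV0.
    - intros t Ht EV.
      assert (Hexp : 0 < exp (t - t0)) by apply exp_pos.
      assert (EV' : V t = Bv * exp (t0 - t)).
      { rewrite <- EV, Rmult_assoc, <- exp_plus.
        replace (t - t0 + (t0 - t)) with 0 by ring. rewrite exp_0; ring. }
      assert (HV2 : V t <= Bv * exp T0).
      { rewrite EV'. apply Rmult_le_compat_l; [lra|].
        apply Rlt_le, exp_increasing. lra. }
      destruct (Hstep t ltac:(lra) HV2) as [_ [l [Hl [Habs _]]]].
      exists ((l + V t) * exp (t - t0)). split.
      + auto_derive; [eexists; exact Hl|].
        rewrite (is_derive_unique (fun x : R => V x) _ _ Hl). unfold Rminus. ring.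
      + apply Rmult_lt_0_compat; [|exact Hexp].
        assert (1 <= exp (t0 - t)) by (generalize (exp_ineq1_le (t0 - t)); lra).
        assert (2 <= V t) by (rewrite EV'; nra).
        apply Rabs_le_between in Habs. lra. }
  intros t Ht.
  assert (HVt : V t <= Bv * exp T0).
  { destruct (Rle_dec t0 t).
    - generalize (Hfwd t ltac:(lra)). nra.
    - generalize (Hbwd t ltac:(lra)). intros H.
      assert (E : V t = V t * exp (t - t0) * exp (t0 - t)).
      { rewrite Rmult_assoc, <- exp_plus.
        replace (t - t0 + (t0 - t)) with 0 by ring. rewrite exp_0; ring. }
      rewrite E. apply Rmult_le_compat; try lra.
      + apply Rmult_le_pos; [|apply Rlt_le, exp_pos]. destruct (HVb t) as [G _].
        generalize (pow2_ge_0 (p t)) (pow2_ge_0 (q t)). lra.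
      + apply Rlt_le, exp_pos.
      + apply Rlt_le, exp_increasing. lra. }
  destruct (Hsmall t HVt). destruct (Hstep t Ht HVt). auto.
Qed.

(** The clamped equation is globally Lipschitz, hence solvable for all times; it coincides with the
    true one as long as |u| <= L eps, which [confinement] then guarantees. *)
Lemma truncated_solution_exists (L eps s : R) : 0 < eps -> 0 <= L ->
  forall t0 u0 w0, exists u : R -> R, u t0 = u0 /\ Derive u t0 = w0 /\
    forall t, truncated_solution L eps s u t.
Proof.
  intros He HL t0 u0 w0.
  assert (Hm : 0 <= L * eps) by (apply Rmult_le_pos; lra).
  destruct (clamped_poly_lipschitz (L * eps) (- om ^ 2) (- c) (- (d / eps)) Hm) as [Lg [HLg Hg]].
  cbv zeta in Hg.
  set (g := fun x => - om ^ 2 * x + - c * clamp (- (L * eps)) (L * eps) x ^ 2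
                     + - (d / eps) * clamp (- (L * eps)) (L * eps) x ^ 3) in *.
  assert (Hgc : forall x, continuous g x).
  { intros x. apply continuity_pt_filterlim. now apply (lipschitz_continuity g Lg). }
  destruct (ode_second_order_exists
    (fun t x v => g x - eps * lam * v + eps ^ 2 * Fm * cos ((om + eps * s) * t))
    (Lg + Rabs (eps * lam)) (Rabs (eps ^ 2 * Fm))) with (t0 := t0) (x0 := u0) (v0 := w0)
    as [u [Hu0 [Hw0 Hu]]].
  - intros t x v x' v'.
    replace (g x - eps * lam * v + eps ^ 2 * Fm * cos ((om + eps * s) * t)
        - (g x' - eps * lam * v' + eps ^ 2 * Fm * cos ((om + eps * s) * t)))
      with ((g x - g x') + - (eps * lam * (v - v'))) by ring.
    triangle. rewrite Rabs_Ropp, (Rabs_mult (eps * lam)).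
    generalize (Hg x x'). fold (g x) (g x'). intros H.
    assert (H1 := Rabs_pos (x - x')). assert (H2 := Rabs_pos (v - v')).
    assert (H3 := Rabs_pos (eps * lam)).
    assert (0 <= Lg * Rabs (v - v')) by (apply Rmult_le_pos; lra).
    assert (0 <= Rabs (eps * lam) * Rabs (x - x')) by (apply Rmult_le_pos; lra).
    lra.
  - intros x v Hx Hv t.
    apply (continuous_plus (fun r => g (x r) - eps * lam * v r)).
    + apply (continuous_minus (fun r => g (x r)) (fun r => eps * lam * v r)).
      * apply (continuous_comp x g); [apply Hx|apply Hgc].
      * apply (continuous_scal_r (eps * lam) v), Hv.
    + apply (ex_derive_continuous (fun r => eps ^ 2 * Fm * cos ((om + eps * s) * r))).
      auto_derive. trivial.
  - intros t. unfold g. rewrite clamp_id by lra.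
    replace (- om ^ 2 * 0 + - c * 0 ^ 2 + - (d / eps) * 0 ^ 3 - eps * lam * 0
      + eps ^ 2 * Fm * cos ((om + eps * s) * t)) with (eps ^ 2 * Fm * cos ((om + eps * s) * t))
      by ring.
    rewrite Rabs_mult. rewrite <- (Rmult_1_r (Rabs (eps ^ 2 * Fm))) at 2.
    apply Rmult_le_compat_l; [apply Rabs_pos|apply Rabs_le, COS_bound].
  - exists u. split; [exact Hu0|]. split; [exact Hw0|]. intros t.
    destruct (Hu t) as [H1 [H2 H3]]. split; [split; assumption|]. intros Hsm.
    unfold forced_equation. rewrite H3. unfold g.
    rewrite clamp_id by now apply Rabs_le_between. ring.
Qed.

(** Controls the acceleration of the error, and with it the second derivative of the remainder r. *)
Lemma error_force_bound (B R0 : R) : exists KG, 0 <= KG /\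
  forall x, orbit_domain 1 B R0 x ->
    Rabs (error_force (op_e x) (op_a x) (op_s x) (op_rho x) (op_phi x)
      (op_p x * cos (op_phi x) + op_q x * sin (op_phi x))
      (- op_p x * sin (op_phi x) + op_q x * cos (op_phi x))) <= KG.
Proof.
  destruct (orbit_domain_bounds 1 B R0 ltac:(lra))
    as [Be [Ba [Bs [Bp [Bq [Br _]]]]]].
  destruct (vapp_bdd 1 B R0 ltac:(lra)) as [_ [_ [Bv _]]].
  cbv zeta in *.
  apply (bdd_elim (orbit_domain 1 B R0)). unfold error_force.
  set (va := fun x => vapp (op_e x) (op_a x) (op_s x) (op_phi x)) in *.
  cbv zeta. bdd_solve.
Qed.

Lemma approximation_eq eps a b s t :
  approximation om c d eps (om + eps * s) a b t
  = eps * (a * cos ((om + eps * s) * t + b) + eps * v1 a ((om + eps * s) * t + b)).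
Proof. unfold approximation, v1, v1_const, v1_cos2, v1_cos3. ring. Qed.

Lemma forced_response : exists e1 C, 0 < e1 <= 1 /\ 0 <= C /\
  forall eps a b s T, admissible e1 eps a b s -> - PI <= b ->
    let t0 := - b / (om + eps * s) in
    0 < t0 < T -> forall u0 w0,
    Rabs (u0 - initial_value om c d eps a) <= K * eps ^ 3 -> Rabs w0 <= K * eps ^ 3 ->
    (exists u : R -> R, forced_solution om lam c d Fm eps (om + eps * s) T u /\
       u t0 = u0 /\ Derive u t0 = w0) /\
    (forall u : R -> R, forced_solution om lam c d Fm eps (om + eps * s) T u ->
       u t0 = u0 -> Derive u t0 = w0 ->
       exists r : R -> R, C2_bounded C T r /\ forall t : R, 0 < t < T ->
         u t = approximation om c d eps (om + eps * s) a b t + eps ^ 3 * r t).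
Proof.
  destruct (confinement)
    as [ea [L [B [Hea [HL [HB Hconf]]]]]].
  destruct (frequency_bounds) as [eb [Heb HOm]].
  destruct (v2_bounds) as [K2 [HK2 Hv2]].
  destruct (residual_bound) as [R0 [HR0 Hres]].
  destruct (error_force_bound B R0) as [KG [HKG HG]].
  set (M1 := K2 + 2 * B).
  set (C := M1 + 2 * om * M1 + (2 * om) ^ 2 * M1 + KG).
  assert (HM1 : 0 <= M1) by (unfold M1; lra).
  assert (Hom1 : 0 <= 2 * om * M1) by (apply Rmult_le_pos; lra).
  assert (Hom2 : 0 <= (2 * om) ^ 2 * M1) by (apply Rmult_le_pos; [apply pow2_ge_0|lra]).
  destruct (common_bound ea eb (proj1 Hea) (proj1 Heb)) as [e1 [He1 [He1a He1b]]].
  exists e1, C. split; [lra|]. split; [unfold C; lra|].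
  intros eps a b s T Hadm Hb t0 Ht0 u0 w0 Hu0 Hw0.
  assert (Hn : near_backbone e1 eps a s) by apply Hadm.
  assert (He : 0 < eps < e1) by apply Hn.
  assert (Hn1 : near_backbone 1 eps a s) by (split; [lra|apply Hn]).
  assert (HOm2 : om / 2 <= om + eps * s <= 2 * om).
  { apply (HOm eps a s). split; [lra|apply Hn]. }
  assert (Hadma := admissible_le e1 ea eps a b s He1a Hadm).
  split.
  - destruct (truncated_solution_exists L eps s (proj1 He) HL t0 u0 w0)
      as [u [Eu [Ew Hu]]].
    exists u. split; [|auto]. intros t Ht.
    destruct (Hconf eps a b s T u Hadma Hb Ht0 (fun t _ => Hu t)
      ltac:(fold t0; rewrite Eu; exact Hu0) ltac:(fold t0; rewrite Ew; exact Hw0) t Ht)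
      as [_ [_ Hsm]].
    destruct (Hu t) as [[H1 H2] H3]. split; [exact H1|]. split; [exact H2|].
    exact (H3 Hsm).
  - intros u Hu Eu Ew.
    assert (Htr : forall t, 0 < t < T -> truncated_solution L eps s u t).
    { intros t Ht. destruct (Hu t Ht) as [H1 [H2 H3]]. split; [split; assumption|].
      intros _. exact H3. }
    assert (Hcf := Hconf eps a b s T u Hadma Hb Ht0 Htr
      ltac:(fold t0; rewrite Eu; exact Hu0) ltac:(fold t0; rewrite Ew; exact Hw0)).
    set (Om := om + eps * s) in *.
    assert (HOmp : 0 < Om) by lra.
    set (y := scaled_error eps a b s u).
    set (z := scaled_velocity eps a b s u).
    set (acc := acceleration eps a b s u).
    (* The stated approximation stops at v1, so the remainder is the second corrector plus the
       scaled error; [r1] and [r2] are its first two derivatives. *)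
    set (r := fun t => v2 a s (Om * t + b) + y t).
    set (r1 := fun t => Om * (v2' a s (Om * t + b) + z t)).
    set (r2 := fun t => Om * (Om * v2'' a s (Om * t + b) + acc t)).
    assert (Hr1 : forall t, 0 < t < T -> is_derive r t (r1 t)).
    { intros t Ht. destruct (Hu t Ht) as [H1 _].
      assert (Hy := scaled_error_derive eps a b s u (proj1 He) HOmp t H1).
      assert (Hv := v2_derive a s (Om * t + b)).
      unfold r, r1. fold y z in Hy. auto_derive.
      - split; [eexists; exact Hv|]. split; [eexists; exact Hy|trivial].
      - rewrite (is_derive_unique (fun x : R => y x) _ _ Hy),
          (is_derive_unique (fun x : R => v2 a s x) _ _ Hv). fold Om. ring. }
    assert (Hr2 : forall t, 0 < t < T -> is_derive r1 t (r2 t)).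
    { intros t Ht. destruct (Hu t Ht) as [_ [H2 _]].
      assert (Hz := scaled_velocity_derive eps a b s u (proj1 He) HOmp t H2).
      assert (Hv := v2'_derive a s (Om * t + b)).
      unfold r1, r2. fold z acc in Hz. auto_derive.
      - split; [eexists; exact Hv|]. split; [eexists; exact Hz|trivial].
      - rewrite (is_derive_unique (fun x : R => z x) _ _ Hz),
          (is_derive_unique (fun x : R => v2' a s x) _ _ Hv). ring. }
    assert (ED : forall t, 0 < t < T -> Derive r t = r1 t)
      by (intros t Ht; apply is_derive_unique, Hr1, Ht).
    assert (Hd2 : forall t, 0 < t < T -> is_derive (Derive r) t (r2 t)).
    { intros t Ht. apply (is_derive_ext_loc r1); [|apply Hr2, Ht].
      apply (open_interval_locally T); [exact Ht|]. intros x Hx. symmetry. now apply ED. }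
    assert (ED2 : forall t, 0 < t < T -> Derive_n r 2 t = r2 t)
      by (intros t Ht; exact (is_derive_unique _ _ _ (Hd2 t Ht))).
    assert (Hbnd : forall t, 0 < t < T -> Rabs (y t) <= 2 * B /\ Rabs (z t) <= 2 * B /\
              Rabs (Om * acc t) <= Om ^ 2 * (2 * B) + KG).
    { intros t Ht. destruct (Hcf t Ht) as [Hp [Hq _]].
      destruct (rot_inv eps a b s u t) as [Ey Ez]. cbv beta in Ey, Ez.
      fold Om y z in Ey, Ez.
      set (p := rot_p eps a b s u t) in *.
      set (q := rot_q eps a b s u t) in *.
      set (phi := Om * t + b) in *.
      destruct (scaled_bounds eps a b s u B t Hp Hq) as [Hy Hz].
      fold y z in Hy, Hz.
      split; [exact Hy|]. split; [exact Hz|].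
      destruct (Hu t Ht) as [_ [_ Heq]].
      assert (Ea := acceleration_eq eps a b s u (proj1 He) HOmp t Heq).
      fold Om phi in Ea. fold y z acc in Ea.
      set (rho := residual eps a b s phi / eps ^ 3) in *.
      assert (Hrho : Rabs rho <= R0).
      { apply Hres; [exact Hn1|apply Hadm|apply Hadm]. }
      assert (Hd : orbit_domain 1 B R0 (OrbitPoint eps a s phi p q rho)).
      { split; [exact Hn1|]. simpl. auto. }
      assert (V := HG _ Hd). cbn [op_e op_a op_s op_phi op_p op_q op_rho] in V.
      rewrite Ey, Ez in V.
      set (G := error_force eps a s rho phi (y t) (z t)) in *.
      replace (Om * acc t) with (- Om ^ 2 * y t + eps * G) by (rewrite Ea; field; lra).
      triangle. apply Rplus_le_compat.
      - rewrite Rabs_mult, Rabs_Ropp, (Rabs_right (Om ^ 2))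
          by (apply Rle_ge, pow2_ge_0).
        apply Rmult_le_compat_l; [apply pow2_ge_0|exact Hy].
      - rewrite Rabs_mult, (Rabs_right eps) by lra.
        generalize (Rabs_pos G). intros. nra. }
    exists r. split.
    + intros t Ht.
      assert (Hdr := Hr1 t Ht). assert (Hdr2 := Hd2 t Ht).
      split; [eexists; exact Hdr|]. split; [eexists; exact Hdr2|].
      destruct (Hv2 eps a s (Om * t + b) Hn1) as [V0 [V1 V2]].
      destruct (Hbnd t Ht) as [Hy [Hz Hacc]].
      rewrite ED2, ED by exact Ht.
      split; [|split; [|split]].
      (* Continuity of the second derivative: near t the equation expresses it through u and Derive
         u, which are differentiable. *)
      * set (f := fun x => Om * (Om * v2'' a s (Om * x + b)
          + (eps ^ 2 * Fm * cos (Om * x) - om ^ 2 * u x - eps * lam * Derive u x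
             - c * u x ^ 2 - d / eps * u x ^ 3
             - eps * Om ^ 2 * vapp'' eps a s (Om * x + b)) / (Om * eps ^ 3))).
        apply (continuous_ext_loc _ f).
        { apply (open_interval_locally T); [exact Ht|]. intros x Hx.
          rewrite ED2 by exact Hx. unfold f, r2, acc, acceleration. fold Om.
          destruct (Hu x Hx) as [_ [_ Heq]]. fold Om in Heq. rewrite <- Heq.
          f_equal. f_equal. f_equal. ring. }
        apply (ex_derive_continuous f). unfold f, vapp'', v1'', v2''.
        destruct (Hu t Ht) as [H1 [H2 _]].
        auto_derive. repeat split; assumption.
      * unfold r. triangle. unfold C, M1 in *. lra.
      * unfold r1. rewrite Rabs_mult, (Rabs_right Om) by lra.
        apply Rle_trans with (2 * om * M1); [|unfold C; lra].
        apply Rmult_le_compat; try lra; [apply Rabs_pos|].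
        triangle. unfold M1. lra.
      * replace (r2 t) with (Om ^ 2 * v2'' a s (Om * t + b) + Om * acc t)
          by (unfold r2; ring).
        triangle.
        rewrite Rabs_mult, (Rabs_right (Om ^ 2)) by (apply Rle_ge, pow2_ge_0).
        assert (HOmsq : Om ^ 2 <= (2 * om) ^ 2) by (apply pow_incr; lra).
        assert (Om ^ 2 * Rabs (v2'' a s (Om * t + b)) <= (2 * om) ^ 2 * K2).
        { apply Rmult_le_compat; try apply Rabs_pos; [apply pow2_ge_0|exact HOmsq|exact V2]. }
        assert (Om ^ 2 * (2 * B) <= (2 * om) ^ 2 * (2 * B))
          by (apply Rmult_le_compat_r; lra).
        unfold C, M1 in *. lra.
    + intros t Ht. unfold Om. rewrite approximation_eq. fold Om.
      unfold r, y, scaled_error, vapp. fold Om. field. lra.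
Qed.

End ForcedResponse.

(** * The amplitude-phase system *)

Lemma sin_shift b : sin (b - PI / 2) = - cos b.
Proof. rewrite sin_minus, sin_PI2, cos_PI2. ring. Qed.

Lemma cos_shift b : cos (b - PI / 2) = sin b.
Proof. rewrite cos_minus, sin_PI2, cos_PI2. ring. Qed.

Section Normalization.
Context (om lam c d Fm m M : R) (rho1 rho2 : R -> R -> R -> R -> R).
Context (Hom : 0 < om) (Hlam : 0 < lam) (HFm : Fm <> 0).
Context (Hrho1 : remainder_O3 Fm rho1) (Hrho2 : remainder_O3 Fm rho2).
Local Notation a0 := (a0star om lam Fm).
Local Notation s0 := (sigma0star om lam d Fm).
Context (Hm : 0 < m < Rabs a0) (HMa : Rabs a0 < M).

Lemma a0star_neq0 : a0 <> 0.
Proof.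
  unfold a0star. apply Rmult_integral_contrapositive. split; [exact HFm|].
  apply Rinv_neq_0_compat. apply Rmult_integral_contrapositive. lra.
Qed.

Lemma Fm_eq : Fm = lam * om * a0.
Proof. unfold a0star. field. lra. Qed.

Lemma backbone_eq : 3 * d * a0 ^ 2 = 8 * om * s0.
Proof. unfold sigma0star. field. lra. Qed.

Definition alpha2 (x b s : R) : R := A_2 om lam c d Fm (a0 * x) (b - PI / 2) s.
Definition rem1 (eps x b s : R) : R :=
  2 / (eps * lam * a0) * rho1 eps (a0 * x) (b - PI / 2) s.
Definition rem2 (eps x b s : R) : R := rho2 eps (a0 * x) (b - PI / 2) s / eps.

Local Notation stat := (normalized_stationary lam s0
  (fun eps x b s => eps * amplitude_correction om lam s0 x b s + rem1 eps x b s)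
  (fun eps x b s => eps * alpha2 x b s + rem2 eps x b s)).
Local Notation x1 := (m / Rabs a0).
Local Notation x2 := (M / Rabs a0).

Lemma normalized_bounds : 0 < x1 < 1 /\ 1 < x2.
Proof.
  assert (Ha := Rabs_pos_lt _ a0star_neq0).
  split; [split; [apply Rdiv_lt_0_compat; lra|]|].
  - apply Rmult_lt_reg_r with (1 := Ha). field_simplify; lra.
  - apply Rmult_lt_reg_r with (1 := Ha). field_simplify; lra.
Qed.

(** The sign condition 0 < Fm a amounts to x > 0, because Fm = lam om a0 has the sign of a0. *)
Lemma in_range_normalized x b s :
  in_range Fm m M (a0 * x) (b - PI / 2) s <-> phase_box x1 x2 M x b s.
Proof.
  assert (Ha := Rabs_pos_lt _ a0star_neq0).
  assert (Ha2 : 0 < a0 ^ 2) by (generalize (pow2_abs a0); nra).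
  unfold in_range, phase_box.
  assert (E1 : forall y, m / Rabs a0 <= y <-> m <= Rabs a0 * y).
  { intros y. split; intros H.
    - apply Rmult_le_compat_l with (r := Rabs a0) in H; [|lra].
      replace (Rabs a0 * (m / Rabs a0)) with m in H by (field; lra). exact H.
    - apply Rmult_le_reg_l with (1 := Ha).
      replace (Rabs a0 * (m / Rabs a0)) with m by (field; lra). exact H. }
  assert (E2 : forall y, y <= M / Rabs a0 <-> Rabs a0 * y <= M).
  { intros y. split; intros H.
    - apply Rmult_le_compat_l with (r := Rabs a0) in H; [|lra].
      replace (Rabs a0 * (M / Rabs a0)) with M in H by (field; lra). exact H.
    - apply Rmult_le_reg_l with (1 := Ha).
      replace (Rabs a0 * (M / Rabs a0)) with M by (field; lra). exact H. }
  assert (EF : Fm * (a0 * x) = lam * om * a0 ^ 2 * x) by (rewrite Fm_eq at 1; ring).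
  assert (Hpos : 0 < lam * om * a0 ^ 2)
    by (apply Rmult_lt_0_compat; [apply Rmult_lt_0_compat|]; lra).
  rewrite Rabs_mult. split.
  - intros [H1 [H2 [H3 H4]]]. rewrite EF in H1.
    assert (Hx : 0 < x) by nra. rewrite (Rabs_right x) in H2 by lra.
    apply Rabs_le_between in H4.
    split; [split; [now apply E1|now apply E2]|]. lra.
  - intros [[H1 H2] [H3 H4]]. apply E1 in H1. apply E2 in H2.
    assert (Hx : 0 < x) by nra. rewrite (Rabs_right x), EF by lra.
    split; [now apply Rmult_lt_0_compat|]. split; [lra|]. split; [lra|].
    now apply Rabs_le_between.
Qed.

Lemma in_range_denormalize a beta s : in_range Fm m M a beta s ->
  phase_box x1 x2 M (a / a0) (beta + PI / 2) s.
Proof.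
  intros H. apply in_range_normalized.
  replace (a0 * (a / a0)) with a by (field; apply a0star_neq0).
  now replace (beta + PI / 2 - PI / 2) with beta by ring.
Qed.

Lemma amplitude_correction_eq x b s :
  amplitude_correction om lam s0 x b s
  = 2 / (lam * a0) * A_1 om lam d Fm (a0 * x) (b - PI / 2) s.
Proof.
  unfold amplitude_correction, A_1. rewrite sin_shift, cos_shift.
  assert (Es : s0 = 3 * d * a0 ^ 2 / (8 * om)) by reflexivity.
  generalize a0star_neq0 Fm_eq Es. generalize a0 s0. intros A S HA EF ES.
  rewrite EF, ES. field. lra.
Qed.

Lemma stationary_normalized eps x b s : 0 < eps -> x <> 0 ->
  stationary om lam c d Fm rho1 rho2 eps (a0 * x) (b - PI / 2) s <-> stat eps x b s.
Proof.
  intros He Hx. assert (Ha := a0star_neq0).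
  unfold stationary, normalized_stationary, rhs_amplitude, rhs_phase.
  assert (E1 : eps * G1 om lam Fm (a0 * x) (b - PI / 2)
      + eps ^ 2 * A_1 om lam d Fm (a0 * x) (b - PI / 2) s + rho1 eps (a0 * x) (b - PI / 2) s
    = - (eps * lam * a0 / 2) * (x - (cos b + (eps * amplitude_correction om lam s0 x b s
        + rem1 eps x b s)))).
  { rewrite amplitude_correction_eq. unfold rem1, G1. rewrite sin_shift.
    set (A := A_1 om lam d Fm (a0 * x) (b - PI / 2) s).
    set (r := rho1 eps (a0 * x) (b - PI / 2) s).
    replace (Fm * - cos b) with (lam * om * a0 * - cos b) by (rewrite <- Fm_eq; ring).
    field. lra. }
  assert (E2 : eps * G2 om d Fm (a0 * x) (b - PI / 2) s
      + eps ^ 2 * A_2 om lam c d Fm (a0 * x) (b - PI / 2) s + rho2 eps (a0 * x) (b - PI / 2) s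
    = - eps * (s - (detuning0 lam s0 x b + (eps * alpha2 x b s + rem2 eps x b s)))).
  { unfold detuning0, rem2, G2, alpha2. rewrite cos_shift.
    set (A := A_2 om lam c d Fm (a0 * x) (b - PI / 2) s).
    set (r := rho2 eps (a0 * x) (b - PI / 2) s).
    replace (Fm * sin b) with (lam * om * a0 * sin b) by (rewrite <- Fm_eq; ring).
    replace s0 with (3 * d * a0 ^ 2 / (8 * om)) by (unfold sigma0star; reflexivity).
    field. repeat split; lra. }
  rewrite E1, E2.
  assert (Hne : eps * lam * a0 / 2 <> 0).
  { revert Ha. generalize a0. intros A HA. unfold Rdiv.
    repeat apply Rmult_integral_contrapositive_currified; try exact HA; lra. }
  split.
  - intros [H1 H2]. apply Rmult_integral in H1, H2. split.
    + destruct H1 as [H1|H1]; lra.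
    + destruct H2 as [H2|H2]; lra.
  - intros [H1 H2]. split.
    + rewrite <- H1. ring.
    + rewrite <- H2. ring.
Qed.

Lemma alpha2_lipschitz : exists C, 0 <= C /\
  lipschitz_on_box (phase_box x1 x2 M) C alpha2.
Proof.
  assert (Ha := a0star_neq0). destruct normalized_bounds as [[Hx1 _] _].
  (* [A_2] rewritten with / x as a separate factor, so that the hypothesis [Bi] on the inverse
     applies. *)
  destruct (lipschitz_on_box_intro x1 x2 M (fun x b s =>
    - lam ^ 2 / (8 * om) - 15 * d ^ 2 * (a0 * x) ^ 4 / (256 * om ^ 3)
    - 5 * c ^ 2 * (a0 * x) ^ 2 / (12 * om ^ 3)
    + s * Fm * sin b / (4 * om ^ 2 * a0) * / x
    + 3 * d * (a0 * x) * Fm * sin b / (32 * om ^ 3)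
    + lam * Fm * cos b / (8 * om ^ 2 * a0) * / x)) as [C [HC HL]].
  - intros dist D dpos Bx Bb Bs.
    assert (Bi : bounded_lipschitz D dist (fun p => / fst (fst p))).
    { apply (bl_inv D dist dpos (fun p => fst (fst p)) x1 Hx1); [|exact Bx].
      intros p [[Hp _] _]; exact Hp. }
    bl_solve.
  - exists C. split; [exact HC|]. intros x b s x' b' s' B B'.
    assert (E : forall x b s, phase_box x1 x2 M x b s -> alpha2 x b s =
      - lam ^ 2 / (8 * om) - 15 * d ^ 2 * (a0 * x) ^ 4 / (256 * om ^ 3)
      - 5 * c ^ 2 * (a0 * x) ^ 2 / (12 * om ^ 3)
      + s * Fm * sin b / (4 * om ^ 2 * a0) * / x
      + 3 * d * (a0 * x) * Fm * sin b / (32 * om ^ 3)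
      + lam * Fm * cos b / (8 * om ^ 2 * a0) * / x).
    { intros y e t [[Hy _] _]. unfold alpha2, A_2. rewrite sin_shift, cos_shift.
      field. repeat split; try lra. }
    rewrite (E x b s B), (E x' b' s' B'). exact (HL x b s x' b' s' B B').
Qed.

Definition uniform_remainder (C e0 : R) (rho : R -> R -> R -> R -> R) : Prop :=
  forall eps a beta s a' beta' s', 0 < eps < e0 ->
    in_range Fm m M a beta s -> in_range Fm m M a' beta' s' ->
    Rabs (rho eps a beta s) <= C * eps ^ 3 /\
    Rabs (rho eps a beta s - rho eps a' beta' s') <= C * eps ^ 3 * dist3 a beta s a' beta' s'.

Lemma remainder_bounds : exists C e0, 0 <= C /\ 0 < e0 <= 1 /\
  uniform_remainder C e0 rho1 /\ uniform_remainder C e0 rho2.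
Proof.
  destruct (Hrho1 m M (proj1 Hm)) as [C1 [f1 [Hf1 V1]]].
  destruct (Hrho2 m M (proj1 Hm)) as [C2 [f2 [Hf2 V2]]].
  destruct (common_bound f1 f2 Hf1 Hf2) as [f [Hf [Hff1 Hff2]]].
  destruct (common_bound 1 f Rlt_0_1 Hf) as [e0 [He0 [He01 He0f]]].
  assert (H1 := Rabs_pos C1). assert (H2 := Rabs_pos C2).
  assert (T : forall K e u v w, K <= Rabs C1 + Rabs C2 -> 0 < e -> 0 <= w ->
    u <= K * e ^ 3 /\ v <= K * e ^ 3 * w ->
    u <= (Rabs C1 + Rabs C2) * e ^ 3 /\ v <= (Rabs C1 + Rabs C2) * e ^ 3 * w).
  { intros K e u v w HK He Hw [Hu Hv].
    assert (K * e ^ 3 <= (Rabs C1 + Rabs C2) * e ^ 3)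
      by (apply Rmult_le_compat_r; [apply pow_le|]; lra).
    split; [lra|]. apply Rle_trans with (1 := Hv). now apply Rmult_le_compat_r. }
  exists (Rabs C1 + Rabs C2), e0. split; [lra|]. split; [lra|].
  split; intros eps a beta s a' beta' s' He B B'.
  - apply (T C1); [generalize (Rle_abs C1); lra|lra|apply dist3_pos|]. apply V1; auto; lra.
  - apply (T C2); [generalize (Rle_abs C2); lra|lra|apply dist3_pos|]. apply V2; auto; lra.
Qed.

(** Common form of the two divisions: f is 2 / (eps lam a0) for rho1 and / eps for rho2. The factor
    |a0| + 1 comes from the change of variables in the Lipschitz bound. *)
Lemma remainder2_normalized (C e0 k : R) (f : R -> R) (rho : R -> R -> R -> R -> R) :
  0 <= C -> 0 <= k -> (forall eps, 0 < eps -> Rabs (f eps) = k / eps) ->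
  uniform_remainder C e0 rho ->
  remainder2 (phase_box x1 x2 M) (k * C * (Rabs a0 + 1)) e0
    (fun eps x b s => f eps * rho eps (a0 * x) (b - PI / 2) s).
Proof.
  intros HC Hk Hf V eps x b s x' b' s' He B B'.
  apply in_range_normalized in B, B'.
  destruct (V eps _ _ _ _ _ _ He B B') as [V1 V2].
  assert (He3 : 0 <= eps ^ 3) by (apply pow_le; lra).
  assert (HkC : 0 <= k * C) by now apply Rmult_le_pos.
  assert (Hke : 0 <= k / eps).
  { apply Rmult_le_pos; [exact Hk|apply Rlt_le, Rinv_0_lt_compat; lra]. }
  assert (Hd : dist3 (a0 * x) (b - PI / 2) s (a0 * x') (b' - PI / 2) s'
               <= (Rabs a0 + 1) * dist3 x b s x' b' s').
  { unfold dist3.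
    replace (a0 * x - a0 * x') with (a0 * (x - x')) by ring.
    replace (b - PI / 2 - (b' - PI / 2)) with (b - b') by ring.
    rewrite Rabs_mult.
    generalize (Rabs_pos (x - x')) (Rabs_pos (b - b')) (Rabs_pos (s - s')). nra. }
  split.
  - rewrite Rabs_mult, Hf by lra.
    apply Rle_trans with (k / eps * (C * eps ^ 3)); [now apply Rmult_le_compat_l|].
    replace (k / eps * (C * eps ^ 3)) with (k * C * 1 * eps ^ 2) by (field; lra).
    apply Rmult_le_compat_r; [apply pow2_ge_0|]. apply Rmult_le_compat_l; lra.
  - rewrite <- Rmult_minus_distr_l, Rabs_mult, Hf by lra.
    apply Rle_trans with (k / eps * (C * eps ^ 3 * ((Rabs a0 + 1) * dist3 x b s x' b' s'))).
    + apply Rmult_le_compat_l; [exact Hke|]. apply Rle_trans with (1 := V2).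
      apply Rmult_le_compat_l; [now apply Rmult_le_pos|exact Hd].
    + right. field. lra.
Qed.

Lemma normalized_corrections : exists C e0, 0 <= C /\ 0 < e0 <= 1 /\
  lipschitz_on_box (phase_box x1 x2 M) C alpha2 /\
  remainder2 (phase_box x1 x2 M) C e0 rem1 /\ remainder2 (phase_box x1 x2 M) C e0 rem2.
Proof.
  destruct remainder_bounds as [C [e0 [HC [He0 [V1 V2]]]]].
  destruct alpha2_lipschitz as [Ca [HCa Ha]].
  set (k := 2 / (lam * Rabs a0)).
  assert (Hk : 0 < k) by (unfold k; apply Rdiv_lt_0_compat; [|apply Rmult_lt_0_compat]; lra).
  assert (R1 := remainder2_normalized C e0 k (fun eps => 2 / (eps * lam * a0)) rho1 HC
    (Rlt_le _ _ Hk)).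
  assert (R2 := remainder2_normalized C e0 1 (fun eps => / eps) rho2 HC Rle_0_1).
  set (q := C * (Rabs a0 + 1)).
  assert (Hq : 0 <= q) by (apply Rmult_le_pos; lra).
  assert (Hkq : 0 <= k * q) by (apply Rmult_le_pos; lra).
  exists (k * q + q + Ca), e0. split; [lra|]. split; [exact He0|]. split; [|split].
  - intros x b s x' b' s' B B'. destruct (Ha _ _ _ _ _ _ B B') as [W1 W2].
    split; [lra|]. apply Rle_trans with (1 := W2).
    apply Rmult_le_compat_r; [apply dist3_pos|lra].
  - apply remainder2_le with (k * C * (Rabs a0 + 1)); [unfold q in *; lra|].
    apply R1; [|exact V1]. intros eps He.
    unfold Rdiv. rewrite Rabs_mult, Rabs_inv, !Rabs_mult, (Rabs_right 2), (Rabs_right eps),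
      (Rabs_right lam) by lra. unfold k. field. repeat split; lra.
  - apply remainder2_le with (1 * C * (Rabs a0 + 1)); [unfold q in *; lra|].
    intros eps x b s x' b' s' He B B'. unfold rem2, Rdiv. rewrite !(Rmult_comm _ (/ eps)).
    refine (R2 _ V2 eps x b s x' b' s' He B B'). intros h Hh.
    rewrite Rabs_right by (apply Rle_ge, Rlt_le, Rinv_0_lt_compat, Hh). field. lra.
Qed.

Lemma stationary_divided eps a beta s : 0 < eps ->
  stationary om lam c d Fm rho1 rho2 eps a beta s ->
  G1 om lam Fm a beta + eps * A_1 om lam d Fm a beta s = - (rho1 eps a beta s / eps) /\
  G2 om d Fm a beta s + eps * A_2 om lam c d Fm a beta s = - (rho2 eps a beta s / eps).
Proof.
  intros He [E1 E2]. unfold rhs_amplitude in E1. unfold rhs_phase in E2.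
  set (g1 := G1 om lam Fm a beta) in *. set (g2 := G2 om d Fm a beta s) in *.
  set (f1 := A_1 om lam d Fm a beta s) in *. set (f2 := A_2 om lam c d Fm a beta s) in *.
  split; apply Rmult_eq_reg_l with eps; try lra; field_simplify; lra.
Qed.

(* sin beta and cos beta are eliminated in favour of G1 and G2, which are O(eps)
   at stationary points. *)
Lemma resonance_identities eps a beta s : a <> 0 ->
  let g1 := G1 om lam Fm a beta in let g2 := G2 om d Fm a beta s in
  resonance_cos om c d Fm eps a beta s
    = 2 * om * a * (g2 + eps * A_2 om lam c d Fm a beta s)
      + eps * (2 * om * a * g2 * (s / (2 * om) + 3 * d * a ^ 2 / (16 * om ^ 2)) - lam * g1 / 2) /\
  resonance_sin om lam Fm eps a beta s
    = 2 * om * (g1 + eps * A_1 om lam d Fm a beta s)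
      + eps * (2 * om * g1 * (s / (2 * om) + 9 * d * a ^ 2 / (16 * om ^ 2)) + lam * a * g2 / 2).
Proof.
  intros Ha g1 g2. unfold g1, g2, resonance_cos, resonance_sin, G1, G2, A_1, A_2.
  split; field; lra.
Qed.

(** The first two bounds feed [residual_bound]; the last two are the stationary equations of the
    claim with their O(eps^2) made explicit. *)
Lemma stationary_resonance : exists K e1, 0 <= K /\ 0 < e1 <= 1 /\
  forall eps a beta s, 0 < eps < e1 -> in_range Fm m M a beta s ->
    stationary om lam c d Fm rho1 rho2 eps a beta s ->
    Rabs (resonance_cos om c d Fm eps a beta s) <= K * eps ^ 2 /\
    Rabs (resonance_sin om lam Fm eps a beta s) <= K * eps ^ 2 /\
    Rabs (G1 om lam Fm a beta + eps * A_1 om lam d Fm a beta s) <= K * eps ^ 2 /\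
    Rabs (G2 om d Fm a beta s + eps * A_2 om lam c d Fm a beta s) <= K * eps ^ 2.
Proof.
  destruct remainder_bounds as [C [e1 [HC [He1 [V1 V2]]]]].
  set (D := fun x => 0 < op_e x < e1 /\ in_range Fm m M (op_a x) (op_phi x) (op_s x) /\
    stationary om lam c d Fm rho1 rho2 (op_e x) (op_a x) (op_phi x) (op_s x)).
  set (e2 := fun x => op_e x ^ 2).
  assert (He : forall x, D x -> 0 < op_e x <= 1 /\ Rabs (op_e x) = op_e x /\ Rabs (e2 x) = e2 x).
  { intros x [He _]. unfold e2. generalize (pow2_ge_0 (op_e x)). intros.
    rewrite !Rabs_right; lra. }
  assert (Be : bdd D op_e).
  { apply bdd_intro with 1. intros x Hx. destruct (He x Hx) as [G [-> _]]. lra. }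
  assert (Ba : bdd D op_a).
  { apply bdd_intro with M. intros x [_ [[_ [Hx _]] _]]. lra. }
  assert (Bs : bdd D op_s).
  { apply bdd_intro with M. intros x [_ [[_ [_ [_ Hx]]] _]]. lra. }
  assert (Bi : bdd D (fun x => / op_a x)).
  { apply bdd_inv with m; [lra|]. intros x [_ [[_ [Hx _]] _]]. lra. }
  assert (Hane : forall x, D x -> op_a x <> 0).
  { intros x [_ [[_ [Hx _]] _]] E. rewrite E, Rabs_R0 in Hx. lra. }
  assert (Or : forall rho, (forall x, D x ->
      Rabs (rho (op_e x) (op_a x) (op_phi x) (op_s x)) <= C * op_e x ^ 3) ->
    bigO D e2 (fun x => - (rho (op_e x) (op_a x) (op_phi x) (op_s x) / op_e x))).
  { intros rho Hr. apply bigO_intro with C. intros x Hx.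
    destruct (He x Hx) as [G [_ ->]]. unfold e2, Rdiv.
    assert (Hie : 0 < / op_e x) by (apply Rinv_0_lt_compat; lra).
    rewrite Rabs_Ropp, Rabs_mult, (Rabs_right (/ op_e x)) by lra.
    apply Rle_trans with (C * op_e x ^ 3 * / op_e x); [apply Rmult_le_compat_r; [lra|auto]|].
    right. field. lra. }
  assert (O1 : bigO D e2 (fun x => G1 om lam Fm (op_a x) (op_phi x)
      + op_e x * A_1 om lam d Fm (op_a x) (op_phi x) (op_s x))).
  { apply bigO_ext with (fun x => - (rho1 (op_e x) (op_a x) (op_phi x) (op_s x) / op_e x)).
    - intros x [Hx [_ Hs]]. now apply stationary_divided.
    - apply Or. intros x [Hx [B _]]. now apply (V1 _ _ _ _ _ _ _ Hx B B). }
  assert (O2 : bigO D e2 (fun x => G2 om d Fm (op_a x) (op_phi x) (op_s x)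
      + op_e x * A_2 om lam c d Fm (op_a x) (op_phi x) (op_s x))).
  { apply bigO_ext with (fun x => - (rho2 (op_e x) (op_a x) (op_phi x) (op_s x) / op_e x)).
    - intros x [Hx [_ Hs]]. now apply stationary_divided.
    - apply Or. intros x [Hx [B _]]. now apply (V2 _ _ _ _ _ _ _ Hx B B). }
  assert (Oe : bigO D op_e e2) by now apply bigO_sqr.
  assert (BA1 : bdd D (fun x => A_1 om lam d Fm (op_a x) (op_phi x) (op_s x)))
    by (unfold A_1; bdd_solve).
  assert (BA2 : bdd D (fun x => A_2 om lam c d Fm (op_a x) (op_phi x) (op_s x))).
  { apply bigO_ext with (fun x => - lam ^ 2 / (8 * om)
      - 15 * d ^ 2 * op_a x ^ 4 / (256 * om ^ 3) - 5 * c ^ 2 * op_a x ^ 2 / (12 * om ^ 3)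
      + op_s x * Fm * cos (op_phi x) / (4 * om ^ 2) * / op_a x
      + 3 * d * op_a x * Fm * cos (op_phi x) / (32 * om ^ 3)
      - lam * Fm * sin (op_phi x) / (8 * om ^ 2) * / op_a x).
    - intros x Hx. unfold A_2. field. split; [now apply Hane|lra].
    - bdd_solve. }
  assert (OG1 : bigO D op_e (fun x => G1 om lam Fm (op_a x) (op_phi x))).
  { apply bigO_ext with (fun x => (G1 om lam Fm (op_a x) (op_phi x)
      + op_e x * A_1 om lam d Fm (op_a x) (op_phi x) (op_s x))
      - A_1 om lam d Fm (op_a x) (op_phi x) (op_s x) * op_e x); [intros; ring|].
    apply bigO_minus; [apply bigO_trans with (1 := O1), Oe|].
    apply bigO_bdd_l; [exact BA1|apply bigO_refl]. }
  assert (OG2 : bigO D op_e (fun x => G2 om d Fm (op_a x) (op_phi x) (op_s x))).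
  { apply bigO_ext with (fun x => (G2 om d Fm (op_a x) (op_phi x) (op_s x)
      + op_e x * A_2 om lam c d Fm (op_a x) (op_phi x) (op_s x))
      - A_2 om lam c d Fm (op_a x) (op_phi x) (op_s x) * op_e x); [intros; ring|].
    apply bigO_minus; [apply bigO_trans with (1 := O2), Oe|].
    apply bigO_bdd_l; [exact BA2|apply bigO_refl]. }
  assert (Omul : forall f, bigO D op_e f -> bigO D e2 (fun x => op_e x * f x)).
  { intros f Hf. apply bigO_mult_sqr; [apply bigO_refl|exact Hf]. }
  assert (ORc : bigO D e2 (fun x => resonance_cos om c d Fm (op_e x) (op_a x) (op_phi x) (op_s x))).
  { eapply bigO_ext; [intros x Hx; apply resonance_identities; now apply Hane|].
    cbv beta zeta. apply bigO_plus; [apply bigO_bdd_l; [bdd_solve|exact O2]|].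
    apply Omul. apply bigO_minus.
    - apply bigO_ext with (fun x => 2 * om * op_a x * (op_s x / (2 * om)
        + 3 * d * op_a x ^ 2 / (16 * om ^ 2)) * G2 om d Fm (op_a x) (op_phi x) (op_s x));
        [intros; ring|].
      apply bigO_bdd_l; [bdd_solve|exact OG2].
    - apply bigO_ext with (fun x => lam / 2 * G1 om lam Fm (op_a x) (op_phi x));
        [intros; field|].
      apply bigO_bdd_l; [bdd_solve|exact OG1]. }
  assert (ORs : bigO D e2 (fun x => resonance_sin om lam Fm (op_e x) (op_a x) (op_phi x) (op_s x))).
  { eapply bigO_ext; [intros x Hx; apply resonance_identities; now apply Hane|].
    cbv beta zeta. apply bigO_plus; [apply bigO_bdd_l; [bdd_solve|exact O1]|].
    apply Omul. apply bigO_plus.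
    - apply bigO_ext with (fun x => 2 * om * (op_s x / (2 * om)
        + 9 * d * op_a x ^ 2 / (16 * om ^ 2)) * G1 om lam Fm (op_a x) (op_phi x));
        [intros; ring|].
      apply bigO_bdd_l; [bdd_solve|exact OG1].
    - apply bigO_ext with (fun x => lam / 2 * op_a x * G2 om d Fm (op_a x) (op_phi x) (op_s x));
        [intros; field|].
      apply bigO_bdd_l; [bdd_solve|exact OG2]. }
  clear V1 V2.
  destruct ORc as [K1 [HK1 V1]], ORs as [K2 [HK2 V2]], O1 as [K3 [HK3 V3]], O2 as [K4 [HK4 V4]].
  exists (K1 + K2 + K3 + K4), e1. split; [lra|]. split; [exact He1|].
  intros eps a beta s Heps B S.
  set (x := OrbitPoint eps a s beta 0 0 0).
  assert (Hx : D x) by (split; [exact Heps|split; assumption]).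
  assert (E2 := pow2_ge_0 eps).
  generalize (V1 x Hx) (V2 x Hx) (V3 x Hx) (V4 x Hx) (He x Hx).
  unfold e2, x; cbn [op_e op_a op_s op_phi]. intros W1 W2 W3 W4 [_ [_ E]].
  rewrite E in *.
  assert (T : forall k, k <= K1 + K2 + K3 + K4 ->
    k * eps ^ 2 <= (K1 + K2 + K3 + K4) * eps ^ 2) by (intros; now apply Rmult_le_compat_r).
  generalize (T K1 ltac:(lra)) (T K2 ltac:(lra)) (T K3 ltac:(lra)) (T K4 ltac:(lra)). lra.
Qed.

End Normalization.

(** In [sigma1star], 29 / 12 = 2 + 5 / 12: the 2 matches the shift a1 along the backbone, the 5 / 12
    the d^2 term of the free frequency, and the c^2 terms agree. What is left at order eps^2 is -
    lam^2 / (4 om), due to damping alone. *)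
Lemma frequency_gap (om lam c d Fm M K : R) (nu : R -> R -> R) :
  0 < om -> 0 < lam -> 0 <= K -> free_frequency om c d nu ->
  let a0 := a0star om lam Fm in let s0 := sigma0star om lam d Fm in
  exists C e1, 0 <= C /\ 0 < e1 <= 1 /\ forall eps a s, 0 < eps < e1 -> Rabs a <= M ->
    Rabs (a - (a0 + eps * a1star om lam d Fm)) <= K * eps ^ 2 ->
    Rabs (s - (s0 + eps * sigma1star om lam c d Fm)) <= K * eps ^ 2 ->
    Rabs (om + eps * s - nu eps a + eps ^ 2 * (lam ^ 2 / (4 * om))) <= C * eps ^ 3.
Proof.
  intros Hom Hlam HK Hnu a0 s0.
  destruct (Hnu M) as [Cn [en [Hen Vn]]].
  set (D := fun x => 0 < op_e x < 1 /\ Rabs (op_a x) <= M /\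
    Rabs (op_a x - (a0 + op_e x * a1star om lam d Fm)) <= K * op_e x ^ 2 /\
    Rabs (op_s x - (s0 + op_e x * sigma1star om lam c d Fm)) <= K * op_e x ^ 2).
  set (e2 := fun x => op_e x ^ 2).
  assert (He : forall x, D x -> 0 < op_e x <= 1 /\ Rabs (op_e x) = op_e x /\ Rabs (e2 x) = e2 x).
  { intros x [He _]. unfold e2. generalize (pow2_ge_0 (op_e x)). intros.
    rewrite !Rabs_right; lra. }
  assert (Be : bdd D op_e).
  { apply bdd_intro with 1. intros x Hx. destruct (He x Hx) as [G [-> _]]. lra. }
  assert (Ba : bdd D op_a) by (apply bdd_intro with M; intros x Hx; apply Hx).
  assert (Oa : bigO D e2 (fun x => op_a x - (a0 + op_e x * a1star om lam d Fm))).
  { apply bigO_intro with K. intros x Hx. destruct (He x Hx) as [_ [_ ->]]. apply Hx. }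
  assert (Os : bigO D e2 (fun x => op_s x - (s0 + op_e x * sigma1star om lam c d Fm))).
  { apply bigO_intro with K. intros x Hx. destruct (He x Hx) as [_ [_ ->]]. apply Hx. }
  assert (Oe : bigO D op_e e2) by now apply bigO_sqr.
  assert (Oa1 : bigO D op_e (fun x => op_a x - a0)).
  { apply bigO_ext with (fun x => (op_a x - (a0 + op_e x * a1star om lam d Fm))
      + a1star om lam d Fm * op_e x); [intros; ring|].
    apply bigO_plus; [apply bigO_trans with (1 := Oa), Oe|].
    apply bigO_bdd_l; [bdd_solve|apply bigO_refl]. }
  assert (Omul : forall f g, bigO D op_e f -> bigO D op_e g -> bigO D e2 (fun x => g x * f x)).
  { intros f g Hf Hg. now apply bigO_mult_sqr. }
  assert (O : bigO D e2 (fun x => op_s x - 3 * d * op_a x ^ 2 / (8 * om)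
      - op_e x * (- (5 * c ^ 2 * op_a x ^ 2) / (12 * om ^ 3)
                  - 15 * d ^ 2 * op_a x ^ 4 / (256 * om ^ 3))
      + op_e x * (lam ^ 2 / (4 * om)))).
  { apply bigO_ext with (fun x => (op_s x - (s0 + op_e x * sigma1star om lam c d Fm))
      - 3 * d / (8 * om) * (2 * a0 * (op_a x - (a0 + op_e x * a1star om lam d Fm))
                            + (op_a x - a0) * (op_a x - a0))
      + (5 * c ^ 2 / (12 * om ^ 3) * (op_a x + a0)
         + 15 * d ^ 2 / (256 * om ^ 3) * (op_a x + a0) * (op_a x ^ 2 + a0 ^ 2))
        * (op_e x * (op_a x - a0))).
    - intros x _. unfold sigma1star, a1star. fold a0 s0.
      replace s0 with (3 * d * a0 ^ 2 / (8 * om)) by reflexivity.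
      generalize a0. intros A. field. lra.
    - apply bigO_plus; [apply bigO_minus|].
      + exact Os.
      + apply bigO_bdd_l; [bdd_solve|]. apply bigO_plus.
        * apply bigO_bdd_l; [bdd_solve|exact Oa].
        * apply Omul; exact Oa1.
      + apply bigO_bdd_l; [bdd_solve|]. apply Omul; [exact Oa1|apply bigO_refl]. }
  destruct O as [C [HC V]].
  exists (C + Rabs Cn), (Rmin 1 en). assert (HCn := Rabs_pos Cn).
  split; [lra|]. split; [split; [apply Rmin_glb_lt; lra|apply Rmin_l]|].
  intros eps a s Heps HaM Ha Hs.
  assert (He1 : eps < 1) by (apply Rlt_le_trans with (1 := proj2 Heps), Rmin_l).
  assert (He2 : eps < en) by (apply Rlt_le_trans with (1 := proj2 Heps), Rmin_r).
  assert (Vn' := Vn eps a ltac:(lra) HaM).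
  assert (Hx : D (OrbitPoint eps a s 0 0 0 0))
    by (unfold D; simpl op_e; simpl op_a; simpl op_s; lra).
  assert (V' := V _ Hx). destruct (He _ Hx) as [_ [_ E]]. rewrite E in V'. unfold e2 in V'.
  cbn [op_e op_a op_s] in V'.
  match type of V' with Rabs ?A <= _ => match type of Vn' with Rabs ?B <= _ =>
    replace (om + eps * s - nu eps a + eps ^ 2 * (lam ^ 2 / (4 * om))) with (eps * A - B)
      by (field; lra) end end.
  unfold Rminus at 1. triangle.
  rewrite Rabs_Ropp, Rabs_mult, (Rabs_right eps) by lra.
  assert (He3 : 0 < eps ^ 3) by (apply pow_lt; lra).
  assert (Cn * eps ^ 3 <= Rabs Cn * eps ^ 3)
    by (apply Rmult_le_compat_r; [lra|apply Rle_abs]).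
  apply Rmult_le_compat_l with (r := eps) in V'; [|lra].
  replace (eps * (C * eps ^ 2)) with (C * eps ^ 3) in V' by ring. lra.
Qed.

Lemma approximation_periodic om c d eps freq a b t : freq <> 0 ->
  approximation om c d eps freq a b (t + 2 * PI / freq) = approximation om c d eps freq a b t.
Proof.
  intros Hf. unfold approximation.
  assert (E : freq * (t + 2 * PI / freq) + b = freq * t + b + 2 * INR 1 * PI)
    by (simpl; field; exact Hf).
  rewrite E. set (p := freq * t + b).
  replace (2 * (p + 2 * INR 1 * PI)) with (2 * p + 2 * INR 2 * PI) by (simpl; ring).
  replace (3 * (p + 2 * INR 1 * PI)) with (3 * p + 2 * INR 3 * PI) by (simpl; ring).
  now rewrite !cos_period.
Qed.

(** At (a0, - PI / 2) the two damping terms of [A_2] cancel, and its d^2 term equals - 5 s0^2 / (12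
    om), which completes 2 to 29 / 12. *)
Lemma sigma1star_eq om lam c d Fm : 0 < om -> 0 < lam -> Fm <> 0 ->
  - 2 * sigma0star om lam d Fm ^ 2 / om - lam ^ 2 / (4 * om)
    + alpha2 om lam c d Fm 1 0 (sigma0star om lam d Fm)
  = sigma1star om lam c d Fm.
Proof.
  intros Hom Hlam HFm. unfold alpha2, A_2, sigma1star. rewrite sin_shift, cos_shift, sin_0, cos_0.
  generalize (a0star_neq0 om lam Fm Hom Hlam HFm) (Fm_eq om lam Fm Hom Hlam).
  assert (Es : sigma0star om lam d Fm = 3 * d * a0star om lam Fm ^ 2 / (8 * om)) by reflexivity.
  revert Es. generalize (a0star om lam Fm) (sigma0star om lam d Fm). intros A S -> HA ->.
  field. lra.
Qed.

(** Transfer from the normalized variables back to (a, beta). Since x > 0 in the box, |a| = |a0| x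
    and maximal |a| means maximal x. *)
Lemma maximal_stationary_point (om lam c d Fm m M : R) (rho1 rho2 : R -> R -> R -> R -> R) :
  0 < om -> 0 < lam -> Fm <> 0 -> remainder_O3 Fm rho1 -> remainder_O3 Fm rho2 ->
  0 < m < Rabs (a0star om lam Fm) -> Rabs (a0star om lam Fm) < M ->
  Rabs (sigma0star om lam d Fm) < M ->
  exists K e1 delta, 0 <= K /\ 0 < e1 <= 1 /\ 0 < delta /\ forall eps, 0 < eps < e1 ->
    (forall s, Rabs (s - sigma0star om lam d Fm) <= delta -> exists a beta,
       in_range Fm m M a beta s /\ stationary om lam c d Fm rho1 rho2 eps a beta s) /\
    (exists a beta s, max_amplitude om lam c d Fm rho1 rho2 m M eps a beta s) /\
    (forall a beta s, max_amplitude om lam c d Fm rho1 rho2 m M eps a beta s ->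
       Rabs (s - (sigma0star om lam d Fm + eps * sigma1star om lam c d Fm)) <= K * eps ^ 2 /\
       Rabs (a - (a0star om lam Fm + eps * a1star om lam d Fm)) <= K * eps ^ 2 /\
       Rabs (beta - (beta0star + eps * beta1star om lam)) <= K * eps ^ 2).
Proof.
  intros Hom Hlam HFm Hr1 Hr2 Hm HMa HMs.
  set (a0 := a0star om lam Fm) in *. set (s0 := sigma0star om lam d Fm) in *.
  assert (Ha0 : a0 <> 0) by (apply a0star_neq0; assumption).
  assert (Hpa := Rabs_pos_lt _ Ha0).
  destruct (normalized_bounds om lam Fm m M Hom Hlam HFm Hm HMa) as [Hx1 Hx2].
  fold a0 in Hx1, Hx2. set (x1 := m / Rabs a0) in *. set (x2 := M / Rabs a0) in *.
  destruct (normalized_corrections om lam c d Fm m M rho1 rho2 Hom Hlam HFm Hr1 Hr2 Hm HMa)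
    as [C [er [HC [Her [Hal [Rr1 Rr2]]]]]].
  fold a0 x1 x2 in Hal, Rr1, Rr2.
  destruct (corrections_small om lam s0 x1 x2 M C er (alpha2 om lam c d Fm)
    (rem1 om lam Fm rho1) (rem2 om lam Fm rho2) HC Her Hal Rr1 Rr2)
    as [C1 [HC1 [S1 S2]]].
  destruct (stationary_existence lam s0 x1 x2 M C1 er _ _ Hlam Hx1 Hx2 HMs HC1 (proj1 Her) S1 S2)
    as [ea [eta [delta [Hea [Heta [Hdelta Hex]]]]]].
  destruct (maximum_location om lam s0 x1 x2 M C er (alpha2 om lam c d Fm)
    (rem1 om lam Fm rho1) (rem2 om lam Fm rho2) Hom Hlam Hx1 Hx2 HMs HC Her Hal Rr1 Rr2)
    as [eb [K [Heb [HK Hloc]]]].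
  destruct (small_epsilon (lam / (2 * om)) eta) as [ec [Hec Hsm]];
    [apply Rlt_le, Rdiv_lt_0_compat; lra|exact Heta|].
  destruct (common_bound ea eb (proj1 Hea) (proj1 Heb)) as [ed [Hed [Heda Hedb]]].
  destruct (common_bound ed ec Hed (proj1 Hec)) as [e1 [He1 [He1d He1c]]].
  exists (K + Rabs a0 * K), e1, delta.
  assert (HaK : 0 <= Rabs a0 * K) by (apply Rmult_le_pos; lra).
  split; [lra|]. split; [lra|]. split; [exact Hdelta|].
  intros eps He.
  destruct (Hex eps ltac:(lra)) as [Hphase [Hdet [xm [bm [sm [Bm [Sm Hmax]]]]]]].
  assert (Hto : forall x b s, phase_box x1 x2 M x b s ->
    normalized_stationary lam s0
      (fun eps x b s => eps * amplitude_correction om lam s0 x b s + rem1 om lam Fm rho1 eps x b s)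
      (fun eps x b s => eps * alpha2 om lam c d Fm x b s + rem2 om lam Fm rho2 eps x b s)
      eps x b s ->
    in_range Fm m M (a0 * x) (b - PI / 2) s /\
    stationary om lam c d Fm rho1 rho2 eps (a0 * x) (b - PI / 2) s).
  { intros x b s B S. split.
    - now apply in_range_normalized.
    - apply stationary_normalized; try assumption; [lra|]. destruct B as [Bx _]. lra. }
  assert (Hfrom : forall a beta s, in_range Fm m M a beta s ->
    stationary om lam c d Fm rho1 rho2 eps a beta s ->
    phase_box x1 x2 M (a / a0) (beta + PI / 2) s /\
    normalized_stationary lam s0
      (fun eps x b s => eps * amplitude_correction om lam s0 x b s + rem1 om lam Fm rho1 eps x b s)
      (fun eps x b s => eps * alpha2 om lam c d Fm x b s + rem2 om lam Fm rho2 eps x b s)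
      eps (a / a0) (beta + PI / 2) s).
  { intros a beta s B S.
    assert (B' := in_range_denormalize om lam Fm m M Hom Hlam HFm Hm a beta s B).
    split; [exact B'|]. apply stationary_normalized; try assumption; [lra| |].
    - fold a0 x1 in B'. destruct B' as [Bx _]. lra.
    - fold a0. replace (a0 * (a / a0)) with a by (field; exact Ha0).
      now replace (beta + PI / 2 - PI / 2) with beta by ring. }
  assert (Habs : forall x, x1 <= x -> Rabs (a0 * x) = Rabs a0 * x).
  { intros x Hx. rewrite Rabs_mult, (Rabs_right x) by lra. reflexivity. }
  assert (Hdiv : forall a, a = a0 * (a / a0)) by (intros; field; exact Ha0).
  split; [|split].
  - intros s Hs. destruct (Hdet s Hs) as [x [b [B S]]].
    exists (a0 * x), (b - PI / 2). now apply Hto.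
  - exists (a0 * xm), (bm - PI / 2), sm. destruct (Hto _ _ _ Bm Sm) as [T1 T2].
    split; [exact T2|]. split; [exact T1|].
    intros a' beta' s' S' B'. destruct (Hfrom _ _ _ B' S') as [T3 T4].
    assert (Hle := Hmax _ _ _ T3 T4). rewrite (Hdiv a').
    destruct T3 as [T3 _]. destruct Bm as [Bm _].
    rewrite !Habs by lra. apply Rmult_le_compat_l; lra.
  - intros a beta s [S [B Hmx]]. destruct (Hfrom _ _ _ B S) as [T1 T2].
    (* The competitor that [maximum_location] asks for. *)
    destruct (Hphase (eps * (lam / (2 * om)))) as [x' [s' [B' S']]].
    { rewrite Rabs_right; [|apply Rle_ge, Rmult_le_pos; [lra|apply Rlt_le, Rdiv_lt_0_compat; lra]].
      rewrite Rmult_comm. apply Rlt_le, Hsm. lra. }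
    destruct (Hto _ _ _ B' S') as [T3 T4].
    assert (Hle : x' <= a / a0).
    { assert (Hle := Hmx _ _ _ T4 T3). rewrite (Hdiv a) in Hle.
      destruct T1 as [T1 _]. destruct B' as [B' _]. rewrite !Habs in Hle by lra.
      now apply Rmult_le_reg_l with (1 := Hpa). }
    destruct (Hloc eps _ _ _ x' s' ltac:(lra) T1 T2 B' S' Hle) as [L1 [L2 L3]].
    assert (Es := sigma1star_eq om lam c d Fm Hom Hlam HFm). fold s0 in Es.
    rewrite Es in L3.
    assert (E2 := pow2_ge_0 eps).
    assert (HaK2 : 0 <= Rabs a0 * K * eps ^ 2) by (apply Rmult_le_pos; lra).
    assert (HK2 : 0 <= K * eps ^ 2) by (apply Rmult_le_pos; lra).
    split; [|split].
    + lra.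
    + replace (a - (a0 + eps * a1star om lam d Fm))
        with (a0 * (a / a0 - (1 - eps * (s0 / om)))).
      * rewrite Rabs_mult. apply Rmult_le_compat_l with (r := Rabs a0) in L2; lra.
      * unfold a1star. fold a0 s0. field. lra.
    + replace (beta - (beta0star + eps * beta1star om lam))
        with (beta + PI / 2 - eps * (lam / (2 * om)))
        by (unfold beta0star, beta1star; ring).
      lra.
Qed.

Theorem proposition2p4
    (omega lambda c d Fm varsigma : R)
    (rho1 rho2 : R -> R -> R -> R -> R) (nu : R -> R -> R)
    (m M K : R)
    (Homega : 0 < omega) (Hlambda : 0 < lambda) (HFm : Fm <> 0)
    (Hvarsigma : 0 < varsigma)
    (Hrho1 : remainder_O3 Fm rho1) (Hrho2 : remainder_O3 Fm rho2)
    (Hnu : free_frequency omega c d nu)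
    (Hm : 0 < m < Rabs (a0star omega lambda Fm))
    (HMa : Rabs (a0star omega lambda Fm) < M)
    (HMs : Rabs (sigma0star omega lambda d Fm) < M)
    (HK : 0 <= K) :
  sigma0star omega lambda d Fm
    = 3 * d * Fm ^ 2 / (8 * lambda ^ 2 * omega ^ 3) /\
  sigma1star omega lambda c d Fm
    = - (87 * d ^ 2 * a0star omega lambda Fm ^ 4) / (256 * omega ^ 3)
      - 5 * c ^ 2 * a0star omega lambda Fm ^ 2 / (12 * omega ^ 3)
      - lambda ^ 2 / (4 * omega) /\
  exists C eps0 delta : R, 0 < eps0 /\ 0 < delta /\
  forall eps : R, 0 < eps < eps0 ->
  (forall a beta sigma : R,
     in_range Fm m M a beta sigma ->
     stationary omega lambda c d Fm rho1 rho2 eps a beta sigma ->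
     Rabs (- (Fm * sin beta) / (2 * omega) - lambda * a / 2
           + eps * A_1 omega lambda d Fm a beta sigma) <= C * eps ^ 2 /\
     Rabs (- sigma + 3 * d * a ^ 2 / (8 * omega)
           - Fm * cos beta / (2 * a * omega)
           + eps * A_2 omega lambda c d Fm a beta sigma) <= C * eps ^ 2) /\
  (forall sigma : R,
     Rabs (sigma - sigma0star omega lambda d Fm) <= delta ->
     exists a beta : R, in_range Fm m M a beta sigma /\
       stationary omega lambda c d Fm rho1 rho2 eps a beta sigma) /\
  (exists a beta sigma : R,
     max_amplitude omega lambda c d Fm rho1 rho2 m M eps a beta sigma) /\
  (forall a beta sigma : R,
     max_amplitude omega lambda c d Fm rho1 rho2 m M eps a beta sigma ->
     let freq := omega + eps * sigma in
     let T := varsigma / eps ^ 2 in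
     let t0 := zero_phase_time freq beta in
     Rabs (sigma - (sigma0star omega lambda d Fm
                    + eps * sigma1star omega lambda c d Fm)) <= C * eps ^ 2 /\
     Rabs (a - (a0star omega lambda Fm
                + eps * a1star omega lambda d Fm)) <= C * eps ^ 2 /\
     Rabs (beta - (beta0star + eps * beta1star omega lambda)) <= C * eps ^ 2 /\
     Rabs (freq - (omega + eps * sigma0star omega lambda d Fm
                   + eps ^ 2 * sigma1star omega lambda c d Fm))
       <= C * eps ^ 3 /\
     freq <> nu eps a /\ Rabs (freq - nu eps a) <= C * eps ^ 2 /\
     (forall t : R,
        approximation omega c d eps freq a beta (t + 2 * PI / freq)
        = approximation omega c d eps freq a beta t) /\
     0 < t0 < T /\
     (forall u0 v0 : R,
        Rabs (u0 - initial_value omega c d eps a) <= K * eps ^ 3 ->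
        Rabs v0 <= K * eps ^ 3 ->
        (exists u : R -> R,
           forced_solution omega lambda c d Fm eps freq T u /\
           u t0 = u0 /\ Derive u t0 = v0) /\
        (forall u : R -> R,
           forced_solution omega lambda c d Fm eps freq T u ->
           u t0 = u0 -> Derive u t0 = v0 ->
           exists r : R -> R, C2_bounded C T r /\
           forall t : R, 0 < t < T ->
             u t = approximation omega c d eps freq a beta t
                   + eps ^ 3 * r t))).
Proof.
  split; [unfold sigma0star, a0star; field; lra|].
  split; [unfold sigma1star, sigma0star; field; lra|].
  destruct (maximal_stationary_point omega lambda c d Fm m M rho1 rho2 Homega Hlambda HFm
    Hrho1 Hrho2 Hm HMa HMs) as [K1 [e1 [delta [HK1 [He1 [Hdelta Hmax]]]]]].
  destruct (stationary_resonance omega lambda c d Fm m M rho1 rho2 Homega Hrho1 Hrho2 Hm)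
    as [K2 [e2 [HK2 [He2 Hres]]]].
  destruct (frequency_gap omega lambda c d Fm M K1 nu Homega Hlambda HK1 Hnu)
    as [K3 [e3 [HK3 [He3 Hgap]]]].
  set (a0 := a0star omega lambda Fm) in *. set (s0 := sigma0star omega lambda d Fm) in *.
  set (a1 := a1star omega lambda d Fm) in *. set (s1 := sigma1star omega lambda c d Fm) in *.
  (* Covers both requirements of [admissible]: the O(eps) distance to (a0, s0), hence the
     first-order coefficients, and the resonance bound K2. *)
  set (K0 := K1 + K2 + Rabs a1 + Rabs s1).
  assert (Ha1 := Rabs_pos a1). assert (Hs1 := Rabs_pos s1).
  assert (HK0 : 0 <= K0) by (unfold K0; lra).
  destruct (forced_response omega lambda c d Fm a0 s0 K0 K Homega Hlambda HK0
    (backbone_eq omega lambda d Fm Homega)) as [e4 [K4 [He4 [HK4 Hresp]]]].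
  destruct (frequency_bounds omega a0 s0 K0 Homega HK0) as [e5 [He5 Hfreq]].
  set (g := lambda ^ 2 / (4 * omega)).
  assert (Hg : 0 < g) by (unfold g; apply Rdiv_lt_0_compat; [apply pow_lt|]; lra).
  assert (HPI := PI_RGT_0).
  (* Below e6 the O(eps^3) error is smaller than the gap g eps^2, whence freq <> nu. *)
  destruct (small_epsilon K3 g HK3 Hg) as [e6 [He6 Hsm6]].
  (* Below e7 the zero-phase time, at most PI / (omega / 2), precedes varsigma / eps^2. *)
  destruct (small_epsilon (PI / (omega / 2)) varsigma) as [e7 [He7 Hsm7]];
    [apply Rlt_le, Rdiv_lt_0_compat; lra|exact Hvarsigma|].
  (* Below e8 the phase beta stays negative, so that the zero-phase time is positive. *)
  destruct (small_epsilon (K1 + lambda / (2 * omega)) (PI / 2)) as [e8 [He8 Hsm8]];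
    [assert (0 < lambda / (2 * omega)) by (apply Rdiv_lt_0_compat; lra); lra|lra|].
  set (e := Rmin (Rmin (Rmin e1 e2) (Rmin e3 e4)) (Rmin (Rmin e5 e6) (Rmin e7 e8))).
  assert (He : 0 < e /\ e <= e1 /\ e <= e2 /\ e <= e3 /\ e <= e4 /\ e <= e5 /\ e <= e6 /\
               e <= e7 /\ e <= e8).
  { assert (L : forall x y z, x <= Rmin y z -> x <= y /\ x <= z).
    { intros x y z H. split; apply Rle_trans with (1 := H); [apply Rmin_l|apply Rmin_r]. }
    split; [unfold e; repeat apply Rmin_glb_lt; lra|].
    destruct (L e _ _ (Rle_refl e)) as [L1 L2]. destruct (L _ _ _ L1) as [L3 L4].
    destruct (L _ _ _ L2) as [L5 L6].
    generalize (L _ _ _ L3) (L _ _ _ L4) (L _ _ _ L5) (L _ _ _ L6).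
    lra. }
  set (C := K1 + K2 + K3 + g + K4).
  exists C, e, delta. split; [lra|]. split; [exact Hdelta|].
  intros eps Heps.
  assert (E2 : 0 < eps ^ 2) by (apply pow_lt; lra).
  assert (E32 : eps ^ 3 <= eps ^ 2) by nra.
  assert (E21 : eps ^ 2 <= eps) by nra.
  assert (T2 : forall k, k <= C -> k * eps ^ 2 <= C * eps ^ 2)
    by (intros; apply Rmult_le_compat_r; lra).
  destruct (Hmax eps ltac:(lra)) as [Hdet [Hexm Hloc]].
  split; [|split; [exact Hdet|split; [exact Hexm|]]].
  - intros a beta sigma B S.
    destruct (Hres eps a beta sigma ltac:(lra) B S) as [_ [_ [V1 V2]]].
    generalize (T2 K2 ltac:(unfold C; lra)). unfold G1 in V1. unfold G2 in V2. lra.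
  - intros a beta sigma Hm' freq T t0.
    destruct (Hloc a beta sigma Hm') as [Ls [La Lb]].
    destruct Hm' as [S [B _]].
    destruct (Hres eps a beta sigma ltac:(lra) B S) as [Rc [Rs _]].
    assert (Hlin : forall x x0 x1, Rabs (x - (x0 + eps * x1)) <= K1 * eps ^ 2 ->
              Rabs (x - x0) <= (K1 + Rabs x1) * eps).
    { intros x x0 x1 H.
      replace (x - x0) with ((x - (x0 + eps * x1)) + eps * x1) by ring.
      triangle.
      rewrite (Rabs_mult eps), (Rabs_right eps) by lra.
      assert (K1 * eps ^ 2 <= K1 * eps) by (apply Rmult_le_compat_l; lra). lra. }
    assert (HK0e : forall k, k <= K0 -> k * eps <= K0 * eps)
      by (intros; apply Rmult_le_compat_r; lra).
    assert (HK0e2 : K2 * eps ^ 2 <= K0 * eps ^ 2)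
      by (apply Rmult_le_compat_r; unfold K0; lra).
    assert (Hnear : forall f, eps < f -> near_backbone a0 s0 K0 f eps a sigma).
    { intros f Hf. split; [lra|]. split.
      - apply Rle_trans with (1 := Hlin _ _ _ La), HK0e. unfold K0; lra.
      - apply Rle_trans with (1 := Hlin _ _ _ Ls), HK0e. unfold K0; lra. }
    assert (Hadm : admissible omega lambda c d Fm a0 s0 K0 e4 eps a beta sigma).
    { split; [apply Hnear; lra|]. lra. }
    assert (Hfr : omega / 2 <= freq <= 2 * omega) by (apply (Hfreq eps a); apply Hnear; lra).
    destruct B as [_ [[_ HaM] [HbP _]]].
    assert (HG := Hgap eps a sigma ltac:(lra) HaM La Ls). fold freq g in HG.
    assert (HK3e : K3 * eps ^ 3 < g * eps ^ 2).
    { replace (K3 * eps ^ 3) with (K3 * eps * eps ^ 2) by ring.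
      apply Rmult_lt_compat_r; [exact E2|]. apply Hsm6. lra. }
    assert (Hbneg : beta < 0).
    { apply Rabs_le_between in Lb. unfold beta0star, beta1star in Lb.
      assert (K1 * eps ^ 2 <= K1 * eps) by (apply Rmult_le_compat_l; lra).
      generalize (Hsm8 eps ltac:(lra)). lra. }
    assert (Ht0 : 0 < t0 < T).
    { unfold t0, T, zero_phase_time. split; [apply Rdiv_lt_0_compat; lra|].
      apply Rle_lt_trans with (PI / (omega / 2)).
      - apply Rmult_le_compat; try lra; [apply Rlt_le, Rinv_0_lt_compat; lra|].
        apply Rinv_le_contravar; lra.
      - apply Rmult_lt_reg_r with (1 := E2).
        replace (varsigma / eps ^ 2 * eps ^ 2) with varsigma by (field; lra).
        apply Rle_lt_trans with (2 := Hsm7 eps ltac:(lra)).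
        apply Rmult_le_compat_l; [apply Rlt_le, Rdiv_lt_0_compat; lra|lra]. }
    assert (T1 := T2 K1 ltac:(unfold C; lra)).
    split; [lra|]. split; [lra|]. split; [lra|]. split.
    { replace (freq - (omega + eps * s0 + eps ^ 2 * s1)) with (eps * (sigma - (s0 + eps * s1)))
        by (unfold freq; ring).
      rewrite Rabs_mult, (Rabs_right eps) by lra.
      replace (C * eps ^ 3) with (eps * (C * eps ^ 2)) by ring.
      apply Rmult_le_compat_l; lra. }
    split.
    { intros E. rewrite E in HG. apply Rabs_le_between in HG. lra. }
    split.
    { apply Rabs_le_between in HG. apply Rabs_le.
      assert (K3 * eps ^ 3 <= K3 * eps ^ 2) by (apply Rmult_le_compat_l; lra).
      generalize (T2 (K3 + g) ltac:(unfold C; lra)). lra. }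
    split; [intros t; apply approximation_periodic; lra|].
    split; [exact Ht0|].
    intros u0 v0 Hu0 Hv0.
    destruct (Hresp eps a beta sigma T Hadm (proj1 HbP) Ht0 u0 v0 Hu0 Hv0) as [Hex Hall].
    split; [exact Hex|]. intros u Hu Eu Ev.
    destruct (Hall u Hu Eu Ev) as [r [Hr Er]]. exists r. split; [|exact Er].
    intros t Ht. destruct (Hr t Ht) as [R1 [R2 [R3 R4]]].
    split; [exact R1|]. split; [exact R2|]. split; [exact R3|]. unfold C. lra.
Qed.
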